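(* Let $X_\infty=\varprojlim\{f^{i}_{i-1}:X_i\to X_{i-1}\}$ be the weak solenoid with alternating covering degrees $5,3,3,5,3,3,3,5,3,3,3,3,5,\dots$ described in the context. Then the leaves of $X_\infty$ have the following end structures. (1) There is a single leaf with $4$ ends. (2) There is a residual set of leaves with $1$ end (that is, the union of the leaves with $1$ end is a residual subset of $X_\infty$). (3) There is an uncountable meager set of leaves with $2$ ends (that is, the set of leaves with $2$ ends is uncountable and the union of these leaves is a meager subset of $X_\infty$).
   Context: Leaves of $X_\infty$ are its path-connected components, equipped with the leaf topology (in which each leaf is a connected surface covering $X_0$); the number of ends of a leaf is the cardinality of its Freudenthal end space in this topology. Meager means a countable union of nowhere dense sets; residual means having meager complement. Construction of $X_\infty$. Let $(d_i)_{i\ge1}=5,3,3,5,3,3,3,5,3,3,3,3,5,3,\dots$ be the sequence in which the numbers of $3$'s between consecutive $5$'s are $2,3,4,5,\dots$. Define finite based graphs $(\Lambda_k,\mathrm{id}_k)$ with directed edges labelled $a$ or $b$, such that each vertex has exactly one incoming and one outgoing edge of each label, inductively. $\Lambda_0$ has one vertex $\mathrm{id}_0$, one $a$-loop and one $b$-loop. Given $\Lambda_k$, let $e_a$ and $e_b$ be the $a$-edge and the $b$-edge ending at $\mathrm{id}_k$. If $d_{k+1}=3$, take three copies $\Lambda_k^{0},\Lambda_k^{A},\Lambda_k^{B}$ of $\Lambda_k$ and change only the following terminal vertices: the copy of $e_a$ in $\Lambda_k^0$ now ends at the copy of $\mathrm{id}_k$ in $\Lambda_k^A$, and the copy of $e_a$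 in $\Lambda_k^A$ at the copy of $\mathrm{id}_k$ in $\Lambda_k^0$; the copy of $e_b$ in $\Lambda_k^0$ now ends at the copy of $\mathrm{id}_k$ in $\Lambda_k^B$, and the copy of $e_b$ in $\Lambda_k^B$ at the copy of $\mathrm{id}_k$ in $\Lambda_k^0$. If $d_{k+1}=5$, take five copies $\Lambda_k^{0},\Lambda_k^{A_1},\Lambda_k^{A_2},\Lambda_k^{B_1},\Lambda_k^{B_2}$ and change only the following: the copies of $e_a$ in $\Lambda_k^0,\Lambda_k^{A_1},\Lambda_k^{A_2}$ now end at the copies of $\mathrm{id}_k$ in $\Lambda_k^{A_1},\Lambda_k^{A_2},\Lambda_k^0$ respectively; the copies of $e_b$ in $\Lambda_k^0,\Lambda_k^{B_1},\Lambda_k^{B_2}$ now end at the copies of $\mathrm{id}_k$ in $\Lambda_k^{B_1},\Lambda_k^{B_2},\Lambda_k^0$ respectively. In both cases the resulting graph is $\Lambda_{k+1}$, $\mathrm{id}_{k+1}$ is the copy of $\mathrm{id}_k$ in $\Lambda_k^0$, and forgetting the copy gives a label-preserving $d_{k+1}$-fold covering $\Lambda_{k+1}\to\Lambda_k$. Let $X_0$ be the closed orientable surface of genus $2$ with $\pi_1(X_0,x_0)=\langle a,\alpha,b,\beta\mid a\alpha a^{-1}\alpha^{-1}b\beta b^{-1}\beta^{-1}\rangle$, and let $X_k\to X_0$ be the finite connected based covering whose fibre over $x_0$ is the vertex set of $\Lambda_k$, with base point $\mathrm{id}_k$, where lifting the loops $a$ and $b$ moves a vertex along its outgoing $a$-edge,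 respectively $b$-edge, and where $\alpha,\beta$ lift to loops at every vertex. The maps $\Lambda_{k+1}\to\Lambda_k$ on vertices induce covering maps $f^{k+1}_k:X_{k+1}\to X_k$ of degree $d_{k+1}$, and $X_\infty=\varprojlim\{X_k,f^{k+1}_k\}$. *)

(* Defs.v *)
From HB Require Import structures.
From Stdlib Require Import Relations.
From mathcomp Require Import all_boot all_order all_algebra.
From mathcomp Require Import all_classical all_reals all_analysis.
Import Order.TTheory GRing.Theory Num.Theory.
Import numFieldNormedType.Exports.

Set Implicit Arguments.
Unset Strict Implicit.
Unset Printing Implicit Defensive.

Local Open Scope classical_set_scope.
Local Open Scope ring_scope.

(** * The graphs Lambda_k *)

(* The indices i >= 1 with d_i = 5 are 1, 4, 8, 13, 19, ...: there are j + 2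
   threes between the j-th and the (j + 1)-st five (j >= 0). *)
Fixpoint five_index (j : nat) : nat :=
  if j is j'.+1 then (five_index j' + (j' + 2) + 1)%N else 1%N.

(* As five_index j > j, only the j < i can give five_index j = i. *)
Definition is_five (i : nat) : bool := has (fun j => five_index j == i) (iota 0 i).

Definition deg (i : nat) : nat := (if is_five i then 4 else 2).+1.

Inductive label := La | Lb.

(* Each vertex has exactly one outgoing edge of each label, so an edge is given
   by its label and its origin v, and [move l v] is its terminal vertex. *)
Record based_graph := BasedGraph {
  vert :> finType;
  move : label -> vert -> vert;
  base : vert }.

(* The copies of a graph G are numbered 0, 1, 2 for 0, A, B when d = 3, and
   0, 1, 2, 3, 4 for 0, A_1, A_2, B_1, B_2 when d = 5.  The c-th entry of
   [rewire] is the copy whose base point is the new end of the copy of e_l in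
   the c-th copy of G (unchanged if this entry is c). *)
Definition rewire (five : bool) (l : label) : seq nat :=
  match five, l with
  | false, La => [:: 1; 0; 2]
  | false, Lb => [:: 2; 1; 0]
  | true,  La => [:: 1; 2; 0; 3; 4]
  | true,  Lb => [:: 3; 1; 2; 4; 0]
  end%N.

(* The edge e_l is the l-edge whose origin u satisfies [move l u = base G]. *)
Definition copies_move (G : based_graph) (n : nat) (r : label -> seq nat)
    (l : label) (w : G * 'I_n.+1) : G * 'I_n.+1 :=
  (move l w.1,
   if move l w.1 == base G then inord (nth 0%N (r l) w.2) else w.2).

Definition copies (G : based_graph) (n : nat) (r : label -> seq nat) :=
  @BasedGraph (G * 'I_n.+1)%type (@copies_move G n r) (base G, ord0).

Fixpoint Lambda (k : nat) : based_graph :=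
  if k is k'.+1 then copies (Lambda k') (deg k).-1 (rewire (is_five k))
  else @BasedGraph unit (fun _ => id) tt.

Definition forget (k : nat) (w : Lambda k.+1) : Lambda k := w.1.

(** * Paths and coverings *)

Section Paths.
Variable R : realType.

Definition is_path (T : topologicalType) (c : R -> T) :=
  {within `[0, 1], continuous c}.

(* Path component of [x] in the subset [A]. *)
Definition path_component (T : topologicalType) (A : set T) (x : T) : set T :=
  [set y | exists c : R -> T,
     [/\ is_path c, c @` `[0, 1] `<=` A, c 0 = x & c 1 = y]].

(* The path [g] has a lift through [p] going from [x] to [y]. *)
Definition lifts_to (X Y : topologicalType) (p : X -> Y) (g : R -> Y) (x y : X) :=
  exists c : R -> X,
    [/\ is_path c, {in `[0, 1], p \o c =1 g}, c 0 = x & c 1 = y].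

End Paths.

Definition evenly_covered (X Y : topologicalType) (p : X -> Y) (U : set Y) :=
  exists S : set (set X),
    [/\ forall V, S V -> open V,
        trivIset S id,
        \bigcup_(V in S) V = p @^-1` U &
        forall V, S V -> set_bij V U p /\
          (forall W, open W -> W `<=` V -> open (p @` W))].

Definition covering_map (X Y : topologicalType) (p : X -> Y) :=
  continuous p /\
  forall y, exists U, [/\ open U, U y & evenly_covered p U].

(** * The surface of genus 2 as a closed disc with boundary identifications *)

Section Surface.
Variable R : realType.

Definition disc : set (R * R) := [set z | z.1 ^+ 2 + z.2 ^+ 2 <= 1].

(* The unit circle is divided into eight arcs, read counterclockwise. *)
Definition side (i : nat) (t : R) : R * R :=
  (cos ((i%:R + t) * pi / 4), sin ((i%:R + t) * pi / 4)).

(* Boundary word a alpha a^-1 alpha^-1 b beta b^-1 beta^-1. *)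
Definition glue (z w : R * R) : Prop :=
  exists i t, [/\ i \in [:: 0; 1; 4; 5]%N, t \in `[0, 1],
    z = side i t & w = side i.+2 (1 - t)].

(* [q] exhibits X as the quotient of the disc by the equivalence relation
   generated by [glue]; it is a quotient map because the disc is compact and X
   is Hausdorff. *)
Definition genus2_surface (X : topologicalType) (q : R * R -> X) : Prop :=
  [/\ hausdorff_space X,
      {within disc, continuous q},
      q @` disc = [set: X] &
      forall z w, disc z -> disc w ->
        (q z = q w <-> clos_refl_sym_trans (R * R) glue z w)].

Section Loops.
Variables (X : topologicalType) (q : R * R -> X).

Definition x0 : X := q (side 0 0).
Definition loop_a (t : R) : X := q (side 0 t).
Definition loop_alpha (t : R) : X := q (side 1 t).
Definition loop_b (t : R) : X := q (side 4 t).
Definition loop_beta (t : R) : X := q (side 5 t).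

Definition loop (l : label) : R -> X :=
  match l with La => loop_a | Lb => loop_b end.

End Loops.
End Surface.

(** * The tower of coverings and its inverse limit *)

Section Tower.
Variables (X : nat -> topologicalType) (f : forall k, X k.+1 -> X k).

Fixpoint to_base (k : nat) : X k -> X 0%N :=
  match k with
  | 0%N => id
  | k'.+1 => fun x => to_base (f x)
  end.

Definition inverse_limit_set : set (prod_topology X) :=
  [set x : forall k, X k | forall k, f (x k.+1) = x k].

Definition inverse_limit : topologicalType := set_type inverse_limit_set.

End Tower.

Arguments to_base {X} f k _.

(* [fib k] identifies the vertices of Lambda_k with the fibre of X_k over x0;
   the base point of X_k is [fib k (base (Lambda k))]. *)
Record solenoid_tower (R : realType) (X : nat -> topologicalType)
    (q : R * R -> X 0%N) (f : forall k, X k.+1 -> X k)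
    (fib : forall k, Lambda k -> X k) : Prop := SolenoidTower {
  tower_surface : genus2_surface q;
  tower_connected : forall k, connected [set: X k];
  tower_covering : forall k, covering_map (to_base f k);
  tower_fibre : forall k,
    set_bij [set: Lambda k] (to_base f k @^-1` [set x0 q]) (fib k);
  tower_lift : forall k l (v : Lambda k),
    lifts_to (to_base f k) (loop q l) (fib k v) (fib k (move l v));
  tower_lift_alpha : forall k (v : Lambda k),
    lifts_to (to_base f k) (loop_alpha q) (fib k v) (fib k v);
  tower_lift_beta : forall k (v : Lambda k),
    lifts_to (to_base f k) (loop_beta q) (fib k v) (fib k v);
  tower_bonding : forall k, covering_map (f k);
  tower_forget : forall k (w : Lambda k.+1), f k (fib k.+1 w) = fib k (forget w) }.

(** * Leaves *)

Definition is_leaf (R : realType) (T : topologicalType) (L : set T) : Prop :=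
  exists x, L = path_component R setT x.

(* T with the topology whose basic open sets are the path components of the
   open subsets of T.  When T is locally the product of a disc and a Cantor
   set, these are locally the slices disc x {pt}. *)
Definition leafwise (R : realType) (T : topologicalType) : Type := T.

Section LeafTopology.
Variables (R : realType) (T : topologicalType).

HB.instance Definition _ := Choice.on (leafwise R T).

Definition leaf_open (O : set (leafwise R T)) : Prop :=
  forall x, O x -> exists W : set T,
    [/\ open W, W x & path_component R W x `<=` O].

Lemma leaf_openT : leaf_open setT.
Proof. by move=> x _; exists setT; split => //; exact: openT. Qed.

Lemma path_component_sub (A B : set T) x :
  A `<=` B -> path_component R A x `<=` path_component R B x.
Proof.
move=> AB y [c [cc cA c0 c1]]; exists c; split => //.
exact: subset_trans AB.
Qed.

Lemma leaf_openI : setI_closed leaf_open.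
Proof.
move=> O O' oO oO' x [Ox O'x].
have [W [oW Wx WO]] := oO _ Ox; have [W' [oW' W'x WO']] := oO' _ O'x.
exists (W `&` W'); split => //; first exact: openI.
move=> y xy; split.
- by apply: WO; apply: path_component_sub xy => z [].
- by apply: WO'; apply: path_component_sub xy => z [].
Qed.

Lemma leaf_open_bigU (I : Type) (O : I -> set (leafwise R T)) :
  (forall i, leaf_open (O i)) -> leaf_open (\bigcup_i O i).
Proof.
move=> oO x [i _ Oix]; have [W [oW Wx WO]] := oO i _ Oix.
by exists W; split => // y /WO Oiy; exists i.
Qed.

HB.instance Definition _ := isOpenTopological.Build (leafwise R T)
  leaf_openT leaf_openI leaf_open_bigU.

End LeafTopology.

Definition leaf_space (R : realType) (T : topologicalType) (L : set T) :
  topologicalType := set_type (L : set (leafwise R T)).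

(** * Ends *)

(* Freudenthal end space: the inverse limit, over the compact subsets K ordered
   by inclusion, of the sets of connected components of the complement of K. *)
Definition end_space (Y : topologicalType) :
  set ({K : set Y | compact K} -> set Y) :=
  [set e | (forall K, exists2 x, (~` sval K) x &
                e K = connected_component (~` sval K) x) /\
           (forall K K', sval K `<=` sval K' -> e K' `<=` e K)].

Definition has_n_ends (Y : topologicalType) (n : nat) : Prop :=
  (@end_space Y #= `I_n)%card.

(** * Baire category *)

Definition nowhere_dense (T : topologicalType) (A : set T) : Prop :=
  interior (closure A) = set0.

Definition meager (T : topologicalType) (A : set T) : Prop :=
  exists2 F : nat -> set T, (forall n, nowhere_dense (F n)) & A = \bigcup_n F n.

Definition residual (T : topologicalType) (A : set T) : Prop := meager (~` A).

(* The leaves of T with n ends. *)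
Definition leaves_with_ends (R : realType) (T : topologicalType) (n : nat) :
  set (set T) := [set L | is_leaf R L /\ has_n_ends (leaf_space R L) n].

(* Main.v *)
From HB Require Import structures.
From Stdlib Require Import Relations.
From mathcomp Require Import all_boot all_order all_algebra.
From mathcomp Require Import all_classical all_reals all_analysis.
Require Import Defs.
From mathcomp Require Import zify ring lra.
Import Order.TTheory GRing.Theory Num.Theory.
Import numFieldNormedType.Exports.

Set Implicit Arguments.
Unset Strict Implicit.
Unset Printing Implicit Defensive.

(* The fibre of the solenoid over [x0] is the set of sequences of copy numbers,
   on which the free group on a and b acts.  Lifting the disc to every level of
   the tower cuts the solenoid into closed cells, one for each point of the
   fibre.  A leaf is the union of the cells of one orbit, and two of its cells
   meet only if they are joined, through cells containing the common point, in
   the graph of the action; so the ends of a leaf are those of its orbit graph.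
   Lambda_k is a tree of cycles.  A nonzero copy number at level k + 1 means
   that the copy of Lambda_k containing the point is attached to the rest of the
   graph along the edges of a single label.  If both labels occur infinitely
   often, such copies have connected complements: one end.  If from some level
   on only the label l occurs, infinitely often, the graph is a line of l-edges
   with finite decorations: two ends.  The remaining points form the orbit of
   the base point, whose graph has two lines through the base point: four ends.
   The sequences which eventually avoid one of the labels form a meager set;
   they are uncountably many, whereas orbits are countable. *)

(** The action of a and b is an odometer: the copy number at level k changes only when the first k
    copy numbers have just returned to those of the base point. A step that does not end at the base
    point thus changes finitely many copy numbers. So an orbit avoiding the base point is one class
    of sequences with equal tails, while the orbit of the base point is a union of three such
    classes (those of the base point and of its predecessors along a and b), joined at the base
    point. Finite blocks of sequences with equal tails exhaust an orbit, and the components of their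
    complements are told apart by an integer coordinate along the l-line, a mixed-radix number whose
    digits are the ranks of copies on their cycles. On the topological side the obstacle is that all
    corners of the disc are glued together, so cells may meet without being neighbours in the graph.
    Two facts repair this: cells sharing a point are linked by a chain of neighbours through that
    point, and two neighbours share the midpoint of a side, which lies in no third cell. *)

Section CopyNumbers.
Local Open Scope nat_scope.

(** * The two cycles of copies at one level *)

Definition ncopies (five : bool) := (if five then 4 else 2).+1.
Definition nshift five l c := nth 0 (rewire five l) c.
Definition ncut five l c := nshift five l c != c.

(** Position of copy c on the cycle of copies through copy 0 along l; copies off this cycle get the
    default 0, so the value is meaningful only under [ncut]. *)
Definition rank five l c :=
  nth 0 (match five, l with
         | false, La => [:: 0; 1; 0]
         | false, Lb => [:: 0; 0; 1]
         | true, La => [:: 0; 1; 2; 0; 0]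
         | true, Lb => [:: 0; 0; 0; 1; 2]
         end) c.
Definition cycle_length (five : bool) := if five then 3 else 2.
Definition nlast five l :=
  match five, l with
  | false, La => 1 | false, Lb => 2 | true, La => 2 | true, Lb => 4
  end.

Definition other l := if l is La then Lb else La.

Ltac copy_cases five l c :=
  case: five; case: l; case: c => [|[|[|[|[|c]]]]].

Lemma nshift_lt five l c : c < ncopies five -> nshift five l c < ncopies five.
Proof. by copy_cases five l c. Qed.

Lemma nshift_inj five l c c' : c < ncopies five -> c' < ncopies five ->
  nshift five l c = nshift five l c' -> c = c'.
Proof. by copy_cases five l c; case: c' => [|[|[|[|[|c']]]]]. Qed.

Lemma ncut0 five l : ncut five l 0.
Proof. by case: five; case: l. Qed.

(** Every copy but copy 0 sits on exactly one of the two cycles; the count of ends rests on this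
    dichotomy. *)
Lemma ncut_other five l c : c < ncopies five -> c != 0 ->
  ncut five (other l) c = ~~ ncut five l c.
Proof. by copy_cases five l c. Qed.

Lemma nshift_cut five l c : c < ncopies five ->
  ncut five l (nshift five l c) = ncut five l c.
Proof. by copy_cases five l c. Qed.

Lemma rank_shift five l c : c < ncopies five -> ncut five l c ->
  nshift five l c != 0 -> rank five l (nshift five l c) = (rank five l c).+1.
Proof. by copy_cases five l c. Qed.

Lemma rank_last five l c : c < ncopies five -> ncut five l c ->
  nshift five l c = 0 -> (rank five l c).+1 = cycle_length five.
Proof. by copy_cases five l c. Qed.

Lemma rank0 five l : rank five l 0 = 0.
Proof. by case: five; case: l. Qed.

Lemma rank_gt0 five l c : c < ncopies five -> ncut five l c -> c != 0 ->
  0 < rank five l c.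
Proof. by copy_cases five l c. Qed.

Lemma rank_lt five l c : rank five l c < cycle_length five.
Proof. by copy_cases five l c => //; rewrite /rank nth_default. Qed.

Lemma rank_inj five l c c' : c < ncopies five -> c' < ncopies five ->
  ncut five l c -> ncut five l c' -> rank five l c = rank five l c' -> c = c'.
Proof. by copy_cases five l c; case: c' => [|[|[|[|[|c']]]]]. Qed.

Lemma nlast_lt five l : nlast five l < ncopies five.
Proof. by case: five; case: l. Qed.

Lemma nlast_neq0 five l : nlast five l != 0.
Proof. by case: five; case: l. Qed.

Lemma nlast_cut five l : ncut five l (nlast five l).
Proof. by case: five; case: l. Qed.

Lemma nshift_last five l c : c < ncopies five ->
  (nshift five l c == 0) = (c == nlast five l).
Proof. by copy_cases five l c. Qed.

Lemma nshift0_uncut five l : ~~ ncut five l (nshift five (other l) 0).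
Proof. by case: five; case: l. Qed.

Lemma nshift_cut_other five l c : c < ncopies five -> ~~ ncut five l c ->
  nshift five (other l) c = 0 \/ ~~ ncut five l (nshift five (other l) c).
Proof. by copy_cases five l c => //; auto. Qed.

End CopyNumbers.

Lemma otherK : involutive other. Proof. by case. Qed.

Lemma labelP (l l' : label) : l' = l \/ l' = other l.
Proof. by case: l; case: l'; auto. Qed.

(** * Copy numbers at each level and the graphs Lambda_k *)

Section Codes.
Local Open Scope nat_scope.

Notation code k := 'I_(deg k.+1).-1.+1.

Definition shift k l (c : code k) : code k := inord (nshift (is_five k.+1) l c).
(** The copy of e_l in copy c has been rewired, that is, c lies on the l-cycle of copies. Copy 0 is
    cut by both labels. *)
Definition cut k l (c : code k) := shift l c != c.

Lemma code_lt k (c : code k) : c < ncopies (is_five k.+1).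
Proof. exact: ltn_ord. Qed.

Lemma val_shift k l (c : code k) : shift l c = nshift (is_five k.+1) l c :> nat.
Proof. by rewrite inordK //; exact: nshift_lt (code_lt c). Qed.

Lemma cutE k l (c : code k) : cut l c = ncut (is_five k.+1) l c.
Proof. by rewrite /cut /ncut -val_eqE /= val_shift. Qed.

Lemma shift_inj k l : injective (@shift k l).
Proof.
move=> c c' /(congr1 val) /=; rewrite !val_shift => /nshift_inj e.
by apply/val_inj/e; exact: code_lt.
Qed.

Lemma cut0 k l : cut l (ord0 : code k).
Proof. by rewrite cutE ncut0. Qed.

Lemma cut_other k l (c : code k) : c != ord0 -> cut (other l) c = ~~ cut l c.
Proof. by move=> c0; rewrite !cutE ncut_other //; exact: code_lt. Qed.

Lemma shift_uncut k l (c : code k) : ~~ cut l c -> shift l c = c.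
Proof. by move/negPn/eqP. Qed.

Definition lastc k l : code k := inord (nlast (is_five k.+1) l).

Lemma val_lastc k l : lastc k l = nlast (is_five k.+1) l :> nat.
Proof. by rewrite inordK //; exact: nlast_lt. Qed.

Lemma shift_eq0 k l (c : code k) : (shift l c == ord0) = (c == lastc k l).
Proof.
by rewrite -!val_eqE /= val_shift val_lastc nshift_last //; exact: code_lt.
Qed.

Lemma lastc_neq0 k l : lastc k l != ord0.
Proof. by rewrite -val_eqE /= val_lastc nlast_neq0. Qed.

Lemma lastc_cut k l : cut l (lastc k l).
Proof. by rewrite cutE val_lastc nlast_cut. Qed.

Lemma lastc_uncut k l : ~~ cut (other l) (lastc k l).
Proof. by rewrite cut_other ?lastc_neq0// negbK lastc_cut. Qed.

(** * Positions along the cycle of a label through the base point *)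

(** Length of the cycle of either label through the base point of Lambda_k: it doubles when d = 3
    and triples when d = 5. *)
Fixpoint cycle_len k :=
  if k is k'.+1 then cycle_length (is_five k'.+1) * cycle_len k' else 1.

Lemma cycle_len_gt0 k : 0 < cycle_len k.
Proof. by elim: k => //= k IH; rewrite muln_gt0 IH /cycle_length; case: ifP. Qed.

(* The graph Lambda_k is a tree of cycles: every vertex hangs off a unique
   vertex of the l-cycle through the base point, whose index on this cycle,
   counted from the base point, is its height. *)
Fixpoint height l k : Lambda k -> nat :=
  match k with
  | 0 => fun=> 0
  | k'.+1 => fun u => if cut l u.2
      then rank (is_five k'.+1) l u.2 * cycle_len k' + height l u.1 else 0
  end.

Lemma height_base l k : height l (base (Lambda k)) = 0.
Proof. by elim: k => //= k IH; rewrite cut0 rank0 mul0n IH. Qed.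

(** Mixed-radix bound: the leading digit is below [cycle_length] and the rest below its weight
    [cycle_len k]. *)
Lemma height_lt l k (u : Lambda k) : height l u < cycle_len k.
Proof.
elim: k u => [//|k IH] u /=; case: ifP => _; last exact: (cycle_len_gt0 k.+1).
have := rank_lt (is_five k.+1) l u.2; have := IH u.1.
move: (height _ _) (rank _ _ _) (cycle_length _) (cycle_len k) => a b c d ad bc.
apply: (@leq_trans (b.+1 * d)); first by rewrite mulSn addnC ltn_add2r.
by rewrite leq_mul2r bc orbT.
Qed.

Lemma move_copies k l (u : Lambda k.+1) : move l u =
  (move l u.1, if move l u.1 == base (Lambda k) then shift l u.2 else u.2).
Proof. by []. Qed.

Lemma move_inj k l : injective (@move (Lambda k) l).
Proof.
elim: k => [//|k IH] u w; rewrite !move_copies => -[/IH e1].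
rewrite e1 => e2; rewrite (surjective_pairing u) (surjective_pairing w) e1.
congr pair; move: e2; case: ifP => _ //; exact: shift_inj.
Qed.

Lemma base_eqS k (u : Lambda k.+1) :
  (u == base (Lambda k.+1)) = (u.1 == base (Lambda k)) && (u.2 == ord0).
Proof. by rewrite -pair_eqE. Qed.

(** An edge of the other label stays in one decoration of the l-cycle. If it changes the copy, it
    arrives at a base point, so the height inside the copy is 0 by induction, and the old and new
    copies have rank 0 or are off the l-cycle. *)
Lemma height_other l k (u : Lambda k) :
  height l (move (other l) u) = height l u.
Proof.
elim: k u => [//|k IH] u; rewrite move_copies /=.
have := IH u.1; case: eqP => [e|_]; last by move->.
rewrite e height_base => <-; rewrite !addn0.
have [|u2] := boolP (cut (other l) u.2); last by rewrite shift_uncut.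
have [->|u0] := eqVneq u.2 ord0.
  rewrite !cut0 rank0 mul0n => _.
  by rewrite cutE val_shift (negPf (nshift0_uncut _ _)).
rewrite cut_other // => u2; rewrite (negPf u2) cutE val_shift.
case: (@nshift_cut_other (is_five k.+1) l u.2); first exact: code_lt.
- by rewrite -cutE.
- by move->; rewrite rank0 mul0n if_same.
- by move/negPf->.
Qed.

Lemma height_pre l k (u : Lambda k) :
  move l u = base (Lambda k) -> (height l u).+1 = cycle_len k.
Proof.
elim: k u => [//|k IH] u; rewrite move_copies => -[e]; rewrite e eqxx => e2.
rewrite /=.
have c : cut l u.2.
  by apply: contraT => c; have := c; rewrite -(shift_uncut c) e2 cut0.
rewrite c -addnS IH // addnC -mulSn (@rank_last _ l u.2) -?cutE ?code_lt //.
by rewrite -val_shift e2.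
Qed.

Lemma height_move l k (u : Lambda k) : move l u != base (Lambda k) ->
  height l (move l u) = height l u \/ height l (move l u) = (height l u).+1.
Proof.
elim: k u => [|k IH] u; first by case: (move l u).
rewrite base_eqS move_copies /=; case: eqP => [e /= s0|/eqP e _].
  (* The carry: the edge leaves its copy at the last position, given by [height_pre], and the
     leading digit goes up by one if the copy is cut by l. *)
  rewrite e height_base addn0; have hp := height_pre e.
  have [c|c] := boolP (cut l u.2).
    right; rewrite cutE val_shift nshift_cut ?code_lt // -cutE c.
    rewrite rank_shift -?cutE ?code_lt //; last by rewrite -val_shift.
    by rewrite mulSn addnC -hp addnS.
  by left; rewrite shift_uncut // (negPf c).
case: ifP => _; last by left.
by have [->|->] := IH _ e; [left|right; rewrite addnS].
Qed.

(** The copy at the highest nonzero level lies on one cycle only, which makes the other height 0. *)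
Lemma height_excl l k (u : Lambda k) : height l u = 0 \/ height (other l) u = 0.
Proof.
elim: k u => [|k IH] u /=; first by left.
have [u0|u0] := eqVneq u.2 ord0.
  by rewrite u0 !cut0 !rank0 !mul0n; exact: IH.
by rewrite cut_other //; case: ifP => _; [right|left].
Qed.

(** * Points of the fibre as sequences of copy numbers *)

Definition codes := forall k, code k.

Lemma codesP (v w : codes) : (forall k, v k = w k) -> v = w.
Proof. by move=> e; exact: functional_extensionality_dep. Qed.

Fixpoint vert (v : codes) k : Lambda k :=
  if k is k'.+1 then (vert v k', v k') else tt.

Lemma vert_inj (v w : codes) : (forall k, vert v k = vert w k) -> v = w.
Proof. by move=> e; apply: codesP => k; case: (e k.+1). Qed.

Definition mv l (v : codes) : codes := fun k =>
  if move l (vert v k) == base (Lambda k) then shift l (v k) else v k.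

Lemma vert_mv l v k : vert (mv l v) k = move l (vert v k).
Proof. by elim: k => [//|k IH]; rewrite move_copies /= IH. Qed.

Lemma mv_inj l : injective (mv l).
Proof.
by move=> v w e; apply: vert_inj => k; apply: (@move_inj _ l); rewrite -!vert_mv e.
Qed.

(** The inverse of [mv l]: each [move l] is a permutation of a finite graph, and its inverse at
    level k + 1 gives copy number k. *)
Definition mvi l (v : codes) : codes := fun k =>
  (invF (@move_inj k.+1 l) (vert v k.+1)).2.

Lemma vert_mvi l v k : vert (mvi l v) k = invF (@move_inj k l) (vert v k).
Proof.
elim: k => [|k IH]; first by case: (invF _ _).
rewrite /= IH [RHS]surjective_pairing; congr pair.
apply: (@move_inj _ l); rewrite f_invF.
have := f_invF (@move_inj k.+1 l) (vert v k.+1); rewrite move_copies.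
by case.
Qed.

Lemma mviK l : cancel (mvi l) (mv l).
Proof. by move=> v; apply: vert_inj => k; rewrite vert_mv vert_mvi f_invF. Qed.

Lemma mvK l : cancel (mv l) (mvi l).
Proof. by move=> v; apply: (@mv_inj l); rewrite mviK. Qed.

Definition agree m (v w : codes) := forall j, m <= j -> v j = w j.

Lemma agree_refl m v : agree m v v. Proof. by []. Qed.

Lemma agree_sym m v w : agree m v w -> agree m w v.
Proof. by move=> a j /a. Qed.

Lemma agree_trans m v w x : agree m v w -> agree m w x -> agree m v x.
Proof. by move=> a b j mj; rewrite a // b. Qed.

Lemma agreeW m n v w : m <= n -> agree m v w -> agree n v w.
Proof. by move=> mn a j nj; apply: a; exact: leq_trans nj. Qed.

Lemma agree_inj m v w : vert v m = vert w m -> agree m v w -> v = w.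
Proof.
move=> + a; elim: m a => [a _|m IH a [e1 e2]]; first by apply: codesP => k; exact: a.
by apply: IH => // j; rewrite leq_eqVlt => /predU1P[<-//|]; exact: a.
Qed.

Lemma vert_neq_base m n v : m <= n -> vert v m != base (Lambda m) ->
  vert v n != base (Lambda n).
Proof.
elim: n => [|n IH]; first by rewrite leqn0 => /eqP ->.
rewrite leq_eqVlt => /predU1P[->//|/IH{}IH /IH].
by rewrite base_eqS negb_and => ->.
Qed.

(** The base point of a higher level projects to that of Lambda_m, so no copy number from m on is
    touched. *)
Lemma mv_agree m l v : move l (vert v m) != base (Lambda m) -> agree m (mv l v) v.
Proof.
by move=> h j mj; rewrite /mv -vert_mv ifN // (vert_neq_base mj) // vert_mv.
Qed.

(** Reachability by forward edges that never land on the base point. Such a path causes no carry, so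
    it can be followed inside a fixed tail. *)
Inductive reach k : Lambda k -> Prop :=
| reach_base : reach (base (Lambda k))
| reach_move l u : reach u -> move l u != base (Lambda k) -> reach (move l u).

Lemma reach_pre k l : (forall u : Lambda k, reach u) ->
  exists2 u : Lambda k, reach u & move l u = base (Lambda k).
Proof.
by move=> h; exists (invF (@move_inj k l) (base _)); rewrite ?f_invF.
Qed.

Lemma reach_copy k (c : code k) : reach ((base (Lambda k), c) : Lambda k.+1) ->
  (forall u : Lambda k, reach u) -> forall u : Lambda k, reach ((u, c) : Lambda k.+1).
Proof.
move=> rc h u; elim: {u}(h u) => [//|l u _ IH nb].
have -> : ((move l u, c) : Lambda k.+1) = move l ((u, c) : Lambda k.+1).
  by rewrite move_copies /= (negPf nb).
by apply: reach_move => //; rewrite move_copies base_eqS /= (negPf nb).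
Qed.

Lemma reach_shift k l (c : code k) : (forall u : Lambda k, reach u) ->
  shift l c != ord0 ->
  (forall u : Lambda k, reach ((u, c) : Lambda k.+1)) ->
  forall u : Lambda k, reach ((u, shift l c) : Lambda k.+1).
Proof.
move=> h s0 hc; apply: reach_copy => //.
have [u _ e] := reach_pre l h.
have -> : ((base (Lambda k), shift l c) : Lambda k.+1) = move l ((u, c) : Lambda k.+1).
  by rewrite move_copies /= e eqxx.
apply: reach_move => //.
by rewrite move_copies /= e eqxx base_eqS /= eqxx.
Qed.

(** A cycle of copies has length at most 3, so each copy is 0 or one or two shifts away from it; a
    new copy is entered at its own base point. *)
Lemma reach_all k (u : Lambda k) : reach u.
Proof.
elim: k u => [|k IH] u; first by case: u; exact: (reach_base 0).
case: u => u c; have r0 := reach_copy (@reach_base k.+1) IH.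
have r1 l : forall w : Lambda k, reach ((w, shift l ord0) : Lambda k.+1).
  by apply: reach_shift => //; exact: cut0.
suff [->|[l [->|[-> s0]]]] : c = ord0 \/ exists l : label, c = shift l ord0 \/
   c = shift l (shift l (ord0 : code k)) /\ shift l (shift l (ord0 : code k)) != ord0.
- exact: r0.
- exact: r1.
- by apply: reach_shift.
have cl := code_lt c; have [c0|c0] := eqVneq c ord0; first by left.
right; exists (if ncut (is_five k.+1) La c then La else Lb).
have H : forall five l n, n < ncopies five -> n != 0 -> ncut five l n ->
  n = nshift five l 0 \/ n = nshift five l (nshift five l 0) by
  move=> five l n; case: five; case: l; case: n => [|[|[|[|[|n]]]]] //; auto.
have nc : ncut (is_five k.+1) (if ncut (is_five k.+1) La c then La else Lb) c.
  by case: ifP => // /negbT; rewrite -(@ncut_other _ La).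
have {H} := H _ _ _ cl c0 nc; set l := (if _ then _ else _).
case=> e; [left; apply: val_inj; rewrite /= val_shift e//|right].
have -> : c = shift l (shift l (ord0 : code k)).
  by apply: val_inj; rewrite /= !val_shift e.
by split => //; rewrite -val_eqE /= !val_shift -e.
Qed.

Definition orbit : codes -> codes -> Prop :=
  clos_refl_sym_trans codes (fun v w => exists l, w = mv l v).

Lemma orbit_refl v : orbit v v. Proof. exact: rst_refl. Qed.
Lemma orbit_sym v w : orbit v w -> orbit w v. Proof. exact: rst_sym. Qed.
Lemma orbit_trans v w x : orbit v w -> orbit w x -> orbit v x.
Proof. exact: rst_trans. Qed.
Lemma orbit_mv l v : orbit v (mv l v). Proof. by apply: rst_step; exists l. Qed.
Lemma orbit_mvi l v : orbit v (mvi l v).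
Proof. by apply: orbit_sym; rewrite -{2}(mviK l v); exact: orbit_mv. Qed.

Definition set_code m (c : code m) (v : codes) : codes := fun k =>
  if pselect (k = m) is left e then ecast i (code i) (esym e) c else v k.

Lemma set_code_eq m (c : code m) v : set_code c v m = c.
Proof.
rewrite /set_code; case: pselect => // e.
by rewrite (eq_irrelevance e erefl).
Qed.

Lemma set_code_neq m (c : code m) v k : k != m -> set_code c v k = v k.
Proof. by rewrite /set_code => /eqP; case: pselect. Qed.

Fixpoint with_vert m : Lambda m -> codes -> codes :=
  match m with
  | 0 => fun _ v => v
  | m'.+1 => fun u v => with_vert u.1 (set_code (u.2 : code m') v)
  end.

Lemma with_vertP m (u : Lambda m) v :
  vert (with_vert u v) m = u /\ agree m (with_vert u v) v.
Proof.
elim: m u v => [|m IH] u v; first by case: u.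
have [/= e a] := IH u.1 (set_code (u.2 : code m) v); split.
  by rewrite e a // set_code_eq; case: (u).
by move=> j mj; rewrite a ?(ltnW mj) // set_code_neq // gtn_eqF.
Qed.

(** Both sequences are joined to the one with the same tail and the base point as prefix, along
    paths of [reach] in Lambda_m, which leave the tail alone. *)
Lemma agree_orbit m v w : agree m v w -> orbit v w.
Proof.
pose b := with_vert (base (Lambda m)) v.
suff H u : reach u -> forall w, vert w m = u -> agree m w v -> orbit b w.
  move=> a; apply: (@orbit_trans _ b).
    by apply/orbit_sym/(H _ (reach_all (vert v m))).
  by apply: (H _ (reach_all (vert w m))) => //; exact: agree_sym.
have [vb ab] := with_vertP (base (Lambda m)) v.
elim=> [w' e a|l {}u _ IH nb w' e a].
  rewrite (@agree_inj m w' b) ?vb ?e //; first exact: orbit_refl.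
  exact: agree_trans (agree_sym ab).
have [vu au] := with_vertP u v.
have oc := IH _ vu au; apply: orbit_trans oc _.
rewrite (@agree_inj m w' (mv l (with_vert u v))); first exact: orbit_mv.
  by rewrite vert_mv vu.
apply: agree_trans a _; apply: agree_sym; apply: agree_trans au.
by apply: mv_agree; rewrite vu.
Qed.

End Codes.
Notation code k := 'I_(deg k.+1).-1.+1.

Local Open Scope classical_set_scope.

(** * Connected sets and compact unions *)

Section Connectedness.
Variable T : topologicalType.
Implicit Types A B U Z : set T.

Lemma connected_sub_open A U1 U2 : connected A -> open U1 -> open U2 ->
  A `<=` U1 `|` U2 -> A `&` (U1 `&` U2) = set0 -> A `&` U1 !=set0 -> A `<=` U1.
Proof.
move=> cA o1 o2 sA A12 A1; suff -> : A = A `&` U1 by move=> x [].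
apply/esym/cA => //; first by exists U1.
exists (~` U2); first exact: open_closedC.
apply/seteqP; split=> x [Ax H]; split=> //.
  by move=> U2x; have : (A `&` (U1 `&` U2)) x by []; rewrite A12.
by case: (sA _ Ax).
Qed.

Lemma connected_sub_closed A Z1 Z2 : connected A -> closed Z1 -> closed Z2 ->
  A `<=` Z1 `|` Z2 -> A `&` (Z1 `&` Z2) = set0 -> A `&` Z1 !=set0 -> A `<=` Z1.
Proof.
move=> cA c1 c2 sA A12 [x [Ax Z1x]].
have Z2x : ~ Z2 x by move=> Z2x; have : (A `&` (Z1 `&` Z2)) x by []; rewrite A12.
have : A `<=` ~` Z2.
  apply: (@connected_sub_open _ (~` Z2) (~` Z1)) => //; rewrite ?openC //.
  - move=> y Ay; case: (pselect (Z1 y)) => [Z1y|]; last by right.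
    by left=> Z2y; have : (A `&` (Z1 `&` Z2)) y by []; rewrite A12.
  - by rewrite -subset0 => y [Ay [nZ2 nZ1]]; case: (sA _ Ay).
  - by exists x.
by move=> AZ2 y Ay; case: (sA _ Ay) => // /(AZ2 _ Ay).
Qed.

Lemma connected_between A B : connected A -> A `<=` B -> B `<=` closure A ->
  connected B.
Proof.
move=> cA AB BA E E0 [U oU EU] [Z cZ EZ].
have [y Ey] := E0; have := Ey; rewrite {1}EU => -[By Uy].
have [z [Az Uz]] := BA _ By _ (open_nbhs_nbhs (conj oU Uy)).
have AZ : A `<=` Z.
  have : A `&` Z = A; last by move=> <- x [].
  have ZU x : A x -> Z x <-> U x.
    move=> /AB Bx; have : (B `&` Z) x <-> (B `&` U) x by rewrite -EZ -EU.
    by case=> h1 h2; split=> H; [case: h1|case: h2].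
  apply: cA; last by exists Z.
  - by exists z; split=> //; apply/ZU.
  - by exists U => //; apply/seteqP; split=> x [Ax H]; split=> //; apply/ZU.
rewrite EZ; apply/seteqP; split=> [x []//|x Bx]; split=> //.
by move: (closureS AZ (BA _ Bx)); rewrite -(closure_id Z).1.
Qed.

End Connectedness.

Lemma finite_bigcup_compact (Y : topologicalType) (I : choiceType)
    (F : set I) (K : I -> set Y) : finite_set F ->
  (forall i, F i -> compact (K i)) -> compact (\bigcup_(i in F) K i).
Proof.
move=> finF cK; rewrite bigcup_fset_set // big_seq.
by apply: bigsetU_compact => i; rewrite in_fset_set // inE => /cK.
Qed.

(** * Ends of a space built from compact cells *)

(* The label of a vertex outside [F k] is the component of the complement of
   [F k] containing it, and [b k i] is a vertex of the i-th component. *)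
Record exhaustion (I : Type) (O : set I) (adj : I -> I -> Prop) (n : nat)
    (F : nat -> set I) (lab : nat -> I -> 'I_n) (b : nat -> 'I_n -> I) : Prop :=
  Exhaustion {
  exh_finite : forall k, finite_set (F k);
  exh_mono : forall k, F k `<=` F k.+1;
  exh_cover : forall w, O w -> exists k, F k w;
  exh_lab_adj : forall k w w', O w -> O w' -> ~ F k w -> ~ F k w' ->
    adj w w' -> lab k w = lab k w';
  exh_lab_mono : forall k w, O w -> ~ F k.+1 w -> lab k.+1 w = lab k w;
  exh_out : forall k i, [/\ O (b k i), ~ F k (b k i) & lab k (b k i) = i];
  exh_reach : forall k w, O w -> ~ F k w ->
    clos_refl_sym_trans I
      (fun u u' => [/\ O u, O u', ~ F k u, ~ F k u' & adj u u'])
      w (b k (lab k w)) }.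

Section CellularEnds.
Variables (Y : topologicalType) (I : choiceType) (O : set I)
  (cell core : I -> set Y) (adj : I -> I -> Prop).
Hypothesis cell_compact : forall w, O w -> compact (cell w).
Hypothesis cell_cover : forall y, exists2 w, O w & cell w y.
Hypothesis cell_local : forall y, exists2 N, nbhs y N &
  forall w, O w -> N `&` cell w !=set0 -> cell w y.
Hypothesis cell_finite : forall y, finite_set [set w | O w /\ cell w y].
Hypothesis core_connected : forall w, O w -> connected (core w).
Hypothesis core_neq0 : forall w, O w -> core w !=set0.
Hypothesis core_sub : forall w, O w -> core w `<=` cell w.
Hypothesis core_dense : forall w, O w -> cell w `<=` closure (core w).
Hypothesis core_disjoint : forall w w' y, O w -> O w' -> core w y -> cell w' y ->
  w = w'.
Hypothesis adj_common : forall w w', O w -> O w' -> adj w w' ->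
  exists y, [/\ cell w y, cell w' y &
    forall u, O u -> cell u y -> u = w \/ u = w'].
Hypothesis cell_chain : forall w w' y, O w -> O w' -> cell w y -> cell w' y ->
  clos_refl_sym_trans I
    (fun u u' => [/\ O u, O u', cell u y, cell u' y & adj u u']) w w'.

Variables (n : nat) (F : nat -> set I) (lab : nat -> I -> 'I_n)
  (b : nat -> 'I_n -> I).
Hypothesis ex : exhaustion O adj F lab b.

Let F_finite := exh_finite ex.
Let F_mono := exh_mono ex.
Let F_cover := exh_cover ex.
Let lab_adj := exh_lab_adj ex.
Let lab_mono := exh_lab_mono ex.
Let b_out := exh_out ex.
Let b_reach := exh_reach ex.

(** [K k] is a compact block of cells; [U k i] will turn out to be the i-th component of its
    complement. *)
Let K k := \bigcup_(w in F k `&` O) cell w.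
Let U k i := [set y | ~ K k y /\ exists w, [/\ O w, lab k w = i & cell w y]].

Let F_le k k' : (k <= k')%N -> F k `<=` F k'.
Proof.
move=> /subnKC <-; elim: (k' - k)%N => [|m IH]; first by rewrite addn0.
by rewrite addnS; apply: subset_trans IH _; exact: F_mono.
Qed.

Let K_compact k : compact (K k).
Proof.
apply: finite_bigcup_compact; first exact: finite_setIl.
by move=> w [_]; exact: cell_compact.
Qed.

Let K_mono k k' : (k <= k')%N -> K k `<=` K k'.
Proof. by move=> /F_le kk' y [w [Fw Ow] wy]; exists w => //; split=> //; exact: kk'. Qed.

(** A point has a neighbourhood meeting only the cells through it; these are finitely many, hence
    all in some [F k], and compactness makes k uniform. *)
Let compact_subK C : compact C -> exists k, C `<=` K k.
Proof.
move=> /compact_near_coveringP cC.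
suff : \forall k \near \oo, C `<=` K k.
  by case=> k _ /(_ k (leqnn k)) H; exists k.
apply: (cC nat \oo (fun k y => K k y)).
move=> y _; have [N Ny HN] := cell_local y.
  have [k Hk] : exists k, forall w, O w -> cell w y -> F k w.
    have : finite_set [set w | O w /\ cell w y] by [].
    move=> /finite_seqP[s sE].
    have H w : w \in s -> exists k, F k w.
      by move=> ws; have : [set` s] w by []; rewrite -sE => -[] /F_cover.
    suff [k Hk] : exists k, forall w, w \in s -> F k w.
      exists k => w Ow wy; apply: Hk.
      by have : [set w | O w /\ cell w y] w by []; rewrite sE.
    move: H; elim: {sE} s => [|w r IH] H; first by exists 0%N.
    have [|k kP] := IH; first by move=> u ur; apply: H; rewrite inE ur orbT.
    have [k' k'P] := H w (mem_head _ _).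
    exists (maxn k k') => u; rewrite inE => /predU1P[->|/kP].
      by apply: F_le k'P; rewrite leq_maxr.
    by apply: F_le; rewrite leq_maxl.
  exists (N, [set j | (k <= j)%N]) => /=.
    by split=> //; exists k.
  move=> [z j] [/= Nz kj]; have [w Ow wz] := cell_cover z.
  exists w => //; split=> //; apply: (F_le kj); apply: Hk => //.
  by apply: HN => //; exists z.
Qed.

Let cells_closed (P : set I) : closed (\bigcup_(w in P `&` O) cell w).
Proof.
move=> y cy; have [N Ny HN] := cell_local y.
have [z [[w [Pw Ow] wz] Nz]] := cy _ Ny.
by exists w => //; apply: HN => //; exists z.
Qed.

Let cell_out k w y : O w -> cell w y -> ~ K k y -> ~ F k w.
Proof. by move=> Ow wy Ky Fw; apply: Ky; exists w. Qed.

(** The chain of neighbours through y avoids [F k] because y is outside [K k], so the label cannot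
    change along it. *)
Let U_lab k y w w' : ~ K k y -> O w -> O w' -> cell w y -> cell w' y ->
  lab k w = lab k w'.
Proof.
move=> Ky Ow Ow' wy w'y; elim: (cell_chain Ow Ow' wy w'y) => //.
- move=> u u' [Ou Ou' uy u'y]; apply: lab_adj => //; exact: cell_out Ky.
- by move=> u v x _ -> _ ->.
Qed.

Let U_open_cover k y : ~ K k y -> exists i, U k i y.
Proof.
by move=> Ky; have [w Ow wy] := cell_cover y; exists (lab k w); split=> //; exists w.
Qed.

Let U_disjoint k i j y : U k i y -> U k j y -> i = j.
Proof.
by move=> [Ky [w [Ow <- wy]]] [_ [w' [Ow' <- w'y]]]; exact: U_lab Ky _ _ _ _.
Qed.

(** Unions of cells are closed; the cells with label i and those with another label give two closed
    sets that are disjoint outside [K k]. *)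
Let U_max k i C : connected C -> C `<=` ~` K k -> C `&` U k i !=set0 ->
  C `<=` U k i.
Proof.
move=> cC CK [x [Cx Uix]].
have : C `<=` \bigcup_(w in [set w | lab k w = i] `&` O) cell w.
  apply: (@connected_sub_closed _ _ _
    (\bigcup_(w in [set w | lab k w <> i] `&` O) cell w)) => //.
  - move=> y /CK /U_open_cover[j [_ [w [Ow wj wy]]]].
    have [ji|ji] := eqVneq j i; [left|right]; exists w => //; split=> //=;
      by rewrite wj //; exact/eqP.
  - rewrite -subset0 => y [/CK Ky [[w [/= wi Ow] wy] [w' [/= wi' Ow'] wy']]].
    by apply: wi'; rewrite -wi; exact: U_lab Ky _ _ _ _.
  - by exists x; split=> //; case: Uix => _ [w [? ? ?]]; exists w.
by move=> H y Cy; split; [exact: CK|have [w [? ?] ?] := H _ Cy; exists w].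
Qed.

(** A cell outside [F k] may touch [K k] along its boundary; what is left still lies between its
    core and the closure of the core. *)
Let cell_connected k w : O w -> ~ F k w -> connected (cell w `&` ~` K k).
Proof.
move=> Ow Fw; apply: (connected_between (core_connected Ow)).
  move=> y wy; split; first exact: core_sub.
  by move=> [u [Fu Ou] uy]; apply: Fw; rewrite (core_disjoint Ow Ou wy uy).
by move=> y [wy _]; exact: core_dense.
Qed.

Let core_out k w y : O w -> ~ F k w -> core w y -> ~ K k y.
Proof.
move=> Ow Fw wy [x [Fx Ox] xy]; apply: Fw.
by rewrite (core_disjoint Ow Ox wy xy).
Qed.

Let core_cell k w : O w -> ~ F k w -> core w `<=` cell w `&` ~` K k.
Proof. by move=> Ow Fw y wy; split; [exact: core_sub|exact: core_out Fw wy]. Qed.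

(** Neighbouring cells share a point lying in no third cell, hence outside [K k]; there their
    remainders are joined. *)
Let cells_join k u v : O u -> ~ F k u -> clos_refl_sym_trans I
    (fun u u' => [/\ O u, O u', ~ F k u, ~ F k u' & adj u u']) u v ->
  exists C, [/\ connected C, C `<=` ~` K k, core u `<=` C & core v `<=` C].
Proof.
move=> Ou Fu uv.
(* The generated relation is symmetric, so being outside [F k] has to be carried in both
   directions. *)
suff [_] : ((O u /\ ~ F k u) <-> (O v /\ ~ F k v)) /\ ((O u /\ ~ F k u) ->
    exists C, [/\ connected C, C `<=` ~` K k, core u `<=` C & core v `<=` C]).
  by apply.
elim: uv => [w w' [Ow Ow' Fw Fw' ww']|w|w w' _ [ww' IH]|x y z _ [xy IH] _ [yz IH']].
- split=> // _; have [y [wy w'y Hy]] := adj_common Ow Ow' ww'.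
  exists ((cell w `&` ~` K k) `|` (cell w' `&` ~` K k)); split.
  + apply: connectedU; [|exact: cell_connected|exact: cell_connected].
    have Ky : ~ K k y by move=> [x [Fx Ox] /(Hy _ Ox)[] xw]; subst x.
    by exists y.
  + by move=> z [] [].
  + by move=> z /(core_cell Ow Fw); left.
  + by move=> z /(core_cell Ow' Fw'); right.
- split=> // -[Ow Fw]; exists (core w); split=> //; first exact: core_connected.
  by move=> z /(core_cell Ow Fw)[].
- by split=> [|/ww'/IH[C [? ? ? ?]]]; [rewrite ww'|exists C].
- split=> [|hx]; first by rewrite xy.
  have [Oy Fy] := xy.1 hx; have [C [cC CK xC yC]] := IH hx.
  have [D [cD DK yD zD]] := IH' (conj Oy Fy).
  exists (C `|` D); split.
  + apply: connectedU => //; have [t yt] := core_neq0 Oy.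
    by exists t; split; [exact: yC|exact: yD].
  + by move=> t [/CK|/DK].
  + by move=> t /xC; left.
  + by move=> t /zD; right.
Qed.

Let pt k i : {y | core (b k i) y}.
Proof. by apply: cid; apply: core_neq0; case: (b_out k i). Qed.

Let pt_U k i : U k i (sval (pt k i)).
Proof.
have [Ob Fb li] := b_out k i; have := svalP (pt k i) => bp.
split; first exact: core_out Fb bp.
by exists (b k i); split=> //; exact: core_sub.
Qed.

Let U_component k i y : U k i y -> connected_component (~` K k) y = U k i.
Proof.
move=> Uy; apply/seteqP; split=> [z|z].
  move=> [C [Cy CK cC] Cz]; suff: C `<=` U k i by apply.
  by apply: U_max => //; exists y.
suff H x : U k i x -> connected_component (~` K k) (sval (pt k i)) x.
  move=> Uz; apply: (@connected_component_trans _ _ (sval (pt k i))).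
    by apply: connected_component_sym; exact: H.
  exact: H.
move=> [Kx [w [Ow wi wx]]]; have Fw := cell_out Ow wx Kx.
have := b_reach Ow Fw; rewrite wi => /(cells_join Ow Fw)[C [cC CK wC bC]].
have Cp := bC _ (svalP (pt k i)).
have [t wt] := core_neq0 Ow.
apply: (@connected_component_trans _ _ t).
  by exists C => //; exact: wC.
exists (cell w `&` ~` K k) => //; split=> //; first exact: core_cell.
  exact: cell_connected.
Qed.

Let U_mono k k' i : (k <= k')%N -> U k' i `<=` U k i.
Proof.
move=> /subnKC <-; elim: (k' - k)%N => [|m IH]; first by rewrite addn0.
apply: subset_trans IH; rewrite addnS => y [Ky [w [Ow wi wy]]]; split.
  by move=> H; apply: Ky; exact: K_mono H.
exists w; split=> //; rewrite -wi; apply/esym/lab_mono => //.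
exact: cell_out Ky.
Qed.

Let rk (C : {C : set Y | compact C}) : {k | sval C `<=` K k} :=
  cid (compact_subK (svalP C)).

Let end_of (i : 'I_n) (C : {C : set Y | compact C}) : set Y :=
  connected_component (~` sval C) (sval (pt (sval (rk C)) i)).

(** Two admissible indices are compared at their maximum, since [U] decreases with the index. *)
Let end_ofE i C k y : sval C `<=` K k -> U k i y ->
  end_of i C = connected_component (~` sval C) y.
Proof.
move=> Ck Uy; apply: same_connected_component.
have H k' x x' : sval C `<=` K k' -> U k' i x -> U k' i x' ->
    connected_component (~` sval C) x x'.
  move=> Ck' Ux Ux'; exists (U k' i) => //; split=> //.
    by move=> z [Kz _] Cz; apply: Kz; exact: Ck'.
  by rewrite -(U_component Ux); exact: component_connected.
set m := maxn k (sval (rk C)).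
apply: (@connected_component_trans _ _ (sval (pt m i))).
  apply: (H _ _ _ (svalP (rk C))); first exact: pt_U.
  by apply: U_mono (pt_U _ _); exact: leq_maxr.
by apply: (H _ _ _ Ck) => //; apply: U_mono (pt_U _ _); exact: leq_maxl.
Qed.

Let Kc k : {C : set Y | compact C} := exist _ (K k) (@K_compact k).

Let end_ofK i k : end_of i (Kc k) = U k i.
Proof. by rewrite (@end_ofE i (Kc k) k _ _ (pt_U k i)) // (U_component (pt_U k i)). Qed.

(** An end picks one [U k i] for every k, and monotonicity forces the same i throughout. As every
    compact set lies in some [K k], this i determines the end. *)
Lemma cellular_ends : has_n_ends Y n.
Proof.
have inj i j : end_of i = end_of j -> i = j.
  move=> e; have := pt_U 0 i; rewrite -end_ofK e end_ofK => Uj.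
  exact: U_disjoint (pt_U 0 i) Uj.
rewrite /has_n_ends; suff -> : @end_space Y = end_of @` [set: 'I_n].
  apply: (card_eq_trans (B := [set: 'I_n])).
    by apply: inj_card_eq => i j _ _; exact: inj.
  by rewrite card_eq_sym; exact: card_II.
apply/seteqP; split=> [e [comp mono]|_ [i _ <-]]; last first.
  split=> [C|C C' CC'].
    exists (sval (pt (sval (rk C)) i)) => //.
    by have [+ _] := pt_U (sval (rk C)) i; apply: contra_not; exact: (svalP (rk C)).
  have Ck := svalP (rk C'); have Up := pt_U (sval (rk C')) i.
  rewrite (end_ofE Ck Up) (end_ofE (subset_trans CC' Ck) Up).
  move=> y [D [? DC ?] ?]; exists D => //; split=> // z /DC; apply: contra_not.
  exact: CC'.
have [i Hi] : exists i, forall k, e (Kc k) = U k i.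
  have eK k : exists i, e (Kc k) = U k i.
    have [x Kx ->] := comp (Kc k); have [i Ui] := U_open_cover Kx.
    by exists i; exact: U_component.
  have [i ei] := eK 0%N; exists i; elim=> [//|k IH].
  have [j ej] := eK k.+1.
  have : e (Kc k.+1) `<=` e (Kc k) by apply: mono; exact: K_mono.
  rewrite ej IH => s; have := s _ (pt_U k.+1 j) => Ui.
  by have <- : j = i by apply: U_disjoint Ui; exact: U_mono (leqnSn k) _ (pt_U _ _).
exists i => //; apply: functional_extensionality_dep => C.
have [k Ck] := compact_subK (svalP C).
rewrite (end_ofE Ck (pt_U k i)).
have [x Cx Ex] := comp C; rewrite Ex; apply/esym/same_connected_component.
by rewrite -Ex; apply: (mono C (Kc k)) => //; rewrite Hi; exact: pt_U.
Qed.

End CellularEnds.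

HB.instance Definition _ := gen_eqMixin codes.
HB.instance Definition _ := gen_choiceMixin codes.

(** * Exhaustions of orbit graphs by finite blocks *)

Section Exhaustions.
Local Open Scope nat_scope.

Definition adj (w w' : codes) := exists l, w' = mv l w \/ w = mv l w'.

Definition joined (O F : set codes) : codes -> codes -> Prop :=
  clos_refl_sym_trans codes
    (fun u u' => [/\ O u, O u', ~ F u, ~ F u' & adj u u']).

Lemma adj_orbit v w w' : adj w w' -> orbit v w -> orbit v w'.
Proof.
move=> [l [->|->]] vw; first exact: orbit_trans vw (orbit_mv _ _).
exact: orbit_trans vw (orbit_sym (orbit_mv _ _)).
Qed.

Lemma adj_sym w w' : adj w w' -> adj w' w.
Proof. by move=> [l []]; exists l; [right|left]. Qed.

Lemma adj_mv l w : adj w (mv l w). Proof. by exists l; left. Qed.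

Lemma orbit_ind v (P : codes -> Prop) : (forall l w, P w <-> P (mv l w)) ->
  P v -> forall w, orbit v w -> P w.
Proof.
move=> HP Pv w vw; suff : P v <-> P w by move=> [h _]; exact: h.
elim: vw => [x _ [l ->]|//|x y _ ->//|x y z _ -> _ ->//].
exact: HP.
Qed.

(** A walk from w to f inside the orbit must enter F; the vertex just before has property B and is
    joined to w outside F. *)
Lemma reach_boundary v (F : set codes) (B : codes -> Prop) f :
  orbit v f -> F f ->
  (forall w u, orbit v w -> ~ F w -> F u -> adj w u -> B w) ->
  forall w, orbit v w -> ~ F w ->
  exists b, [/\ orbit v b, ~ F b, B b & joined (orbit v) F w b].
Proof.
move=> vf Ff HB w vw nFw.
pose P x := orbit v x -> F x \/
  exists b, [/\ orbit v b, ~ F b, B b & joined (orbit v) F x b].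
have PP x y : adj x y -> P y -> P x.
  move=> xy Py vx; have [|nFx] := pselect (F x); [by left|right].
  have vy := adj_orbit xy vx; have [Fy|nFy] := pselect (F y).
    by exists x; split=> //; [exact: HB Fy xy|exact: rst_refl].
  have [//|[b [vb Fb Bb yb]]] := Py vy.
  exists b; split=> //; apply: rst_trans yb.
  by apply: rst_step; split.
suff /(_ vw)[] : P w by [].
apply: (orbit_ind (v := f) (P := P)); last 2 first.
- by move=> _; left.
- exact: orbit_trans (orbit_sym vf) vw.
move=> l x; split; apply: PP; [apply: adj_sym|]; exact: adj_mv.
Qed.

(** The vertices of the copy of Lambda_k that contains v. *)
Definition tail_class k v : set codes := [set w | agree k w v].

Lemma tail_class_finite k v : finite_set (tail_class k v).
Proof.
apply: (@sub_finite_set _ _ ((fun u => with_vert u v) @` [set: Lambda k])).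
  move=> w wv; exists (vert w k) => //.
  have [e a] := with_vertP (vert w k) v; apply: (agree_inj e).
  exact: agree_trans a (agree_sym wv).
exact: finite_image.
Qed.

Lemma subsequence (P : nat -> Prop) : (forall N, exists2 k, N <= k & P k) ->
  exists kappa : nat -> nat, [/\ forall n, P (kappa n),
    forall n, kappa n < kappa n.+1 & forall n, n <= kappa n].
Proof.
move=> H; have g N : {k | N <= k & P k} by apply: cid2; exact: H.
pose kappa := fix kap n := if n is n'.+1 then s2val (g (kap n').+1) else s2val (g 0).
exists kappa; have lt n : kappa n < kappa n.+1 by exact: (s2valP (g (kappa n).+1)).
split=> //; first by case=> [|n];
  [exact: (s2valP' (g 0))|exact: (s2valP' (g (kappa n).+1))].
by elim=> // n IH; exact: leq_ltn_trans (lt n).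
Qed.

(** * Boundary of a tail class *)

Section Boundary.
Variables (k : nat) (l : label) (v : codes).

(** Along l, a copy of Lambda_k can be left only by its copy of e_l and entered only at its base
    point. [out_vertex] is the end of the first edge, [in_vertex] the origin of the second. *)
Definition out_vertex := mv l (with_vert (invF (@move_inj k l) (base _)) v).
Definition in_vertex := mvi l (with_vert (base (Lambda k)) v).

Lemma mv_code w : move l (vert w k) = base _ -> mv l w k = shift l (w k).
Proof. by rewrite /mv => ->; rewrite eqxx. Qed.

Lemma out_vertexP u : agree k u v -> move l (vert u k) = base _ ->
  mv l u = out_vertex.
Proof.
move=> uv e; congr mv; have [e' a] := with_vertP (invF (@move_inj k l) (base _)) v.
apply: (@agree_inj k); last exact: agree_trans uv (agree_sym a).
by rewrite e'; apply: (@move_inj _ l); rewrite f_invF.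
Qed.

Lemma in_vertexP u : agree k (mv l u) v -> vert (mv l u) k = base _ ->
  u = in_vertex.
Proof.
move=> uv e; rewrite -(mvK l u); congr mvi.
have [e' a] := with_vertP (base (Lambda k)) v.
by apply: (@agree_inj k); rewrite ?e' //; exact: agree_trans uv (agree_sym a).
Qed.

Hypothesis v_cut : cut l (v k).

Lemma out_vertex_orbit : orbit v out_vertex.
Proof.
apply: orbit_trans (orbit_mv _ _); apply/orbit_sym/(@agree_orbit k).
by have [] := with_vertP (invF (@move_inj k l) (base _)) v.
Qed.

Lemma in_vertex_orbit : orbit v in_vertex.
Proof.
apply: orbit_trans (orbit_mvi _ _); apply/orbit_sym/(@agree_orbit k).
by have [] := with_vertP (base (Lambda k)) v.
Qed.

Lemma out_vertex_out : ~ agree k out_vertex v.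
Proof.
rewrite /out_vertex; have [e a] := with_vertP (invF (@move_inj k l) (base _)) v.
move=> /(_ k (leqnn k)); rewrite mv_code ?e ?f_invF // a //.
by move/eqP: v_cut.
Qed.

Lemma in_vertex_out : ~ agree k in_vertex v.
Proof.
have [e a] := with_vertP (base (Lambda k)) v => /(_ k (leqnn k)) ik.
have := mv_code (w := in_vertex); rewrite -vert_mv mviK e => /(_ erefl).
by rewrite a // ik; apply/eqP; rewrite eq_sym.
Qed.

End Boundary.

Section NonzeroCode.
Variables (k : nat) (v : codes).
Hypothesis v0 : v k != ord0.

(** A nonzero copy number at level k stops carries: a move landing at such a vertex changes nothing
    beyond level k. *)
Lemma vertS_neq_base w : w k = v k -> vert w k.+1 != base (Lambda k.+1).
Proof. by rewrite base_eqS /= => ->; rewrite negb_and v0 orbT. Qed.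

Lemma uncut_mv l u : ~~ cut l (v k) -> agree k u v -> agree k (mv l u) v.
Proof.
move=> c uv; have [e|e] := eqVneq (move l (vert u k)) (base _); last first.
  exact: agree_trans (mv_agree e) uv.
have ek : mv l u k = v k by rewrite mv_code // uv // shift_uncut.
move=> j; rewrite leq_eqVlt => /predU1P[<-//|kj].
rewrite -uv ?(ltnW kj) //; apply: (mv_agree _ kj).
by rewrite -vert_mv; exact: vertS_neq_base.
Qed.

Lemma uncut_mv_inv l u : ~~ cut l (v k) -> agree k (mv l u) v -> agree k u v.
Proof.
move=> c uv; have [e|e] := eqVneq (move l (vert u k)) (base _); last first.
  exact: agree_trans (agree_sym (mv_agree e)) uv.
have ek : u k = v k.
  by apply: (@shift_inj k l); rewrite -mv_code // uv // shift_uncut.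
move=> j; rewrite leq_eqVlt => /predU1P[<-//|kj].
rewrite -uv ?(ltnW kj) //; apply/esym/(mv_agree _ kj).
by rewrite -vert_mv; apply: vertS_neq_base; exact: uv.
Qed.

(** Where the copy number is nonzero and cut by l, edges of the other label never leave the copy, so
    it has one exit and one entrance. *)
Lemma boundary l w u : cut l (v k) -> agree k u v -> ~ agree k w v -> adj w u ->
  w = out_vertex k l v \/ w = in_vertex k l v.
Proof.
move=> c uv wv [l' [e|e]].
- right; subst u; case: (labelP l l') => ll; subst l'; last first.
    by case: wv; apply: uncut_mv_inv uv; rewrite cut_other // c.
  apply: in_vertexP => //; apply/eqP/negP => /negP nb; apply: wv.
  by apply: agree_trans uv; apply/agree_sym/mv_agree; rewrite -vert_mv.
- left; subst w; case: (labelP l l') => ll; subst l'; last first.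
    by case: wv; apply: uncut_mv => //; rewrite cut_other // c.
  apply: out_vertexP => //; apply/eqP/negP => /negP nb; apply: wv.
  exact: agree_trans (mv_agree nb) uv.
Qed.

End NonzeroCode.

Definition zero_code : codes := fun k => ord0.
(** The origin of the l-edge into the base point; along this edge the carry runs through all
    levels. *)
Definition last_code l : codes := fun k => lastc k l.

Lemma vert_zero k : vert zero_code k = base (Lambda k).
Proof. by elim: k => //= k ->. Qed.

Lemma zero_codeP v : (forall k, vert v k = base (Lambda k)) -> v = zero_code.
Proof. by move=> e; apply: vert_inj => k; rewrite e vert_zero. Qed.

Lemma mv_last l : mv l (last_code l) = zero_code.
Proof.
apply: zero_codeP => k; rewrite vert_mv; elim: k => [|k IH] //.
rewrite move_copies /= IH eqxx; congr pair; apply/eqP.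
by rewrite shift_eq0.
Qed.

Lemma nonzero_vert v : v <> zero_code -> exists k, vert v k != base (Lambda k).
Proof.
move=> v0; apply/not_existsP => H; apply: v0; apply: zero_codeP => k.
by have /negP/negPn/eqP := H k.
Qed.

Lemma orbit_agree v w : ~ orbit v zero_code -> orbit v w -> exists m, agree m w v.
Proof.
move=> v0 vw; suff : orbit v w -> exists m, agree m w v by apply.
apply: (orbit_ind (v := v)
  (P := fun w => orbit v w -> exists m, agree m w v)) (vw); last by exists 0.
move=> l {vw}w; split=> H vw.
  have [|m a] := H; first exact: orbit_trans vw (orbit_sym (orbit_mv _ _)).
  have [k nb] : exists k, vert (mv l w) k != base (Lambda k).
    by apply: nonzero_vert => e; apply: v0; rewrite -e.
  exists (maxn m k); apply: agree_trans (agreeW (leq_maxl _ _) a).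
  by apply: agreeW (leq_maxr _ _) _; apply: mv_agree; rewrite -vert_mv.
have vw' := orbit_trans vw (orbit_mv l w).
have [m a] := H vw'; have [k nb] : exists k, vert (mv l w) k != base (Lambda k).
  by apply: nonzero_vert => e; apply: v0; rewrite -e.
exists (maxn m k); apply: agree_trans (agreeW (leq_maxl _ _) a).
by apply: agreeW (leq_maxr _ _) _; apply/agree_sym/mv_agree; rewrite -vert_mv.
Qed.

(** * Orbits with one end *)

Definition nonzero_cut l (v : codes) :=
  forall N, exists2 k, N <= k & v k != ord0 /\ cut l (v k).

(** The only moves whose carry does not stop are those into the base point, and they start at some
    [last_code l]. *)
Lemma zero_orbit_tail v : orbit zero_code v ->
  exists m, agree m v zero_code \/ exists l, agree m v (last_code l).
Proof.
apply: (orbit_ind (v := zero_code) (P := fun v => exists m, agree m v zero_code \/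
   exists l, agree m v (last_code l))); last by exists 0; left.
move=> l w; have [e|/nonzero_vert[k nb]] := pselect (mv l w = zero_code).
  split=> _; first by exists 0; left; rewrite e.
  exists 0; right; exists l.
  by rewrite (_ : w = last_code l) //; apply: (@mv_inj l); rewrite mv_last.
have a : agree k (mv l w) w by apply: mv_agree; rewrite -vert_mv.
have H x y : agree k x y -> (exists m, agree m y zero_code \/
     exists l, agree m y (last_code l)) -> exists m, agree m x zero_code \/
     exists l, agree m x (last_code l).
  move=> xy [m yt]; exists (maxn m k).
  have xy' := agreeW (leq_maxr m k) xy.
  case: yt => [yt|[l' yt]]; [left|right; exists l'];
    exact: agree_trans xy' (agreeW (leq_maxl m k) yt).
by split; apply: H => //; exact: agree_sym.
Qed.

Lemma nonzero_notin_orbit (v : codes) : (forall N, exists2 k, N <= k & v k != ord0) ->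
  orbit v zero_code -> exists l N, forall k, N <= k -> v k = lastc k l.
Proof.
move=> nz /orbit_sym/zero_orbit_tail[m [a|[l a]]].
  by have [k mk] := nz m; rewrite a // eqxx.
by exists l, m => k mk; rewrite a.
Qed.

Lemma iter_vert_mv l n v k : vert (iter n (mv l) v) k = iter n (move l) (vert v k).
Proof. by elim: n => //= n IH; rewrite vert_mv IH. Qed.

(* If l is not cut at level m, then the l-cycle through the base point of the
   tail class at level k < m closes up, and it joins the two boundary vertices. *)
Lemma out_in_joined k m l v : k < m -> v k != ord0 -> v m != ord0 ->
  cut l (v k) -> ~~ cut l (v m) ->
  joined (orbit v) (tail_class k v) (out_vertex k l v) (in_vertex k l v).
Proof.
move=> km vk vm ck cm; set o := out_vertex k l v.
pose e := with_vert (invF (@move_inj k l) (base _)) v.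
have oe : o = mv l e by [].
have ea : agree k e v by have [] := with_vertP (invF (@move_inj k l) (base _)) v.
have em n : agree m (iter n (mv l) e) v.
  elim: n => [|n IH]; first exact: agreeW (ltnW km) ea.
  exact: uncut_mv.
(* The tail from m on is fixed along the walk, and [move l] permutes the finite graph Lambda_m, so e
   is periodic. *)
have [n nP] : exists n, iter n.+1 (mv l) e = e.
  have := iter_order (@move_inj m l) (vert e m).
  have := order_gt0 (@move (Lambda m) l) (vert e m).
  case: (order _ _) => // n _ it; exists n.
  apply: (@agree_inj m); first by rewrite iter_vert_mv.
  by apply: agree_trans (em _) _; apply/agree_sym/(em 0).
have exn : exists n, `[< agree k (iter n (mv l) o) v >].
  by exists n; rewrite oe -iterSr nP; apply/asboolP.
(* First return of the walk to the class; the vertex just before it can only be [in_vertex]. *)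
case: (ex_minnP exn) => -[|j] /asboolP aj minj.
  by case: (out_vertex_out ck aj).
have nin i : i <= j -> ~ agree k (iter i (mv l) o) v.
  by move=> ij /asboolP /minj; rewrite ltnNge ij.
have orb i : orbit v (iter i (mv l) o).
  elim: i => [|i IH]; first exact: out_vertex_orbit.
  exact: orbit_trans IH (orbit_mv _ _).
have <- : iter j (mv l) o = in_vertex k l v.
  apply: in_vertexP => //; apply/eqP/negP => /negP nb; apply: (nin j) => //.
  by apply: agree_trans aj; apply/agree_sym/mv_agree; rewrite -vert_mv.
elim: j {aj minj exn} nin => [|j IH] nin; first exact: rst_refl.
apply: (rst_trans _ _ _ (iter j (mv l) o)).
  by apply: IH => i ij; apply: nin; exact: leqW.
apply: rst_step; split=> //; [exact: nin|exact: nin|exact: adj_mv].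
Qed.

(** A copy cut by l has two boundary vertices. A later nonzero level cut by the other label closes
    up the l-cycle, which joins them outside the copy. *)
Lemma one_end v : nonzero_cut La v -> nonzero_cut Lb v ->
  exists F lab b, @exhaustion codes (orbit v) adj 1 F lab b.
Proof.
move=> va vb.
have nc l N : exists2 k, N <= k & v k != ord0 /\ cut l (v k).
  by case: l; [exact: va|exact: vb].
have v0 : ~ orbit v zero_code.
  move=> /nonzero_notin_orbit[N|l [N vN]].
    by have [k Nk []] := va N; exists k.
  have [k Nk [_]] := nc (other l) N.
  by rewrite vN // (negPf (lastc_uncut _ _)).
have [kap [kapP kap_lt kap_ge]] : exists kap : nat -> nat, [/\ forall n, v (kap n) != ord0,
    forall n, kap n < kap n.+1 & forall n, n <= kap n].
  by apply: (@subsequence (fun k => v k != ord0)) => N; have [k Nk []] := va N; exists k.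
have lP n : {l | cut l (v (kap n))}.
  by apply: cid; have := cut_other La (kapP n);
    case: (boolP (cut La (v (kap n)))) => c; [exists La|exists Lb].
pose b n := out_vertex (kap n) (sval (lP n)) v.
exists (fun n => tail_class (kap n) v), (fun _ _ => ord0), (fun n _ => b n).
split=> //.
- by move=> n; exact: tail_class_finite.
- by move=> n w; apply: agreeW; exact: ltnW.
- move=> w /(orbit_agree v0)[m a]; exists m; exact: agreeW a.
- move=> n i; split; [exact: out_vertex_orbit| |exact/esym/ord1].
  exact: (out_vertex_out (svalP (lP n))).
- move=> n w vw Fw; set l := sval (lP n).
  have [x [vx Fx [->|->] wx]] := @reach_boundary v (tail_class (kap n) v)
    (fun w => w = out_vertex (kap n) l v \/ w = in_vertex (kap n) l v) v
    (orbit_refl _) (@agree_refl _ _)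
    (fun w u _ nw au wu => boundary (kapP n) (svalP (lP n)) au nw wu) w vw Fw.
    exact: wx.
  apply: rst_trans wx _; apply: rst_sym.
  have [m km [vm cm]] := nc (other l) (kap n).+1.
  apply: (out_in_joined km) => //; first exact: (svalP (lP n)).
  by move: cm; rewrite cut_other.
Qed.

(** * Positions on the line of a label *)

Section Position.
Variables (l : label) (t : codes).
Hypothesis t_cut : forall k, cut l (t k).

Lemma heightS k w : height l (vert w k.+1) =
  if cut l (w k) then rank (is_five k.+1) l (w k) * cycle_len k + height l (vert w k)
  else 0.
Proof. by []. Qed.

(** Past a level where w and t agree, both heights gain the same digits, because t is cut by l
    everywhere; hence the difference is stable in m. *)
Definition pos_at m w : int :=
  ((height l (vert w m))%:Z - (height l (vert t m))%:Z)%R.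

Definition pos w : int :=
  if pselect (exists m, agree m w t) is left e then pos_at (sval (cid e)) w else 0%R.

Lemma pos_at_le m m' w : m <= m' -> agree m w t -> pos_at m' w = pos_at m w.
Proof.
move=> /subnKC <- a; elim: (m' - m) => [|i IH]; first by rewrite addn0.
rewrite addnS -IH /pos_at /= (a (m + i)) ?leq_addr // t_cut; lia.
Qed.

Lemma posE m w : agree m w t -> pos w = pos_at m w.
Proof.
move=> a; rewrite /pos; case: pselect => [e|[]]; last by exists m.
case: (cid e) => m' a' /=; case: (leqP m m') => h; first exact: pos_at_le.
by apply/esym/pos_at_le => //; exact: ltnW.
Qed.

Lemma pos_other m w : agree m w t -> move (other l) (vert w m) != base _ ->
  pos (mv (other l) w) = pos w.
Proof.
move=> a nb; rewrite (posE a) (posE (agree_trans (mv_agree nb) a)).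
by rewrite /pos_at vert_mv height_other.
Qed.

Lemma pos_mv m w : agree m w t -> move l (vert w m) != base _ ->
  pos (mv l w) = pos w \/ pos (mv l w) = (pos w + 1)%R.
Proof.
move=> a nb; rewrite (posE a) (posE (agree_trans (mv_agree nb) a)).
by rewrite /pos_at vert_mv; case: (height_move nb) => ->; [left|right]; lia.
Qed.

Lemma height_mono k m : k <= m -> height l (vert t k) <= height l (vert t m).
Proof.
move=> /subnKC <-; elim: (m - k) => [|i IH]; first by rewrite addn0.
by apply: leq_trans IH _; rewrite addnS /= t_cut leq_addl.
Qed.

(* The block of Lambda_k containing t, cut off by l at level k, occupies an
   interval of positions of length [cycle_len k] not met by any other vertex. *)
Lemma pos_block k w m : t k != ord0 -> k <= m -> agree m w t ->
  agree k w t <-> (0 <= pos w + (height l (vert t k))%:Z < (cycle_len k)%:Z)%R.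
Proof.
move=> tk km a; split=> [ak|].
  by rewrite (posE ak) /pos_at; have := height_lt l (vert w k); lia.
move: a; rewrite -(subnKC km); elim: (m - k) => [|i IH]; first by rewrite addn0.
rewrite addnS => a; have [e|/eqP ne] := eqVneq (w (k + i)) (t (k + i)).
  apply: IH => j; rewrite leq_eqVlt => /predU1P[<-//|]; exact: a.
rewrite (posE a) /pos_at !heightS t_cut; set j := k + i.
have lt_j := height_lt l (vert t j); have ltw_j := height_lt l (vert w j).
(* [lo] and [hi] say that the block of level k lies inside the block of level j. *)
have lo : height l (vert t k) <= height l (vert t j) by apply: height_mono; exact: leq_addr.
have hi : height l (vert t j) + cycle_len k <= cycle_len j + height l (vert t k).
  rewrite /j; elim: (i) => [|i' IH']; first by rewrite addn0 addnC.
  rewrite addnS /= t_cut; have := rank_lt (is_five (k + i').+1) l (t (k + i')).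
  move: IH' (rank _ _ _) (cycle_length _) => + r c; move: (cycle_len (k+i')) => N H rc.
  have : r.+1 * N <= c * N by rewrite leq_mul2r rc orbT.
  by rewrite mulSn; lia.
have rk_inj : cut l (w j) -> rank (is_five j.+1) l (w j) != rank (is_five j.+1) l (t j).
  move=> cw; apply/eqP => /rank_inj r; apply: ne; apply: val_inj; apply: r.
  - exact: code_lt.
  - exact: code_lt.
  - by rewrite -cutE.
  - by rewrite -cutE.
case: ifP => cw.
  have := rk_inj cw.
  move: (rank _ _ (w j)) (rank _ _ (t j)) (cycle_len j) lt_j ltw_j hi.
  move=> r r' N lt_j ltw_j hi rr'.
  have [h|h] : r.+1 <= r' \/ r'.+1 <= r by lia.
    have : r.+1 * N <= r' * N by rewrite leq_mul2r h orbT.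
    by rewrite mulSn; lia.
  have : r'.+1 * N <= r * N by rewrite leq_mul2r h orbT.
  by rewrite mulSn; lia.
(* Here w has height 0 at level j + 1, and the block lies strictly above: the digit of t at level k
   is positive since t k is nonzero. *)
have [i0|i0] := posnP i.
  have tj : t j != ord0 by rewrite /j i0 addn0.
  have := rank_gt0 (l := l) (code_lt (t j)); rewrite -cutE t_cut => /(_ erefl tj) r0.
  have : 1 * cycle_len j <= rank (is_five j.+1) l (t j) * cycle_len j.
    by rewrite leq_mul2r r0 orbT.
  have jk : height l (vert t j) = height l (vert t k) by rewrite /j i0 addn0.
  by have := cycle_len_gt0 j; lia.
have : height l (vert t k) < height l (vert t j).
  apply: (@leq_trans (height l (vert t k.+1))); last by apply: height_mono; rewrite /j; lia.
  rewrite heightS t_cut; have := rank_gt0 (l := l) (code_lt (t k)).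
  rewrite -cutE t_cut => /(_ erefl tk) r0.
  have : 1 * cycle_len k <= rank (is_five k.+1) l (t k) * cycle_len k.
    by rewrite leq_mul2r r0 orbT.
  by have := cycle_len_gt0 k; lia.
lia.
Qed.

End Position.

(** * Orbits with two ends *)

Lemma zero_prefix n (v : codes) j : vert v n = base (Lambda n) -> j < n -> v j = ord0.
Proof.
elim: n => // n IH [e v0]; rewrite ltnS leq_eqVlt => /predU1P[->//|].
exact: IH.
Qed.

Lemma nonzero_often (v : codes) : ~ orbit v zero_code ->
  forall N, exists2 k, N <= k & v k != ord0.
Proof.
move=> v0 N; apply: contrapT => H; apply: v0; apply: (@agree_orbit N).
move=> j Nj; apply/eqP/negP => /negP vj.
by apply: H; exists j => //.
Qed.

Lemma orbit_eq v w : orbit v w -> orbit v = orbit w.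
Proof.
move=> vw; apply/funext => x; apply/propext; split; first exact/orbit_trans/orbit_sym.
exact: orbit_trans vw.
Qed.

(** If the vertices [b k i] make up the boundary, [exh_reach] is automatic: w is joined to one of
    them, and labels are constant along the way. *)
Lemma exhaustion_of_boundary v n F lab b :
  (forall k, finite_set (F k)) -> (forall k, F k `<=` F k.+1) ->
  (forall w, orbit v w -> exists k, F k w) ->
  (forall k w w', orbit v w -> orbit v w' -> ~ F k w -> ~ F k w' ->
    adj w w' -> lab k w = lab k w') ->
  (forall k w, orbit v w -> ~ F k.+1 w -> lab k.+1 w = lab k w) ->
  (forall k i, [/\ orbit v (b k i), ~ F k (b k i) & lab k (b k i) = i]) ->
  (forall k, F k v) ->
  (forall k w u, orbit v w -> ~ F k w -> F k u -> adj w u -> exists i, w = b k i) ->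
  @exhaustion codes (orbit v) adj n F lab b.
Proof.
move=> H1 H2 H3 Hadj H5 Hout Fv HB; split=> // k w vw Fw.
have [x [vx Fx [i xi] wx]] :=
  reach_boundary (orbit_refl v) (Fv k) (HB k) vw Fw.
suff -> : lab k w = i by rewrite -xi.
have [_ _ <-] := Hout k i; rewrite -xi.
elim: {vx Fx vw Fw xi} wx => [y z [vy vz Fy Fz yz]|//|y z _ -> //|y z t _ -> _ -> //].
exact: Hadj.
Qed.

(** The n-th block fills an interval of N n positions, the other vertices lie below or above it, and
    neighbours differ by at most 1 in position, so no edge jumps over the block. *)
Lemma two_ends_cut l (v : codes) : ~ orbit v zero_code -> (forall k, cut l (v k)) ->
  exists F lab b, @exhaustion codes (orbit v) adj 2 F lab b.
Proof.
move=> v0 vc.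
have [kap [kapP kap_lt kap_ge]] := subsequence (nonzero_often v0).
pose h n : int := Posz (height l (vert v (kap n))).
pose N n : int := Posz (cycle_len (kap n)).
pose F n := tail_class (kap n) v.
pose lab n w : 'I_2 := if (pos l v w + h n < 0)%R then ord0 else ord_max.
pose b n (i : 'I_2) := if i == ord0 then in_vertex (kap n) l v else out_vertex (kap n) l v.
have N_gt0 n : (0 < N n)%R by rewrite ltz_nat cycle_len_gt0.
have ev w : orbit v w -> exists2 m, agree m w v & vert w m != base (Lambda m).
  move=> vw; have [m a] := orbit_agree v0 vw.
  have [k nb] : exists k, vert w k != base (Lambda k).
    by apply: nonzero_vert => e; apply: v0; rewrite -e.
  exists (maxn m k); first by apply: agreeW a; exact: leq_maxl.
  by apply: vert_neq_base nb; exact: leq_maxr.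
have block n w : orbit v w -> F n w <-> (0 <= pos l v w + h n < N n)%R.
  move=> vw; have [m a _] := ev _ vw.
  apply: (@pos_block l v vc _ _ (maxn m (kap n))) => //; first exact: leq_maxr.
  by apply: agreeW a; exact: leq_maxl.
have step l' w : orbit v w -> pos l v (mv l' w) = pos l v w \/
    (l' = l /\ pos l v (mv l' w) = (pos l v w + 1)%R).
  move=> vw; have [m a nb] := ev _ (orbit_trans vw (orbit_mv l' w)).
  have a' : agree m w v.
    by apply: agree_trans a; apply/agree_sym/mv_agree; rewrite -vert_mv.
  rewrite vert_mv in nb; case: (labelP l l') => e; subst l'.
    by have [->|->] := pos_mv vc a' nb; [left|right].
  by left; exact: (pos_other vc a' nb).
have adj_pos w w' : orbit v w -> adj w w' ->
    (pos l v w - 1 <= pos l v w' <= pos l v w + 1)%R.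
  move=> vw ww'; have vw' := adj_orbit ww' vw; case: ww' => l' [e|e].
    by subst w'; have [->|[_ ->]] := step l' w vw; lia.
  by subst w; have [->|[_ ->]] := step l' w' vw'; lia.
have out n w : orbit v w -> ~ F n w ->
    (pos l v w + h n < 0)%R \/ (N n <= pos l v w + h n)%R.
  move=> vw Fw.
  by have : ~ (0 <= pos l v w + h n < N n)%R := fun H => Fw ((block n w vw).2 H); lia.
have h_mono n : (h n <= h n.+1)%R.
  by rewrite lez_nat; apply: height_mono => //; exact: ltnW.
have lab_adj n w w' : orbit v w -> orbit v w' -> ~ F n w -> ~ F n w' -> adj w w' ->
    lab n w = lab n w'.
  move=> vw vw' Fw Fw' ww'; rewrite /lab.
  have := adj_pos _ _ vw ww'; have := out _ _ vw Fw; have := out _ _ vw' Fw'.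
  by have := N_gt0 n; case: ifP; case: ifP => //; lia.
exists F, lab, b; apply: exhaustion_of_boundary => //.
- by move=> n; exact: tail_class_finite.
- by move=> n w; apply: agreeW; exact: ltnW.
- move=> w /(orbit_agree v0)[m a]; exists m; exact: agreeW a.
- move=> n w vw Fw.
  have Fw' : ~ F n w by apply: contra_not Fw; apply: agreeW; exact: ltnW.
  rewrite /lab; have := out _ _ vw Fw; have := out _ _ vw Fw'; have := h_mono n.
  have : (0 <= h n)%R by [].
  have : (h n.+1 < N n.+1)%R by rewrite ltz_nat height_lt.
  by have := N_gt0 n; case: ifP; case: ifP => //; lia.
- move=> n i; rewrite /b; case: eqP => [->|/eqP i0].
    have Fi := in_vertex_out (vc (kap n)).
    have vi := in_vertex_orbit (kap n) l v.
    split=> //; rewrite /lab; have := out _ _ vi Fi.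
    have [e a] := with_vertP (base (Lambda (kap n))) v.
    have := step l _ vi; rewrite mviK.
    rewrite (posE vc a) /pos_at e height_base -/(h n).
    by have := N_gt0 n; case: ifP => //; lia.
  have Fi := out_vertex_out (vc (kap n)).
  have vi := out_vertex_orbit (kap n) l v.
  split=> //; last first.
    have -> : i = ord_max by apply: val_inj; case: i i0 => -[|[|]].
    rewrite /lab; have := out _ _ vi Fi.
    have [e a] := with_vertP (invF (@move_inj (kap n) l) (base _)) v.
    have := step l _ (orbit_trans vi (orbit_sym (orbit_mv l _))).
    rewrite -/(out_vertex _ _ _) (posE vc a) /pos_at e.
    have := @height_pre l _ (invF (@move_inj (kap n) l) (base _)).
    rewrite f_invF => /(_ erefl).
    rewrite -/(h n) /N; case: ifP => //; lia.
- move=> n w u vw Fw Fu wu.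
  have [->|->] := boundary (kapP n) (vc (kap n)) Fu Fw wu.
    by exists ord_max.
  by exists ord0.
Qed.

(** Zero copy numbers are cut by both labels, so replacing the first N of them by 0 stays in the
    orbit and makes every level cut by l. *)
Lemma two_ends l (v : codes) : ~ orbit v zero_code ->
  (exists N, forall k, N <= k -> cut l (v k)) ->
  exists F lab b, @exhaustion codes (orbit v) adj 2 F lab b.
Proof.
move=> v0 [N vN]; have [e a] := with_vertP (base (Lambda N)) v.
rewrite (orbit_eq (agree_orbit (agree_sym a))).
apply: (@two_ends_cut l).
  by move=> H; apply: v0; exact: orbit_trans (agree_orbit (agree_sym a)) H.
move=> k; have [kN|Nk] := ltnP k N; last by rewrite a // vN.
by rewrite (zero_prefix e kN) cut0.
Qed.

(** * The orbit of the base point *)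

Section BaseOrbit.

Let zero_cut l k : cut l (zero_code k). Proof. exact: cut0. Qed.
Let last_cut l k : cut l (last_code l k). Proof. exact: lastc_cut. Qed.

Lemma zero_neq_last m l w : agree m w zero_code -> ~ agree m w (last_code l).
Proof.
move=> a b; have := lastc_neq0 m l.
by rewrite -[lastc m l]/(last_code l m) -b // a // eqxx.
Qed.

Lemma last_neq_last m l w : agree m w (last_code l) ->
  ~ agree m w (last_code (other l)).
Proof.
move=> a b; have := lastc_uncut m (other l); rewrite otherK.
by rewrite -[lastc m _]/(last_code (other l) m) -b // a // last_cut.
Qed.

(** Signed coordinate on the l-line through the base point. The shift by 1 puts [last_code l] at -1,
    just before the base point; the final 0 serves the class of [last_code (other l)], which hangs
    off the base point. *)
Definition base_pos l w : int :=
  if `[< exists m, agree m w zero_code >] then pos l zero_code w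
  else if `[< exists m, agree m w (last_code l) >] then (pos l (last_code l) w - 1)%R
  else 0%R.

Lemma base_pos_zero l m w : agree m w zero_code ->
  base_pos l w = Posz (height l (vert w m)).
Proof.
move=> a; rewrite /base_pos; case: asboolP => [_|[]]; last by exists m.
by rewrite (posE _ a) // /pos_at vert_zero height_base subr0.
Qed.

Lemma base_pos_last l m w : agree m w (last_code l) ->
  base_pos l w = (Posz (height l (vert w m)) - Posz (cycle_len m))%R.
Proof.
move=> a; rewrite /base_pos; case: asboolP => [[m' b]|_].
  case: (@zero_neq_last (maxn m m') l w).
    by apply: agreeW b; exact: leq_maxr.
  by apply: agreeW a; exact: leq_maxl.
case: asboolP => [_|[]]; last by exists m.
rewrite (posE _ a) // /pos_at.
have : move l (vert (last_code l) m) = base _ by rewrite -vert_mv mv_last vert_zero.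
by move/height_pre; lia.
Qed.

Lemma base_pos_other l m w : agree m w (last_code (other l)) -> base_pos l w = 0%R.
Proof.
move=> a; rewrite /base_pos; case: asboolP => [[m' b]|_].
  case: (@zero_neq_last (maxn m m') (other l) w).
    by apply: agreeW b; exact: leq_maxr.
  by apply: agreeW a; exact: leq_maxl.
case: asboolP => [[m' b]|//].
case: (@last_neq_last (maxn m m') l w).
  by apply: agreeW b; exact: leq_maxr.
by apply: agreeW a; exact: leq_maxl.
Qed.

Lemma base_orbitP l w : orbit zero_code w ->
  w = last_code l \/ exists m, move l (vert w m) != base (Lambda m) /\
    (agree m w zero_code \/ exists l', agree m w (last_code l')).
Proof.
move=> zw; have [e|/nonzero_vert[k nb]] := pselect (mv l w = zero_code).
  by left; apply: (@mv_inj l); rewrite mv_last.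
right; have [m wt] := zero_orbit_tail zw; exists (maxn m k); split.
  by rewrite -vert_mv; apply: vert_neq_base nb; exact: leq_maxr.
by case: wt => [a|[l' a]]; [left|right; exists l']; apply: agreeW a; exact: leq_maxl.
Qed.

Lemma base_pos_step l w : orbit zero_code w ->
  (base_pos l (mv l w) = base_pos l w \/ base_pos l (mv l w) = (base_pos l w + 1)%R) /\
  base_pos (other l) (mv l w) = base_pos (other l) w.
Proof.
move=> /(base_orbitP l)[->|[m [nb wt]]].
  (* The edge into the base point goes from position -1 to position 0. *)
  rewrite mv_last (@base_pos_zero l 0) // (@base_pos_last l 0) //=.
  rewrite (@base_pos_zero _ 0) // (@base_pos_other _ 0) ?otherK //.
  by split=> //; right.
have a := mv_agree nb; case: wt => [b|[l' b]].
  rewrite !(base_pos_zero _ b) !(base_pos_zero _ (agree_trans a b)) vert_mv.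
  split; first by case: (height_move nb) => ->; [left|right; lia].
  by rewrite -{2}(otherK l) height_other.
have ab := agree_trans a b; case: (labelP l l') => e; subst l'.
  rewrite (base_pos_last b) (base_pos_last ab) vert_mv.
  have H : agree m w (last_code (other (other l))) by rewrite otherK.
  have H' : agree m (mv l w) (last_code (other (other l))) by rewrite otherK.
  rewrite (base_pos_other H) (base_pos_other H'); split=> //.
  by case: (height_move nb) => ->; [left|right; lia].
rewrite (base_pos_other b) (base_pos_other ab) (base_pos_last b) (base_pos_last ab).
by rewrite vert_mv -{2}(otherK l) height_other; split=> //; left.
Qed.

Lemma base_pos_excl l w : orbit zero_code w ->
  base_pos l w = 0%R \/ base_pos (other l) w = 0%R.
Proof.
move=> /zero_orbit_tail[m [a|[l' a]]].
  by rewrite !(base_pos_zero _ a); case: (height_excl l (vert w m)) => ->; auto.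
case: (labelP l l') => e; subst l'; last by left; exact: base_pos_other a.
by right; apply: (@base_pos_other _ m); rewrite otherK.
Qed.

(** The copies of Lambda_k containing the base point and its two predecessors. *)
Definition base_block k : set codes :=
  [set w | agree k w zero_code \/ exists l, agree k w (last_code l)].

Lemma cycle_len_mono k m : k <= m -> cycle_len k <= cycle_len m.
Proof.
move=> /subnKC <-; elim: (m - k) => [|i IH]; first by rewrite addn0.
apply: leq_trans IH _; rewrite addnS /= -{1}(mul1n (cycle_len _)) leq_mul2r.
by rewrite /cycle_length; case: ifP; rewrite orbT.
Qed.

(** Look at the highest level where w differs from its tail. In the class of [zero_code] a nonzero
    digit there is worth at least a full cycle; in that of [last_code l] a digit below the maximum,
    or a vertex off the line, leaves more than a full cycle missing. *)
Lemma base_block_out k w : orbit zero_code w -> ~ base_block k w ->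
  exists l, (Posz (cycle_len k) <= base_pos l w)%R \/
    (base_pos l w < - Posz (cycle_len k))%R.
Proof.
move=> /zero_orbit_tail[m wt] nw.
have mono j := @cycle_len_mono k j.
suff [l [n H]] : exists l n,
    (agree n w zero_code /\ cycle_len k <= height l (vert w n)) \/
    (agree n w (last_code l) /\ height l (vert w n) + cycle_len k < cycle_len n).
  exists l; case: H => -[b H]; [left|right].
    by rewrite (base_pos_zero l b).
  by rewrite (base_pos_last b); lia.
case: wt => [a|[l a]].
  have {}a : agree (maxn m k) w zero_code by apply: agreeW a; exact: leq_maxl.
  have := leq_maxr m k; move: (maxn m k) a => {}m a km.
  move: a; rewrite -(subnKC km); elim: (m - k) => [|i IH].
    by rewrite addn0 => a; case: nw; left.
  rewrite addnS => a; have [e|ne] := eqVneq (w (k + i)) ord0.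
    by apply: IH => j; rewrite leq_eqVlt => /predU1P[<-//|]; exact: a.
  have [l c] : exists l, cut l (w (k + i)).
    by have := cut_other La ne; case: (boolP (cut La _)) => c; [exists La|exists Lb].
  exists l, (k + i).+1; left; split=> //; rewrite heightS c.
  have := rank_gt0 (l := l) (code_lt (w (k + i))); rewrite -cutE c => /(_ erefl ne) r0.
  have : 1 * cycle_len (k + i) <=
      rank (is_five (k + i).+1) l (w (k + i)) * cycle_len (k + i).
    by rewrite leq_mul2r r0 orbT.
  by have := mono (k + i) (leq_addr _ _); lia.
have {}a : agree (maxn m k) w (last_code l) by apply: agreeW a; exact: leq_maxl.
have := leq_maxr m k; move: (maxn m k) a => {}m a km.
move: a; rewrite -(subnKC km); elim: (m - k) => [|i IH].
  by rewrite addn0 => a; case: nw; right; exists l.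
rewrite addnS => a; have [e|ne] := eqVneq (w (k + i)) (lastc (k + i) l).
  by apply: IH => j; rewrite leq_eqVlt => /predU1P[<-//|]; exact: a.
exists l, (k + i).+1; right; split=> //; rewrite heightS.
have lt_h := height_lt l (vert w (k + i)).
have lt_r := rank_lt (is_five (k + i).+1) l (w (k + i)).
have le_N := mono (k + i) (leq_addr _ _).
have N0 := cycle_len_gt0 k.
have c2 : 2 <= cycle_length (is_five (k + i).+1) by rewrite /cycle_length; case: ifP.
rewrite [cycle_len (k + i).+1]/=; case: ifP => c; last first.
  have : 2 * cycle_len (k + i) <= cycle_length (is_five (k + i).+1) * cycle_len (k + i).
    by rewrite leq_mul2r c2 orbT.
  lia.
have : (rank (is_five (k + i).+1) l (w (k + i))).+1 != cycle_length (is_five (k + i).+1).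
  have <- : (rank (is_five (k + i).+1) l (lastc (k + i) l)).+1 =
      cycle_length (is_five (k + i).+1).
    apply: rank_last; [exact: code_lt|by rewrite -cutE lastc_cut|].
    rewrite -val_shift; apply/eqP; have := shift_eq0 l (lastc (k + i) l).
    by rewrite eqxx => /eqP ->.
  rewrite eqSS; apply: contraNneq ne => /rank_inj e; apply/eqP/val_inj/e.
  - exact: code_lt.
  - exact: code_lt.
  - by rewrite -cutE.
  - by rewrite -cutE lastc_cut.
move=> rne; have {}lt_r : (rank (is_five (k + i).+1) l (w (k + i))).+2 <=
    cycle_length (is_five (k + i).+1).
  by rewrite ltn_neqAle rne.
have : (rank (is_five (k + i).+1) l (w (k + i))).+2 * cycle_len (k + i) <=
   cycle_length (is_five (k + i).+1) * cycle_len (k + i) by rewrite leq_mul2r lt_r orbT.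
by rewrite !mulSn; lia.
Qed.

(** The 3 comes from d_1 = 5. Blocks are taken from level 1 on: a step changes each coordinate by at
    most 1, too little to pass from one line to the other outside such a block. *)
Lemma cycle_len_ge3 k : 3 <= cycle_len k.+1.
Proof. exact: (@cycle_len_mono 1 k.+1). Qed.

Let orbit_last l : orbit zero_code (last_code l).
Proof. by rewrite -(mv_last l); apply/orbit_sym/orbit_mv. Qed.

(** The predecessor of o has l-coordinate [cycle_len k.+1 - 1], at least 2; so the other coordinate
    of o vanishes, and [base_block_out] leaves only the far end of the l-line. *)
Lemma base_out_vertex k l (o := out_vertex k.+1 l zero_code) :
  [/\ orbit zero_code o, ~ base_block k.+1 o &
      (Posz (cycle_len k.+1) <= base_pos l o)%R].
Proof.
have zo : orbit zero_code o by exact: out_vertex_orbit.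
have [e a] := with_vertP (invF (@move_inj k.+1 l) (base _)) zero_code.
have nz : vert o k.+2 != base (Lambda k.+2).
  rewrite base_eqS /= negb_and; apply/orP; right.
  by rewrite {1}/o /out_vertex mv_code ?e ?f_invF // a //; exact: zero_cut.
have a' : agree k.+2 o zero_code.
  apply: agree_trans (agreeW (leqnSn _) a); apply: mv_agree.
  by rewrite -vert_mv.
have no : ~ base_block k.+1 o.
  case=> [|[l' b]]; first exact: (out_vertex_out (zero_cut l k.+1)).
  exact: (zero_neq_last a' (agreeW (leqnSn _) b)).
split=> //; have [l' H] := base_block_out zo no.
have := base_pos_excl l zo.
have [[]] := @base_pos_step l _ (orbit_trans zo (orbit_sym (orbit_mv l _))).
- rewrite -/(out_vertex _ _ _) -/o (base_pos_zero l a) e.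
  have := @height_pre l _ (invF (@move_inj k.+1 l) (base _)); rewrite f_invF => /(_ erefl).
  have := cycle_len_ge3 k; case: (labelP l l') H => ->; lia.
- rewrite -/(out_vertex _ _ _) -/o (base_pos_zero l a) e.
  have := @height_pre l _ (invF (@move_inj k.+1 l) (base _)); rewrite f_invF => /(_ erefl).
  have := cycle_len_ge3 k; case: (labelP l l') H => ->; lia.
Qed.

Lemma base_in_vertex k l (i := in_vertex k.+1 l (last_code l)) :
  [/\ orbit zero_code i, ~ base_block k.+1 i &
      (base_pos l i < - Posz (cycle_len k.+1))%R].
Proof.
have zi : orbit zero_code i.
  by apply: orbit_trans (orbit_last l) _; exact: in_vertex_orbit.
have [e a] := with_vertP (base (Lambda k.+1)) (last_code l).
have nz : vert (mv l i) k.+2 != base (Lambda k.+2).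
  by rewrite mviK; apply: vertS_neq_base (a _ (leqnn _)); exact: lastc_neq0.
have a' : agree k.+2 i (last_code l).
  apply: agree_trans (agreeW (leqnSn _) a).
  apply/agree_sym; rewrite -{1}(mviK l (with_vert _ _)).
  by apply: mv_agree; rewrite -vert_mv.
have ni : ~ base_block k.+1 i.
  case=> [b|[l' b]].
    exact: (zero_neq_last (agreeW (leqnSn _) b) a').
  case: (labelP l l') => ll; subst l'.
    exact: (in_vertex_out (last_cut l k.+1)).
  exact: (last_neq_last a' (agreeW (leqnSn _) b)).
split=> //; have [l' H] := base_block_out zi ni.
have := base_pos_excl l zi.
have [+ _] := base_pos_step l zi; rewrite mviK (base_pos_last a) e height_base.
by have := cycle_len_ge3 k; case: (labelP l l') H => ->; lia.
Qed.

Lemma base_boundary k w u : orbit zero_code w -> ~ base_block k w ->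
  base_block k u -> adj w u ->
  exists l, w = out_vertex k l zero_code \/ w = in_vertex k l (last_code l).
Proof.
move=> zw nw Fu [l [e|e]]; exists l; move: e.
- move=> e; subst u; right; have [eb|nb] := eqVneq (vert (mv l w) k) (base _); last first.
    have a : agree k w (mv l w) by apply/agree_sym/mv_agree; rewrite -vert_mv.
    case: nw; case: Fu => [b|[l' b]]; [left|right; exists l']; exact: agree_trans a b.
  case: Fu => [b|[l' b]].
    case: nw; right; exists l.
    suff -> : w = last_code l by [].
    apply: (@mv_inj l); rewrite mv_last; apply: (agree_inj _ b).
    by rewrite eb vert_zero.
  case: (labelP l l') => ll; subst l'; first exact: in_vertexP.
  case: nw; right; exists (other l); apply: uncut_mv_inv b; first exact: lastc_neq0.
  by have := lastc_uncut k (other l); rewrite otherK.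
- move=> e; subst w; left; have [eb|nb] := eqVneq (vert (mv l u) k) (base _); last first.
    have a : agree k (mv l u) u by apply/mv_agree; rewrite -vert_mv.
    case: nw; case: Fu => [b|[l' b]]; [left|right; exists l']; exact: agree_trans a b.
  case: Fu => [b|[l' b]]; first by apply: out_vertexP; rewrite -?vert_mv.
  case: nw; case: (labelP l l') => ll; subst l'.
    left; suff -> : u = last_code l by rewrite mv_last.
    apply: (agree_inj _ b); apply: (@move_inj _ l); rewrite -!vert_mv eb mv_last.
    by rewrite vert_zero.
  right; exists (other l); apply: uncut_mv b; first exact: lastc_neq0.
  by have := lastc_uncut k (other l); rewrite otherK.
Qed.

Lemma four_ends :
  exists F lab b, @exhaustion codes (orbit zero_code) adj 4 F lab b.
Proof.
pose N n := Posz (cycle_len n.+1).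
have N3 n : (3 <= N n)%R by exact: cycle_len_ge3.
have NM n : (N n <= N n.+1)%R by rewrite lez_nat; exact: cycle_len_mono.
pose F n := base_block n.+1.
(* Labels: the forward and backward halves of the La-line, then of the Lb-line. The last one needs
   no test, since [out] leaves no other case. *)
pose labn n w := if (N n <= base_pos La w)%R then 0 else
  if (base_pos La w < - N n)%R then 1 else
  if (N n <= base_pos Lb w)%R then 2 else 3.
have labn_lt n w : labn n w < 4 by rewrite /labn; do 3! case: ifP => // _.
pose lab n w : 'I_4 := Ordinal (labn_lt n w).
pose b n (i : 'I_4) := match val i with
  | 0 => out_vertex n.+1 La zero_code
  | 1 => in_vertex n.+1 La (last_code La)
  | 2 => out_vertex n.+1 Lb zero_code
  | _ => in_vertex n.+1 Lb (last_code Lb) end.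
have excl w : orbit zero_code w -> base_pos La w = 0%R \/ base_pos Lb w = 0%R.
  exact: (base_pos_excl La).
have out n w : orbit zero_code w -> ~ F n w -> [\/ (N n <= base_pos La w)%R,
    (base_pos La w < - N n)%R, (N n <= base_pos Lb w)%R | (base_pos Lb w < - N n)%R].
  move=> zw nw; have [[] []] := base_block_out zw nw.
  - by constructor 1.
  - by constructor 2.
  - by constructor 3.
  - by constructor 4.
have mono n : F n `<=` F n.+1.
  move=> w [a|[l a]]; [left|right; exists l]; exact: agreeW a.
have step l w : orbit zero_code w ->
    (base_pos La w <= base_pos La (mv l w) <= base_pos La w + 1)%R /\
    (base_pos Lb w <= base_pos Lb (mv l w) <= base_pos Lb w + 1)%R.
  case: l => zw; [have [h /= e] := base_pos_step La zw|
                  have [h /= e] := base_pos_step Lb zw]; rewrite e; lia.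
have adj_pos w w' : orbit zero_code w -> adj w w' ->
    (base_pos La w - 1 <= base_pos La w' <= base_pos La w + 1)%R /\
    (base_pos Lb w - 1 <= base_pos Lb w' <= base_pos Lb w + 1)%R.
  move=> zw ww'; have zw' := adj_orbit ww' zw; case: ww' => l [e|e].
    by subst w'; have [] := step l w zw; lia.
  by subst w; have [] := step l w' zw'; lia.
exists F, lab, b; apply: exhaustion_of_boundary => //.
- move=> n; rewrite /F; apply: (@sub_finite_set _ _ (tail_class n.+1 zero_code `|`
    (tail_class n.+1 (last_code La) `|` tail_class n.+1 (last_code Lb)))).
    by move=> w [|[[]]]; [left|right; left|right; right].
  by rewrite !finite_setU; split; [|split]; exact: tail_class_finite.
- move=> w /zero_orbit_tail[m [a|[l a]]]; exists m; [left|right; exists l];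
    exact: agreeW (leqnSn m) a.
- move=> n w w' zw zw' nw nw' ww'; apply: val_inj => /=.
  have := adj_pos _ _ zw ww'; have := out _ _ zw nw; have := out _ _ zw' nw'.
  have := excl _ zw; have := excl _ zw'; have := N3 n; rewrite /labn.
  move: (N n) (base_pos La w) (base_pos Lb w) (base_pos La w') (base_pos Lb w').
  move=> c x y x' y' c3 e' e o' o [h1 h2].
  by do 6? (case: ifP => ?); case: o' => ?; case: o => ? //; lia.
- move=> n w zw nw; apply: val_inj => /=.
  have := out _ _ zw nw; have := excl _ zw; have := N3 n; have := NM n.
  rewrite /labn; move: (N n.+1) (N n) (base_pos La w) (base_pos Lb w) => d c x y.
  by move=> cd c3 e o; do 6? (case: ifP => ?); case: o => ? //; lia.
- move=> n i.
  have [oa na pa] := base_out_vertex n La; have [ob nb pb] := base_out_vertex n Lb.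
  have [ia ma qa] := base_in_vertex n La; have [ib mb qb] := base_in_vertex n Lb.
  rewrite /b; case: i => -[|[|[|[|//]]]] /= i4; split=> //; apply: val_inj;
    rewrite /= /labn.
  + by rewrite pa.
  + have := N3 n; move: qa; rewrite -/(N n); do 3? (case: ifP => ?) => //; lia.
  + have := N3 n; move: pb (excl _ ob); rewrite -/(N n); do 3? (case: ifP => ?) => //; lia.
  + have := N3 n; move: qb (excl _ ib); rewrite -/(N n); do 3? (case: ifP => ?) => //; lia.
- by move=> n; left.
- move=> n w u zw nw Fu wu; have [[] []->] := base_boundary zw nw Fu wu.
  + by exists (inord 0); rewrite /b /= inordK.
  + by exists (inord 1); rewrite /b /= inordK.
  + by exists (inord 2); rewrite /b /= inordK.
  + by exists (inord 3); rewrite /b /= inordK.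
Qed.

End BaseOrbit.

End Exhaustions.

Local Open Scope ring_scope.

(** * Continuous maps on the line and path components *)

Lemma nbhsS (T : topologicalType) (t : T) (A B : set T) :
  nbhs t A -> A `<=` B -> nbhs t B.
Proof. by move=> tA AB; exact: filterS tA. Qed.

Lemma continuous_pair (S T U : topologicalType) (f : S -> T) (g : S -> U) x :
  {for x, continuous f} -> {for x, continuous g} ->
  {for x, continuous (fun y => (f y, g y))}.
Proof.
move=> cf cg A [[M N] /= [Mx Nx] MN].
have Hf : nbhs x (f @^-1` M) := cf _ Mx; have Hg : nbhs x (g @^-1` N) := cg _ Nx.
apply: (nbhsS (filterI Hf Hg)) => y [My Ny].
exact: (MN (f y, g y)).
Qed.

(** The open-and-closed argument, used below for uniqueness and existence of lifts and for following
    a path from cell to cell. *)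
Lemma connected_locally_constant (T : topologicalType) (P : T -> Prop) (t0 : T) :
  connected [set: T] ->
  (forall t : T, exists2 N : set T, nbhs t N &
    forall s s', N s -> N s' -> P s -> P s') ->
  P t0 -> forall t, P t.
Proof.
move=> cT H P0; suff E : [set t | P t] = setT.
  by move=> t; have : setT t by []; rewrite -E.
apply: cT; first by exists t0.
- exists [set t | P t]; last by rewrite setTI.
  rewrite openE => t Pt; have [N Nt HN] := H t.
  by apply: (filterS _ Nt) => s Ns; apply: HN Pt => //; exact: nbhs_singleton.
- exists [set t | P t]; last by rewrite setTI.
  move=> t ct; have [N Nt HN] := H t; have [s [Ps Ns]] := ct _ Nt.
  by apply: HN Ps => //; exact: nbhs_singleton.
Qed.

Section RealLine.
Variable R : realType.

Lemma real_connected : connected [set: R].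
Proof. by apply/connected_intervalP => x y _ _ z _. Qed.

Lemma ball_connected (t e : R) : connected (ball t e).
Proof.
apply/connected_intervalP => x y; rewrite /ball /= /ball_ !ltr_distlC.
move=> /andP[a b] /andP[c d] z /andP[xz zy]; rewrite ltr_distlC; apply/andP; split; lra.
Qed.

Lemma continuous_glue (T : topologicalType) (f g : R -> T) c :
  continuous f -> continuous g -> f c = g c ->
  continuous (fun t => if t <= c then f t else g t).
Proof.
move=> cf cg fg t U; case: (ltgtP t c) => tc /= HU;
  change (\forall s \near t, U (if s <= c then f s else g s)).
- near=> s; rewrite ifT; first by near: s; exact: cf.
  by apply: ltW; near: s; exact: lt_nbhsl.
- near=> s; rewrite leNgt ifF; first by near: s; exact: cg.
  by apply/negbTE/negPn; near: s; exact: lt_nbhsr.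
- have HU' : nbhs (g t) U by rewrite tc -fg -tc.
  by near=> s; case: ifP => _; near: s; [exact: cf|exact: cg].
Unshelve. all: by end_near.
Qed.

(** Composing with the clamp to [0, 1] makes a path continuous on the whole line, where no subspace
    topology intervenes. *)
Definition clamp (a b t : R) : R := if t <= a then a else if t <= b then t else b.

Lemma clamp_continuous a b : a <= b -> continuous (clamp a b).
Proof.
move=> ab; apply: (@continuous_glue _ (fun=> a) (fun t => if t <= b then t else b)).
- by move=> t; exact: cvg_cst.
- apply: (@continuous_glue _ id (fun=> b)) => // t; first exact: cvg_id.
  exact: cvg_cst.
- by rewrite ab.
Qed.

Lemma clamp_bound a b t : a <= b -> a <= clamp a b t <= b.
Proof. by rewrite /clamp; case: ifP => ?; [lra|case: ifP => ?; lra]. Qed.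

Lemma clamp_id a b t : a <= t <= b -> clamp a b t = t.
Proof. by rewrite /clamp; case: ifP => ?; [lra|case: ifP => ?; lra]. Qed.

Lemma continuous_within_comp (S T U : topologicalType) (A : set T) (c : T -> U)
    (k : S -> T) : {within A, continuous c} -> continuous k ->
  (forall s, A (k s)) -> continuous (c \o k).
Proof.
move=> /subspace_continuousP cc ck kA s W HW.
have H := ck s _ (cc _ (kA s) _ HW).
by apply: (@filterS _ (nbhs s) _ _ _ _ H) => x /(_ (kA x)).
Qed.

Lemma path_continuous (T : topologicalType) (c : R -> T) :
  is_path c -> continuous (c \o clamp 0 1).
Proof.
move=> pc; apply: (continuous_within_comp pc); first exact: clamp_continuous.
by move=> s; have := clamp_bound s (@ler01 R).
Qed.

Lemma continuous_path (T : topologicalType) (c : R -> T) : continuous c -> is_path c.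
Proof. exact: continuous_subspaceT. Qed.

Lemma path_component_refl (T : topologicalType) (A : set T) (x : T) :
  A x -> path_component R A x x.
Proof.
move=> Ax; exists (cst x); split=> //; last by move=> _ [t _ <-].
by apply: continuous_path; exact: cst_continuous.
Qed.

Lemma path_component_in (T : topologicalType) (A : set T) (x y : T) :
  path_component R A x y -> A x /\ A y.
Proof.
move=> [c [_ cA <- <-]]; split; apply: cA; [exists 0|exists 1] => //=;
  by rewrite in_itv /= ?lexx ?ler01.
Qed.

Lemma path_component_continuous (T : topologicalType) (A : set T) (c : R -> T)
   (a b : R) : continuous c -> (forall t, A (c t)) ->
  path_component R A (c a) (c b).
Proof.
move=> cc cA; exists (fun t => c (a + t * (b - a))); split.
- apply: continuous_path => t; apply: continuous_comp; last exact: cc.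
  by apply: cvgD; [exact: cvg_cst|apply: cvgM; [exact: cvg_id|exact: cvg_cst]].
- by move=> _ [t _ <-]; exact: cA.
- by rewrite mul0r addr0.
- by rewrite mul1r addrC subrK.
Qed.

Lemma path_component_line (T : topologicalType) (A : set T) (x y : T) :
  path_component R A x y ->
  exists c : R -> T, [/\ continuous c, forall t, A (c t), c 0 = x & c 1 = y].
Proof.
move=> [c [pc cA c0 c1]]; exists (c \o clamp 0 1); split.
- exact: path_continuous.
- move=> t; apply: cA; exists (clamp 0 1 t) => //.
  by rewrite /= in_itv /= clamp_bound.
- by rewrite /= clamp_id ?lexx ?ler01.
- by rewrite /= clamp_id ?lexx ?ler01.
Qed.

Lemma path_component_sym (T : topologicalType) (A : set T) (x y : T) :
  path_component R A x y -> path_component R A y x.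
Proof.
by move=> /path_component_line[c [cc cA <- <-]]; exact: path_component_continuous.
Qed.

Lemma path_component_trans (T : topologicalType) (A : set T) (y x z : T) :
  path_component R A x y -> path_component R A y z -> path_component R A x z.
Proof.
move=> /path_component_line[c [cc cA <- cy]] /path_component_line[d [cd dA dy <-]].
pose e t := if t <= 1 then c t else d (t - 1).
have ce : continuous e.
  apply: continuous_glue => //; last by rewrite subrr dy.
  move=> t; apply: continuous_comp; last exact: cd.
  by apply: cvgD; [exact: cvg_id|exact: cvg_cst].
have -> : c 0 = e 0 by rewrite /e ler01.
have -> : d 1 = e 2 by rewrite /e ifF; [congr d; lra|apply/negbTE; lra].
apply: path_component_continuous => // t.
by rewrite /e; case: ifP.
Qed.

End RealLine.

(** * Lifting to coverings *)

Section Lifting.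
Variables (E B : topologicalType) (p : E -> B).

(** In the last clause, a connected set over U cannot leave the sheet because the remaining sheets
    form a disjoint open set. *)
Record sheet (U : set B) (V : set E) : Prop := Sheet {
  sheet_open : open V;
  sheet_inj : set_inj V p;
  sheet_surj : forall u, U u -> exists2 x, V x & p x = u;
  sheet_open_map : forall W, open W -> W `<=` V -> open (p @` W);
  sheet_connected : forall C,
    connected C -> C `<=` p @^-1` U -> C `&` V !=set0 -> C `<=` V }.

Hypothesis cp : covering_map p.

Lemma covering_sheets y : exists U S, [/\ open U, U y,
  forall V, S V -> sheet U V, trivIset S id &
  forall e, U (p e) -> exists2 V, S V & V e].
Proof.
have [_ /(_ y)[U [oU Uy [S [oS tS SU bS]]]]] := cp; exists U, S; split=> //; last first.
  by move=> e Ue; have : (p @^-1` U) e by []; rewrite -SU => -[V SV Ve]; exists V.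
move=> V SV; have [[Vsub Vinj Vsurj] Vop] := bS V SV.
split; [exact: oS|exact: Vinj| |exact: Vop|].
  by move=> u /Vsurj[x Vx <-]; exists x.
move=> C cC CU CV; apply: (@connected_sub_open _ C V (\bigcup_(W in S `\ V) W)) => //.
- exact: oS.
- by apply: bigcup_open => W [SW _]; exact: oS.
- move=> x /CU; rewrite -SU => -[W SW Wx].
  by have [<-|WV] := pselect (W = V); [left|right; exists W].
- rewrite -subset0 => x [_ [Vx [W [SW WV] Wx]]]; apply: WV.
  by apply: (tS _ _ SW SV); exists x.
Qed.

Lemma sheet_section (T : topologicalType) (k : T -> B) (U : set B) (V : set E) :
  sheet U V -> continuous k -> (forall t, U (k t)) ->
  exists2 h : T -> E, continuous h & forall t, V (h t) /\ p (h t) = k t.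
Proof.
move=> [oV Vi Vs Vo _] ck kU.
have H t : {x | V x /\ p x = k t}.
  by apply: cid; have [x] := Vs _ (kU t); exists x.
pose h t := sval (H t); have hP t : V (h t) /\ p (h t) = k t := svalP (H t).
exists h => // t W; rewrite nbhsE => -[W' [oW' W't W'W]].
have oWV : open (p @` (W' `&` V)) by apply: Vo; [exact: openI|move=> x []].
have kt : nbhs (k t) (p @` (W' `&` V)).
  by apply: open_nbhs_nbhs; split=> //; exists (h t); have [] := hP t.
apply: (nbhsS (ck _ _ kt)) => s [x [W'x Vx] e]; apply: W'W.
have [Vh ph] := hP s.
by rewrite -(Vi x (h s)) ?inE // e ph.
Qed.

Lemma lift_unique (T : topologicalType) (g h : T -> E) t0 : connected [set: T] ->
  continuous g -> continuous h -> (forall t, p (g t) = p (h t)) -> g t0 = h t0 ->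
  forall t, g t = h t.
Proof.
move=> cT cg ch gh; apply: connected_locally_constant => // t.
have [U [S [oU Ut sS tS HU]]] := covering_sheets (p (g t)).
have [V SV Vg] := HU _ Ut.
have [V' SV' V'h] : exists2 V, S V & V (h t) by apply: HU; rewrite -gh.
have [oV Vi _ _ _] := sS V SV; have [oV' _ _ _ _] := sS V' SV'.
exists ((g @^-1` V) `&` (h @^-1` V')).
  apply: filterI; first by apply: cg; exact: open_nbhs_nbhs.
  by apply: ch; exact: open_nbhs_nbhs.
move=> s s' [gs hs] [gs' hs'] e.
have VV' : V = V' by apply: tS => //; exists (g s); split=> //; rewrite e.
by apply: Vi; rewrite ?inE // VV'.
Qed.

Variable R : realType.

(** Liftability on [0, t] is locally constant in t: near t the path stays in an evenly covered set,
    and the lift continues in one sheet. *)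
Lemma path_lift (k : R -> B) e0 : continuous k -> p e0 = k 0 ->
  exists g : R -> E, [/\ continuous g, g 0 = e0 &
    forall t, p (g t) = k (clamp 0 1 t)].
Proof.
move=> ck e0k.
pose P t := exists g : R -> E, [/\ continuous g, g 0 = e0 &
    forall s, 0 <= s <= t -> p (g s) = k s].
have P0 t : t <= 0 -> P t.
  move=> t0; exists (cst e0); split=> //; first exact: cst_continuous.
  by move=> s st; have -> : s = 0 by lra.
suff [g [cg g0 gk]] : P 1.
  exists (g \o clamp 0 1); split.
  - by move=> t; apply: continuous_comp; [exact: clamp_continuous|exact: cg].
  - by rewrite /= clamp_id ?lexx ?ler01.
  - by move=> t /=; rewrite gk // clamp_bound.
apply: (@connected_locally_constant R P 0 (@real_connected R) _ (P0 _ (lexx 0)) 1) => t.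
have [U [S [oU Ut sS tS HU]]] := covering_sheets (k t).
have : nbhs t (k @^-1` U) by apply: ck; exact: open_nbhs_nbhs.
move=> /nbhs_ballP[d /= d0 kU]; exists (ball t d); first exact: nbhsx_ballx.
move=> s s' sd sd' Ps.
have [s'0|s'0] := leP s' 0; first exact: P0.
have [ss'|ss'] := leP s' s.
  have [g [cg g0 gk]] := Ps; exists g; split=> // r rs'; apply: gk; lra.
(* The maximum of s and 0: the lift on [0, a] is extended over [a, s']. *)
pose a := if s <= 0 then 0 else s.
have [a0 as'] : 0 <= a /\ a <= s' by rewrite /a; case: ifP => ?; split; lra.
have [g [cg g0 gk]] : P a by rewrite /a; case: ifP => // _; exact: P0.
have ga : p (g a) = k a by apply: gk; rewrite a0 lexx.
have Uk r : U (k (clamp a s' r)).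
  apply: kU; have := clamp_bound r as'.
  move: sd sd'; rewrite /ball /= /ball_ !ltr_distlC => /andP[? ?] /andP[? ?] /andP[? ?].
  have : s <= a by rewrite /a; case: ifP => ?; lra.
  by move=> ?; apply/andP; split; lra.
have Ua : U (p (g a)) by rewrite ga -(@clamp_id R a s' a) ?lexx.
have [V SV Vg] := HU _ Ua.
have [h ch hP] : exists2 h : R -> E, continuous h &
    forall r, V (h r) /\ p (h r) = k (clamp a s' r).
  apply: (sheet_section (sS V SV)) => // r; apply: continuous_comp; last exact: ck.
  exact: clamp_continuous.
have ha : g a = h a.
  have [_ Vi _ _ _] := sS V SV; have [Vh ph] := hP a.
  by apply: Vi; rewrite ?inE // ph clamp_id ?lexx.
exists (fun r => if r <= a then g r else h r); split.
- exact: continuous_glue.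
- by rewrite a0.
- move=> r rs'; case: ifP => ra; first by apply: gk; lra.
  by rewrite (hP r).2 clamp_id //; lra.
Qed.

(* Lift the segments from z0: the times at which the lift depends continuously on
   the end point z of the segment form an open and closed set. *)
Lemma map_lift (W : normedModType R) (G : W -> B) z0 e0 : continuous G ->
  p e0 = G z0 ->
  exists L : W -> E, [/\ continuous L, L z0 = e0 & forall z, p (L z) = G z].
Proof.
move=> cG e0G.
pose H (zt : W * R) := G (z0 + clamp 0 1 zt.2 *: (zt.1 - z0)).
have cH : continuous H.
  move=> zt; apply: continuous_comp; last exact: cG.
  apply: cvgD; first exact: cvg_cst.
  apply: cvgZ.
    by apply: continuous_comp; [exact: cvg_snd|exact: clamp_continuous].
  by apply: cvgB; [exact: cvg_fst|exact: cvg_cst].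
have lift z : {g : R -> E | [/\ continuous g, g 0 = e0 &
    forall t, p (g t) = H (z, t)]}.
  apply: cid; pose k t := G (z0 + t *: (z - z0)).
  have [||g [cg g0 gk]] := @path_lift k e0; last by exists g.
    move=> t; apply: continuous_comp; last exact: cG.
    apply: cvgD; first exact: cvg_cst.
    by apply: cvgZ; [exact: cvg_id|exact: cvg_cst].
  by rewrite /k scale0r addr0.
pose l z := sval (lift z).
have lc z : continuous (l z) by have [] := svalP (lift z).
have l0 z : l z 0 = e0 by have [] := svalP (lift z).
have lH z t : p (l z t) = H (z, t) by have [_ _ ->] := svalP (lift z).
have H1 z : H (z, 1) = G z.
  by rewrite /H /= clamp_id ?lexx ?ler01 // scale1r addrC subrK.
exists (l ^~ 1); split; last by move=> z; rewrite lH H1.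
  move=> z; pose Q t := {for z, continuous (l ^~ t)}.
  suff : Q 1 by [].
  apply: (@connected_locally_constant R Q 0 (@real_connected R) _ _ 1); last first.
    rewrite /Q (_ : l ^~ 0 = cst e0); first exact: cst_continuous.
    by apply/funext => ?; rewrite l0.
  move=> t.
  have [U [S [oU Ut sS tS HU]]] := covering_sheets (p (l z t)).
  have [V SV Vg] := HU _ Ut.
  have [oV Vi Vs Vo Vc] := sS V SV.
  have : nbhs (z, t) (H @^-1` U) by apply: cH; apply: open_nbhs_nbhs; rewrite -lH.
  move=> [[M N] /= [Mz Nt] MN].
  have : nbhs t (N `&` l z @^-1` V).
    by apply: filterI => //; apply: lc; exact: open_nbhs_nbhs.
  move=> /nbhs_ballP[d /= d0 dN]; exists (ball t d); first exact: nbhsx_ballx.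
  move=> s s' sd sd' Qs.
  have HV : \forall y \near z, V (l y s').
    have : nbhs z (l ^~ s @^-1` V).
      by apply: Qs; apply: open_nbhs_nbhs; split=> //; have [] := dN _ sd.
    move=> Hs; near=> y.
    (* The lift over the whole time interval is connected, so it stays in the sheet that contains it
       at time s. *)
    have : l y @` ball t d `<=` V.
      apply: Vc.
      + apply: connected_continuous_connected; first exact: ball_connected.
        exact: continuous_subspaceT.
      + move=> _ [r rd <-] /=; rewrite lH; apply: MN; split=> /=; first by near: y.
        by have [] := dN _ rd.
      + by exists (l y s); split; [exists s|near: y].
    by apply; exists s'.
  move=> A; rewrite nbhsE => -[A' [oA' A'z A'A]].
  have oAV : open (p @` (A' `&` V)) by apply: Vo; [exact: openI|move=> x []].
  have : nbhs z ((fun y => H (y, s')) @^-1` (p @` (A' `&` V))).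
    apply: (@continuous_comp _ _ _ (fun y => (y, s')) H); [|exact: cH|].
      by apply: continuous_pair; [exact: cvg_id|exact: cvg_cst].
    apply: open_nbhs_nbhs; split=> //; exists (l z s') => //; split=> //.
    by have [] := dN _ sd'.
  move=> HA; apply: (nbhsS (filterI HV HA)) => y [Vy [x [A'x Vx] e]]; apply: A'A.
  by rewrite -(Vi x (l y s')) ?inE // e lH.
(* The segment from z0 to itself is constant, hence so is its lift. *)
have := @lift_unique R (l z0) (cst e0) 0 (@real_connected R) (lc z0).
move=> /(_ (@cst_continuous _ _ _)); apply=> // t.
by rewrite lH /H subrr scaler0 addr0 e0G.
Unshelve. all: by end_near.
Qed.

End Lifting.

Section Geometry.
Variable R : realType.
Implicit Types (z w : R * R) (i j : nat) (s t : R).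
Notation disc := (@disc R).

(** * Geometry of the disc *)

Definition norm2 z := z.1 ^+ 2 + z.2 ^+ 2.
Definition dist2 z w := norm2 (z - w).

Lemma norm2_continuous : continuous norm2.
Proof.
move=> z; apply: cvgD; rewrite expr2; apply: cvgM;
  by [exact: cvg_fst|exact: cvg_snd].
Qed.

Lemma norm2_ge0 z : 0 <= norm2 z.
Proof. by rewrite addr_ge0 // sqr_ge0. Qed.

Lemma dist2_continuous w : continuous (dist2 ^~ w).
Proof.
move=> z; apply: (@continuous_comp _ _ _ (fun z => z - w) norm2);
  last exact: norm2_continuous.
by apply: cvgB; [exact: cvg_id|exact: cvg_cst].
Qed.

Lemma dist2_eq0 z w : (dist2 z w == 0) = (z == w).
Proof.
rewrite /dist2 /norm2 paddr_eq0 ?sqr_ge0 // !sqrf_eq0 !subr_eq0.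
by case: z => ? ?; case: w => ? ?.
Qed.

(** By (s + t)^2 <= 2 (s^2 + t^2); the factor 4 reappears in [star_radius]. *)
Lemma dist2_triangle r z w x : dist2 z x < r -> dist2 z w < r -> dist2 x w < 4 * r.
Proof.
case: z w x => z1 z2 [w1 w2] [x1 x2]; rewrite /dist2 /norm2 /= => h1 h2.
have := sqr_ge0 (z1 - x1 + (z1 - w1)); have := sqr_ge0 (z2 - x2 + (z2 - w2)).
by move: h1 h2; rewrite !expr2; nra.
Qed.

(** Radial retraction onto the disc. It extends [q] to the whole plane, a normed space, where
    [map_lift] applies. *)
Definition retract z : R * R := (Num.max 1 (Num.sqrt (norm2 z)))^-1 *: z.

Lemma retract_id z : disc z -> retract z = z.
Proof.
move=> zd; rewrite /retract max_l ?invr1 ?scale1r //.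
by rewrite -[leRHS]sqrtr1 ler_wsqrtr.
Qed.

Lemma retract_disc z : disc (retract z).
Proof.
rewrite /disc /=; set m := Num.max _ _.
have m1 : 1 <= m by rewrite le_max lexx.
rewrite -(ler_pM2l (_ : 0 < m ^+ 2)); last by rewrite exprn_gt0 // (lt_le_trans _ m1).
have -> : m ^+ 2 * ((m^-1 * z.1) ^+ 2 + (m^-1 * z.2) ^+ 2) = norm2 z.
  by rewrite /norm2; field; lra.
rewrite mulr1 -[leLHS]sqr_sqrtr ?norm2_ge0 // lerXn2r ?nnegrE ?sqrtr_ge0 //.
  by lra.
by rewrite le_max lexx orbT.
Qed.

Lemma retract_continuous : continuous retract.
Proof.
move=> z; apply: cvgZ; last exact: cvg_id.
pose g (n : R) := if n <= 1 then 1 else n.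
have cg : continuous g.
  by apply: (@continuous_glue R R (fun=> 1) id 1) => // t; [exact: cvg_cst|exact: cvg_id].
have -> : (fun z => (Num.max 1 (Num.sqrt (norm2 z)))^-1) =
   (fun z => (g (Num.sqrt (norm2 z)))^-1).
  by apply/funext => y; rewrite /g; case: leP.
have -> : Num.max 1 (Num.sqrt (norm2 z)) = g (Num.sqrt (norm2 z)).
  by rewrite /g; case: leP.
apply: cvgV; first by rewrite /g; case: leP => h; lra.
apply: (@continuous_comp _ _ _ norm2 (g \o Num.sqrt)); first exact: norm2_continuous.
by apply: continuous_comp; [exact: sqrt_continuous|exact: cg].
Qed.

Lemma disc_closed : closed disc.
Proof.
apply: (@preimage_closed _ _ norm2 [set x | x <= 1]); last exact: closed_le.
by move=> z _; exact: norm2_continuous.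
Qed.

Lemma disc_compact : compact disc.
Proof.
apply: (@subclosed_compact _ disc (`[(-1 : R), (1 : R)] `*` `[(-1 : R), (1 : R)])%classic).
- exact: disc_closed.
- by apply: compact_setX; exact: segment_compact.
- case=> x y; rewrite /disc /= => xy; split; rewrite /= in_itv /=; nra.
Qed.

Lemma norm2_side i t : norm2 (side i t) = 1.
Proof. by rewrite /norm2 /= cos2Dsin2. Qed.

Lemma side_disc i t : disc (side i t).
Proof. by have := norm2_side i t; rewrite /disc /= /norm2 /= => ->. Qed.

Lemma side_continuous i : continuous (@side R i).
Proof.
move=> t.
have ca : {for t, continuous (fun t : R => (i%:R + t) * pi / 4)}.
  apply: cvgM; last exact: cvg_cst.
  apply: cvgM; last exact: cvg_cst.
  by apply: cvgD; [exact: cvg_cst|exact: cvg_id].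
apply: continuous_pair.
  by apply: (continuous_comp ca); exact: continuous_cos.
by apply: (continuous_comp ca); exact: continuous_sin.
Qed.

Lemma sideS i : side i 1 = side i.+1 0 :> R * R.
Proof. by rewrite /side addr0 natr1. Qed.

Lemma dist2_side i j s t : dist2 (side i s) (side j t) =
  2 - 2 * cos ((i%:R + s) * pi / 4 - (j%:R + t) * pi / 4).
Proof.
rewrite cosB /dist2 /norm2 /=.
move: (cos2Dsin2 ((i%:R + s) * pi / 4)) (cos2Dsin2 ((j%:R + t) * pi / 4)).
by rewrite !expr2; nra.
Qed.

(** A chord between two points of one side depends only on the parameter difference up to sign. *)
Lemma dist2_glue i s t :
  dist2 (side i.+2 (1 - s)) (side i.+2 (1 - t)) = dist2 (side i s) (side i t).
Proof.
rewrite !dist2_side -[in RHS]cosN; congr (_ - _ * cos _).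
by field.
Qed.

(** The angle difference x has cos x = 1 and absolute value below 2 pi, so the half-angle sine
    forces x = 0. Since t is interior, the point is not a common corner of consecutive sides. *)
Lemma side_inj i j s t : (i < 8)%N -> (j < 8)%N -> 0 <= s <= 1 -> 0 < t < 1 ->
  side i s = side j t -> i = j /\ s = t.
Proof.
move=> i8 j8 s01 t01 /eqP; rewrite -dist2_eq0 dist2_side => /eqP e.
pose x : R := ((i%:R + s) - (j%:R + t)) * pi / 4.
have {}e : cos x = 1 by have -> : x = (i%:R + s) * pi / 4 - (j%:R + t) * pi / 4;
  [rewrite /x; field|lra].
have pi0 := pi_gt0 R.
have i8' : i%:R <= 7 :> R by rewrite (ler_nat _ _ 7).
have j8' : j%:R <= 7 :> R by rewrite (ler_nat _ _ 7).
have i0 : 0 <= i%:R :> R by [].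
have j0 : 0 <= j%:R :> R by [].
have s0 : sin (x / 2) = 0.
  apply/eqP; rewrite -sqrf_eq0; apply/eqP.
  have : cos x = 1 - 2 * sin (x / 2) ^+ 2.
    by rewrite {1}(splitr x) cosD -expr2 -expr2 cos2sin2; ring.
  by rewrite e; lra.
have x_lb : - (2 * pi) < x.
  have : 0 < pi * ((i%:R + s) - (j%:R + t) + 8) :> R by apply: mulr_gt0 => //; lra.
  by rewrite /x; lra.
have x_ub : x < 2 * pi.
  have : 0 < pi * (8 - ((i%:R + s) - (j%:R + t))) :> R by apply: mulr_gt0 => //; lra.
  by rewrite /x; lra.
have x0 : x = 0.
  have [x_lt|x_gt|//] := ltgtP x 0.
  - have : 0 < sin (- (x / 2)) by apply: sin_gt0_pi; lra.
    by rewrite sinN s0; lra.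
  - have : 0 < sin (x / 2) by apply: sin_gt0_pi; lra.
    by rewrite s0; lra.
have {x0} e2 : i%:R + s = j%:R + t.
  by move: x0; rewrite /x => /eqP; rewrite !mulf_eq0 invr_eq0; lra.
have ij : i = j.
  have [ij|ji|//] := ltngtP i j.
  - have : (i.+1)%:R <= j%:R :> R by rewrite ler_nat.
    by rewrite -natr1; move=> ?; exfalso; lra.
  - have : (j.+1)%:R <= i%:R :> R by rewrite ler_nat.
    by rewrite -natr1; move=> ?; exfalso; lra.
by split=> //; subst j; lra.
Qed.

(** * Classes of the boundary identification *)

Definition glued : R * R -> R * R -> Prop := clos_refl_sym_trans (R * R) (@glue R).

Lemma glue_norm2 z w : glue z w -> norm2 z = 1 /\ norm2 w = 1.
Proof. by move=> [i [t [_ _ -> ->]]]; rewrite !norm2_side. Qed.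

Lemma closed_class (S : set (R * R)) z w :
  (forall x y, glue x y -> S x <-> S y) -> glued z w -> S z -> S w.
Proof.
move=> HS zw; suff : S z <-> S w by move=> [].
elim: zw => [x y /HS //|//|x y _ [? ?] //|x y u _ [? ?] _ [? ?]].
by split; auto.
Qed.

Lemma glued_disc z w : disc z -> glued z w -> disc w.
Proof.
move=> zd zw; apply: (closed_class (S := disc) _ zw) => // x y /glue_norm2.
by rewrite /disc /= /norm2 => -[-> ->].
Qed.

Lemma glued_interior z w : norm2 z < 1 -> glued z w -> w = z.
Proof.
move=> z1 zw; apply: (closed_class (S := [set y | y = z]) _ zw) => //.
by move=> x y /glue_norm2[x1 y1] /=; split=> ?; subst; exfalso; lra.
Qed.

(* The two reflections of the plane which carry each glued side to its partner;
   they generate a dihedral group of order 8. *)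
Let c : R := cos (3 * pi / 4).
Let s' : R := sin (3 * pi / 4).
Let reflection z : R * R := (c * z.1 + s' * z.2, s' * z.1 - c * z.2).
Let rotation z : R * R := (- z.2, z.1).

Let reflection_side (i : nat) t : i \in [:: 0; 1; 4; 5]%N ->
  side i.+2 (1 - t) = reflection (side i t) \/
  side i.+2 (1 - t) = rotation (reflection (side i t)).
Proof.
(* The angles of [side j t] and [side j.+2 (1 - t)] add up to [A j], so a reflection exchanges the
   two points. *)
pose A (i : nat) : R := (2 * i%:R + 3) * pi / 4.
have E (j : nat) : side j.+2 (1 - t) = (cos (A j) * (side j t).1 + sin (A j) * (side j t).2,
    sin (A j) * (side j t).1 - cos (A j) * (side j t).2).
  rewrite /side /= -cosB -sinB -(natr1 j.+1) -(natr1 j).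
  by congr (cos _, sin _); rewrite /A; field.
have A0 : A 0%N = 3 * pi / 4 by rewrite /A; field.
have A1 : A 1%N = 3 * pi / 4 + pi / 2 by rewrite /A; field.
have A4 : A 4%N = A 0%N + pi *+ 2 by rewrite /A -mulr_natr; field.
have A5 : A 5%N = A 1%N + pi *+ 2 by rewrite /A -mulr_natr; field.
have c1 : cos (A 1%N) = - s' by rewrite A1 cosDpihalf.
have s1 : sin (A 1%N) = c by rewrite A1 sinDpihalf.
have [c0 s0] : cos (A 0%N) = c /\ sin (A 0%N) = s' by rewrite A0.
rewrite !inE => /or4P[]/eqP->; rewrite E.
- by left; rewrite c0 s0.
- right; rewrite c1 s1 /rotation /reflection; congr pair; rewrite /=; ring.
- by left; rewrite A4 cosD2pi sinD2pi c0 s0.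
- right; rewrite A5 cosD2pi sinD2pi c1 s1 /rotation /reflection; congr pair; rewrite /=; ring.
Qed.

Let cs1 : c ^+ 2 + s' ^+ 2 = 1. Proof. exact: cos2Dsin2. Qed.

Let reflectionK z : reflection (reflection z) = z.
Proof.
case: z => x y; rewrite /reflection /=; congr pair.
  rewrite -[RHS]mul1r -cs1; ring.
rewrite -[RHS]mul1r -cs1; ring.
Qed.

Let reflection_rotation z :
  reflection (rotation z) = rotation (rotation (rotation (reflection z))).
Proof. by rewrite /reflection /rotation /=; congr pair; ring. Qed.

Let rotation4 z : rotation (rotation (rotation (rotation z))) = z.
Proof. by case: z => x y; rewrite /rotation /= !opprK. Qed.

Let dihedral z : seq (R * R) :=
  [seq iter n rotation z | n <- iota 0 4] ++
  [seq iter n rotation (reflection z) | n <- iota 0 4].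

Let dihedral_rotation z w : w \in dihedral z -> rotation w \in dihedral z.
Proof.
rewrite /dihedral /= !inE.
by do 7 (case/predU1P => [->|]; first by rewrite ?rotation4 ?eqxx ?orbT);
  move/eqP=> ->; rewrite ?rotation4 ?eqxx ?orbT.
Qed.

Let dihedral_reflection z w : w \in dihedral z -> reflection w \in dihedral z.
Proof.
rewrite /dihedral /= !inE.
by do 7 (case/predU1P => [->|];
  first by rewrite ?reflection_rotation ?reflectionK ?rotation4 ?eqxx ?orbT);
  move/eqP=> ->; rewrite ?reflection_rotation ?reflectionK ?rotation4 ?eqxx ?orbT.
Qed.

(** Each generator of the gluing acts by an element of the dihedral group, so a class lies in one of
    its orbits. *)
Lemma glued_finite z : exists A : seq (R * R), forall w, glued z w -> w \in A.
Proof.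
exists (dihedral z) => w zw.
apply: (closed_class (S := [set y | y \in dihedral z]) _ zw); last first.
  by rewrite /= /dihedral /= !inE eqxx.
move=> x y [i [t [i4 _ -> ->]]] /=.
case: (reflection_side t i4) => ->; split=> H.
- exact: dihedral_reflection.
- by rewrite -[side i t]reflectionK; exact: dihedral_reflection.
- exact/dihedral_rotation/dihedral_reflection.
- rewrite -[side i t]reflectionK -[reflection (side i t)]rotation4.
  by apply: dihedral_reflection; do 3 apply: dihedral_rotation.
Qed.

Lemma seq_radius (T : eqType) (A : seq T) (P : T -> R -> Prop) :
  (forall x, exists2 r, 0 < r & forall r', r' <= r -> P x r') ->
  exists2 r, 0 < r & forall x, x \in A -> P x r.
Proof.
move=> H; suff [r r0 Hr] : exists2 r, 0 < r & forall x, x \in A ->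
    forall r', r' <= r -> P x r'.
  by exists r => // x xA; exact: Hr.
elim: A => [|x A [r r0 Hr]]; first by exists 1.
have [r1 r10 Hr1] := H x; exists (Num.min r r1); first by rewrite lt_min r0 r10.
move=> y; rewrite inE => /predU1P[->|yA] r'; rewrite le_min => /andP[? ?].
  exact: Hr1.
exact: Hr.
Qed.

Lemma side_away i z : (forall t, 0 <= t <= 1 -> z <> side i t) ->
  exists2 r, 0 < r & forall t, 0 <= t <= 1 -> r <= dist2 (side i t) z.
Proof.
move=> zi.
have cd : compact ((fun t => dist2 (side i t) z) @` `[0, 1]).
  apply: continuous_compact; last exact: segment_compact.
  apply: continuous_subspaceT => t; apply: (@continuous_comp _ _ _ (side i) (dist2 ^~ z)).
    exact: side_continuous.
  exact: dist2_continuous.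
have cl := compact_closed (@Rhausdorff R) cd.
have : nbhs (0 : R) (~` ((fun t => dist2 (side i t) z) @` `[0, 1])).
  apply: open_nbhs_nbhs; split; first exact: closed_openC.
  move=> [t /=]; rewrite in_itv /= => t01 /eqP; rewrite dist2_eq0 => /eqP e.
  exact: (zi t).
move=> /nbhs_ballP[r /= r0 Hr]; exists r => // t t01; rewrite leNgt; apply/negP => lt.
apply: (Hr (dist2 (side i t) z)); last by exists t; rewrite //= in_itv.
by rewrite /ball /= /ball_ sub0r normrN ger0_norm // norm2_ge0.
Qed.

(* Within distance r of a class (in the squared metric) the gluing only uses the
   identifications between the points of the class itself. *)
Record star_radius z r : Prop := StarRadius {
  star_gt0 : 0 < r;
  star_sep : forall x y, glued z x -> glued z y -> dist2 x y < 4 * r -> x = y;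
  star_side : forall i t x, (i < 8)%N -> 0 <= t <= 1 -> glued z x ->
    dist2 (side i t) x < r -> exists2 t', 0 <= t' <= 1 & x = side i t' }.

(** The class is finite, there are eight sides, and a side has positive distance from a point not on
    it; finitely many bounds suffice. *)
Lemma star_radius_exists z : exists r, star_radius z r.
Proof.
have [A HA] := glued_finite z.
have [r1 r10 H1] : exists2 r : R, 0 < r & forall xy : (R * R) * (R * R),
    xy \in [seq (x, y) | x <- A, y <- A] -> dist2 xy.1 xy.2 < 4 * r -> xy.1 = xy.2.
  apply: (@seq_radius _ _ (fun xy r => dist2 xy.1 xy.2 < 4 * r -> xy.1 = xy.2)) => -[x y] /=.
  have [->|xy] := eqVneq x y; first by exists 1.
  exists (dist2 x y / 4); last by move=> r' ? ?; exfalso; lra.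
  by rewrite divr_gt0 // lt_def norm2_ge0 dist2_eq0 xy.
have [r2 r20 H2] : exists2 r : R, 0 < r & forall xi : (R * R) * nat,
    xi \in [seq (x, i) | x <- A, i <- iota 0 8] ->
    forall t, 0 <= t <= 1 -> dist2 (side xi.2 t) xi.1 < r ->
      exists2 t', 0 <= t' <= 1 & xi.1 = side xi.2 t'.
  apply: (@seq_radius _ _ (fun xi r => forall t, 0 <= t <= 1 ->
    dist2 (side xi.2 t) xi.1 < r -> exists2 t', 0 <= t' <= 1 & xi.1 = side xi.2 t')).
  move=> [x i] /=.
  have [H|H] := pselect (exists2 t', 0 <= t' <= 1 & x = side i t'); first by exists 1.
  have [|r r0 Hr] := @side_away i x; first by move=> t t01 e; apply: H; exists t.
  by exists r => // r' rr' t /Hr h1 h2; exfalso; lra.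
exists (Num.min r1 r2); split; first by rewrite lt_min r10 r20.
- move=> x y zx zy xy; apply: (H1 (x, y)).
    by apply/allpairsP; exists (x, y); split=> //=; exact: HA.
  apply: lt_le_trans xy _; rewrite ler_pM2l // ge_min lexx //.
- move=> i t x i8 t01 zx d; apply: (H2 (x, i)) t01 _.
    apply/allpairsP; exists (x, i); split=> //; first exact: HA.
    by change (i \in iota 0 8); rewrite mem_iota.
  by apply: lt_le_trans d _; rewrite ge_min lexx orbT.
Qed.

(** Supplies the point that two neighbouring cells share with no third cell; corners would not
    do. *)
Lemma glued_midpoint i z : i \in [:: 1; 5]%N -> glued (side i (1 / 2)) z ->
  z = side i (1 / 2) \/ z = side i.+2 (1 / 2).
Proof.
move=> i15 iz.
apply: (closed_class (S := [set y | y = side i (1 / 2) \/ y = side i.+2 (1 / 2)])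
  _ iz); last by left.
have h : 0 < (1 / 2 : R) < 1 by lra.
have hh : 1 - 1 / 2 = 1 / 2 :> R by lra.
have i8 : (i < 8)%N /\ (i.+2 < 8)%N by move: i15; rewrite !inE => /orP[]/eqP->.
move=> x y [j [t [j4 t01 -> ->]]] /=; rewrite in_itv /= in t01.
have t01' : 0 <= 1 - t <= 1 by lra.
have [j8 j8'] : (j < 8)%N /\ (j.+2 < 8)%N by move: j4; rewrite !inE => /or4P[]/eqP->.
split=> -[].
- by move/(side_inj j8 i8.1 t01 h) => [-> ->]; right; rewrite hh.
- move/(side_inj j8 i8.2 t01 h) => [e _]; exfalso; move: j4 i15.
  by rewrite !inE; lia.
- move/(side_inj j8' i8.1 t01' h) => [e _]; exfalso; move: j4 i15.
  by rewrite !inE; lia.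
- by move/(side_inj j8' i8.2 t01' h) => [[->] e]; left; congr side; lra.
Qed.

End Geometry.

(* The sides [offset l] and [offset l + 2] carry the letter l, the sides
   [offset l + 1] and [offset l + 3] the letter alpha or beta. *)
Definition offset (l : label) : nat := if l is La then 0 else 4.

(** * Systems of cells glued along the sides of the disc *)

Section CellSystem.
Variables (R : realType) (I T : Type) (mvI : label -> I -> I) (D : I -> R * R -> T).

(** Read the boundary word: alpha lifts to loops, so the sides a and a^-1 of a cell are the same
    lift of a ([cs_fold]), while the side alpha of the cell of v starts at the vertex a v and is
    also the side alpha^-1 of the cell of a v ([cs_cross]). So a-edges cross alpha-sides, and
    b-edges cross beta-sides. *)
Record cell_system : Prop := CellSystem {
  cs_surj : forall l v, exists w, mvI l w = v;
  cs_inj : forall v w z, D v z = D w z -> v = w;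
  cs_fold : forall l v t, 0 <= t <= 1 ->
    D v (side (offset l) t) = D v (side (offset l).+2 (1 - t));
  cs_cross : forall l v t, 0 <= t <= 1 ->
    D v (side (offset l).+1 t) = D (mvI l v) (side (offset l).+3 (1 - t)) }.

Definition adjI u u' := exists l, u' = mvI l u \/ u = mvI l u'.
Definition cellI u : set T := D u @` @disc R.
Definition chain y := clos_refl_sym_trans I
  (fun u u' => [/\ cellI u y, cellI u' y & adjI u u']).

Hypothesis cs : cell_system.

(** Folding and crossing in one form: passing from side i to side i + 2 takes v to [phi v], which is
    v or a neighbour. *)
Lemma glue_shift i : i \in [:: 0; 1; 4; 5]%N -> exists phi : I -> I,
  [/\ forall v, phi v = v \/ adjI v (phi v), forall u, exists v, phi v = u &
      forall v t, 0 <= t <= 1 -> D v (side i t) = D (phi v) (side i.+2 (1 - t))].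
Proof.
have fold l : exists phi : I -> I,
  [/\ forall v, phi v = v \/ adjI v (phi v), forall u, exists v, phi v = u &
      forall v t, 0 <= t <= 1 ->
        D v (side (offset l) t) = D (phi v) (side (offset l).+2 (1 - t))].
  exists id; split; [by left|by move=> u; exists u|exact: (cs_fold cs)].
have cross l : exists phi : I -> I,
  [/\ forall v, phi v = v \/ adjI v (phi v), forall u, exists v, phi v = u &
      forall v t, 0 <= t <= 1 ->
        D v (side (offset l).+1 t) = D (phi v) (side (offset l).+3 (1 - t))].
  exists (mvI l); split; [|exact: (cs_surj cs)|exact: (cs_cross cs)].
  by move=> v; right; exists l; left.
rewrite !inE => /or4P[]/eqP->.
- exact: (fold La).
- exact: (cross La).
- exact: (fold Lb).
- exact: (cross Lb).
Qed.

Lemma chain_sym y u v : chain y u v -> chain y v u.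
Proof. exact: rst_sym. Qed.

Lemma glued_transport z w : glued z w ->
  (forall v, exists u, D v z = D u w /\ chain (D v z) v u) /\
  (forall u, exists v, D v z = D u w /\ chain (D v z) v u).
Proof.
elim=> {z w} [z w [i [t [i4 t01 -> ->]]]|z|z w _ [H1 H2]|x y z _ [H1 H2] _ [H3 H4]].
- rewrite /= in_itv /= in t01.
  have [phi [phiP phis phiD]] := glue_shift i4.
  have ch v : chain (D v (side i t)) v (phi v).
    have [->|a] := phiP v; first exact: rst_refl.
    apply: rst_step; split=> //; first by exists (side i t) => //; exact: side_disc.
    by exists (side i.+2 (1 - t)); [exact: side_disc|rewrite phiD].
  split=> [v|u]; first by exists (phi v); split; [exact: phiD|exact: ch].
  by have [v <-] := phis u; exists v; split; [exact: phiD|exact: ch].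
- by split=> v; exists v; split=> //; exact: rst_refl.
- split=> v.
    by have [u [e c]] := H2 v; exists u; split=> //; rewrite -e; exact: chain_sym.
  by have [u [e c]] := H1 v; exists u; split=> //; rewrite -e; exact: chain_sym.
- split=> v.
    have [u [e c]] := H1 v; have [u' [e' c']] := H3 u; exists u'; rewrite e; split=> //.
    by apply: rst_trans c'; rewrite -e.
  have [u [e c]] := H4 v; have [u' [e' c']] := H2 u; exists u'; rewrite e'; split=> //.
  by rewrite -e'; apply: rst_trans c' _; rewrite e'.
Qed.

Lemma glued_chain z w v u : glued z w -> D v z = D u w -> chain (D v z) v u.
Proof.
move=> zw e; have [H _] := glued_transport zw; have [u' [e' c]] := H v.
by have -> : u = u' by apply: (cs_inj cs (z := w)); rewrite -e -e'.
Qed.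

(** One cell u matches v at both points: the correspondence of cells at w and w' extends to z and
    z'. *)
Let together w z w' z' :=
  (forall v, exists u, D v w = D u w' /\ D v z = D u z') /\
  (forall u, exists v, D v w = D u w' /\ D v z = D u z').

(** When w is glued along a side, [star_side] puts the centre x on the same side, and the gluing
    moves it along with w at the same distance. *)
Let star_track z r w w' : star_radius z r -> glued w w' ->
  (forall x, glued z x -> dist2 w x < r -> exists x',
    [/\ glued z x', dist2 w' x' < r & together w x w' x']) /\
  (forall x', glued z x' -> dist2 w' x' < r -> exists x,
    [/\ glued z x, dist2 w x < r & together w x w' x']).
Proof.
move=> zr; elim=> {w w'}
  [w w' [i [t [i4 t01 -> ->]]]|w|w w' _ [H1 H2]|w1 w2 w3 _ [H1 H2] _ [H3 H4]].
- rewrite /= in_itv /= in t01.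
  have [phi [_ phis phiD]] := glue_shift i4.
  have [i8 i8'] : (i < 8)%N /\ (i.+2 < 8)%N by move: i4; rewrite !inE => /or4P[]/eqP->.
  have tog s : 0 <= s <= 1 ->
      together (side i t) (side i s) (side i.+2 (1 - t)) (side i.+2 (1 - s)).
    move=> s01; split=> [v|u]; first by exists (phi v); rewrite !phiD.
    by have [v <-] := phis u; exists v; rewrite !phiD.
  have gl s : 0 <= s <= 1 -> glue (side i s) (side i.+2 (1 - s)).
    by move=> s01; exists i, s; rewrite /= in_itv.
  split=> [x zx d|x zx d].
    have [s s01 e] := star_side zr i8 t01 zx d; exists (side i.+2 (1 - s)).
    rewrite dist2_glue -e; split=> //.
      by apply: rst_trans zx _; rewrite e; apply: rst_step; exact: gl.
    by rewrite e; exact: tog.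
  have t01' : 0 <= 1 - t <= 1 by lra.
  have [s s01 e] := star_side zr i8' t01' zx d.
  have s01' : 0 <= 1 - s <= 1 by lra.
  have es : side i.+2 (1 - (1 - s)) = x by rewrite e; congr side; lra.
  exists (side i (1 - s)); split.
  + apply: rst_trans zx _; apply: rst_sym; apply: rst_step.
    by rewrite -es; exact: gl.
  + by rewrite -dist2_glue es.
  + by rewrite -es; exact: tog.
- by split=> x zx d; exists x; split=> //; split=> v; exists v.
- have sym a b c d : together a b c d -> together c d a b.
    by move=> [h1 h2]; split=> v; [have [u []] := h2 v|have [u []] := h1 v]; exists u.
  split=> x zx d.
    by have [x' [? ? ?]] := H2 x zx d; exists x'; split=> //; exact: sym.
  by have [x' [? ? ?]] := H1 x zx d; exists x'; split=> //; exact: sym.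
- have tr a b c d a' b' : together a b c d -> together c d a' b' -> together a b a' b'.
    move=> [h1 h2] [h3 h4]; split=> v.
      have [u [e1 e2]] := h1 v; have [u' [e3 e4]] := h3 u.
      by exists u'; rewrite e1 e2.
    have [u [e1 e2]] := h4 v; have [u' [e3 e4]] := h2 u.
    by exists u'; rewrite e3 e4.
  split=> x zx d.
    have [x' [zx' d' t']] := H1 x zx d; have [x2 [zx2 d2 t2]] := H3 x' zx' d'.
    by exists x2; split=> //; exact: tr t' t2.
  have [x' [zx' d' t']] := H4 x zx d; have [x2 [zx2 d2 t2]] := H2 x' zx' d'.
  by exists x2; split=> //; exact: tr t2 t'.
Qed.

(** [star_track] carries the centre x1 along from w1 to w2, and [star_sep] identifies the result
    with x2. *)
Lemma star_same z r x1 x2 w1 w2 v1 v2 : star_radius z r ->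
  glued z x1 -> glued z x2 -> dist2 w1 x1 < r -> dist2 w2 x2 < r ->
  glued w1 w2 -> D v1 x1 = D v2 x2 <-> D v1 w1 = D v2 w2.
Proof.
move=> zr zx1 zx2 d1 d2 w12.
have [x2' [zx2' d2' [H _]]] := (star_track zr w12).1 x1 zx1 d1.
have e : x2' = x2 by apply: (star_sep zr) => //; exact: dist2_triangle d2' d2.
subst x2'; have [u [-> ->]] := H v1.
by split=> /(cs_inj cs) ->.
Qed.

End CellSystem.

Lemma normed_connected (R : realType) (V : normedModType R) : connected [set: V].
Proof.
have -> : [set: V] = \bigcup_z [set t *: z | t in [set: R]].
  by apply/seteqP; split=> // z _; exists z => //; exists 1; rewrite ?scale1r.
apply: bigcup_connected; first by exists 0 => z _; exists 0; rewrite ?scale0r.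
move=> z _; apply: connected_continuous_connected; first exact: real_connected.
by apply: continuous_subspaceT => t; apply: cvgZ; [exact: cvg_id|exact: cvg_cst].
Qed.

(** * Lifting the disc to a covering *)

Section Level.
Variables (R : realType) (X0 : topologicalType) (q : R * R -> X0).
Hypothesis hq : genus2_surface q.
Variables (E : topologicalType) (p : E -> X0) (I : Type) (fib : I -> E)
  (mvI : label -> I -> I).
Hypothesis cp : covering_map p.
Hypothesis fibP : set_bij setT (p @^-1` [set x0 q]) fib.

Lemma surface_map_continuous : continuous (q \o @retract R).
Proof.
have [_ cq _ _] := hq; apply: continuous_within_comp cq _ _.
  exact: retract_continuous.
exact: retract_disc.
Qed.

Lemma cells_exist : exists D : I -> R * R -> E, [/\ forall v, continuous (D v),
  forall v z, p (D v z) = q (retract z) & forall v, D v (side 0 0) = fib v].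
Proof.
have [fs _ _] := fibP.
have H v : {L : R * R -> E | [/\ continuous L, L (side 0 0) = fib v &
    forall z, p (L z) = q (retract z)]}.
  apply: cid; apply: (@map_lift _ _ _ cp R (R * R)%type (q \o @retract R)).
    exact: surface_map_continuous.
  by rewrite (fs v) // /= retract_id //; exact: side_disc.
by exists (fun v => sval (H v)); split=> v; have [] := svalP (H v).
Qed.

Lemma path_unique (c d : R -> E) t0 : is_path c -> is_path d -> 0 <= t0 <= 1 ->
  (forall t, 0 <= t <= 1 -> p (c t) = p (d t)) -> c t0 = d t0 ->
  forall t, 0 <= t <= 1 -> c t = d t.
Proof.
move=> pc pd t01 cd e t tt.
have := @lift_unique _ _ _ cp R (c \o clamp 0 1) (d \o clamp 0 1) t0
  (@real_connected R) (path_continuous pc) (path_continuous pd).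
move=> /(_ _ _ t); rewrite /= !clamp_id //; apply=> // s.
by apply: cd; exact: clamp_bound.
Qed.

Variable D : I -> R * R -> E.
Hypothesis D_cont : forall v, continuous (D v).
Hypothesis D_proj : forall v z, p (D v z) = q (retract z).
Hypothesis D_base : forall v, D v (side 0 0) = fib v.

(** Lifts that agree at one point agree at the corner [side 0 0], where their values are [fib v] and
    [fib w]. *)
Lemma D_inj v w z : D v z = D w z -> v = w.
Proof.
move=> e; have [_ fi _] := fibP; apply: fi; rewrite ?inE // -!D_base.
apply: (@lift_unique _ _ _ cp (R * R)%type (D v) (D w) z) => //.
  exact: normed_connected.
by move=> t; rewrite !D_proj.
Qed.

Lemma D_surj x z : disc z -> p x = q z -> exists v, D v z = x.
Proof.
move=> zd e; have [_ _ fs] := fibP.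
have [|L [cL Lz Lp]] := @map_lift _ _ _ cp R (R * R)%type (q \o @retract R) z x
   surface_map_continuous; first by rewrite /= retract_id.
have [|v _ fv] := fs (L (side 0 0)).
  by rewrite /= Lp /= retract_id //; exact: side_disc.
exists v; rewrite -Lz.
apply: (@lift_unique _ _ _ cp (R * R)%type (D v) L (side 0 0)) => //.
- exact: normed_connected.
- by move=> t; rewrite D_proj Lp.
- by rewrite D_base.
Qed.

Hypothesis lift_l : forall l v, lifts_to p (loop q l) (fib v) (fib (mvI l v)).
Hypothesis lift_cross : forall l v,
  lifts_to p (fun t => q (side (offset l).+1 t)) (fib v) (fib v).

Let side_path i (k : R -> R) v : continuous k -> is_path (fun t => D v (side i (k t))).
Proof.
move=> ck; apply: continuous_path => t.
apply: (@continuous_comp _ _ _ k (D v \o side i)); first exact: ck.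
by apply: continuous_comp; [exact: side_continuous|exact: D_cont].
Qed.

Let rev_continuous : continuous (fun t : R => 1 - t).
Proof. by move=> t; apply: cvgB; [exact: cvg_cst|exact: cvg_id]. Qed.

Let q_glue i t : i \in [:: 0; 1; 4; 5]%N -> 0 <= t <= 1 ->
  q (side i t) = q (side i.+2 (1 - t)).
Proof.
move=> i4 t01; have [_ _ _ H] := hq; apply/H; try exact: side_disc.
by apply: rst_step; exists i, t; rewrite /= in_itv.
Qed.

Let p_side v i t : p (D v (side i t)) = q (side i t).
Proof. by rewrite D_proj retract_id //; exact: side_disc. Qed.

(** Four consecutive sides are lifts of l, of the crossing loop and of their inverses. The last
    clause returns to [fib v], so the argument for La provides the starting corner for Lb. *)
Let corner_step l : (forall v, D v (side (offset l) 0) = fib v) ->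
  [/\ forall v t, 0 <= t <= 1 ->
        D v (side (offset l) t) = D v (side (offset l).+2 (1 - t)),
      forall v t, 0 <= t <= 1 ->
        D v (side (offset l).+1 t) = D (mvI l v) (side (offset l).+3 (1 - t)) &
      forall v, D v (side (offset l).+4 0) = fib v].
Proof.
move=> base; set o := offset l.
have o0 : o \in [:: 0; 1; 4; 5]%N by rewrite /o; case: (l).
have o1 : o.+1 \in [:: 0; 1; 4; 5]%N by rewrite /o; case: (l).
have z01 : 0 <= (0 : R) <= 1 by lra.
have u01 : 0 <= (1 : R) <= 1 by lra.
have c1 v : D v (side o.+1 0) = fib (mvI l v).
  rewrite -sideS; have [c [pc cl c0 <-]] := lift_l l v.
  apply: (@path_unique (fun t => D v (side o t)) c 0) => //.
  - by apply: side_path => t; exact: cvg_id.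
  - move=> t t01; rewrite p_side; have := cl t; rewrite in_itv /= => -> //.
    by rewrite /loop /o; case: (l).
  - by rewrite base c0.
have c2 v : D v (side o.+1 1) = fib (mvI l v).
  have [c [pc cl c0 <-]] := lift_cross l (mvI l v).
  apply: (@path_unique (fun t => D v (side o.+1 t)) c 0) => //.
  - by apply: side_path => t; exact: cvg_id.
  - by move=> t t01; rewrite p_side; have := cl t; rewrite in_itv /= => ->.
  - by rewrite c1 c0.
have fold v t : 0 <= t <= 1 -> D v (side o t) = D v (side o.+2 (1 - t)).
  move: t; apply: (@path_unique _ _ 1) => //.
  - by apply: side_path => t; exact: cvg_id.
  - exact: (@side_path _ (fun t => 1 - t) _ rev_continuous).
  - by move=> t t01; rewrite !p_side q_glue.
  - by rewrite subrr -sideS c2 sideS c1.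
have c3 v : D v (side o.+3 0) = fib v.
  by rewrite -sideS -[1]subr0 -fold // base.
have cross3 v (c : R -> E) : is_path c -> c 1 = fib v ->
    (forall t, 0 <= t <= 1 -> p (c t) = q (side o.+1 t)) ->
    forall t, 0 <= t <= 1 -> c t = D v (side o.+3 (1 - t)).
  move=> pc e cq; apply: (@path_unique _ _ 1) => //.
  - exact: (@side_path _ (fun t => 1 - t) _ rev_continuous).
  - by move=> t t01; rewrite cq // p_side q_glue.
  - by rewrite subrr c3.
split=> // [v t t01|v].
  apply: (cross3 (mvI l v) (fun t => D v (side o.+1 t))) => //.
  by apply: side_path => s; exact: cvg_id.
(* The fourth side is the reversed lift of the crossing loop at v, which is closed. *)
have [c [pc cl c0 e]] := lift_cross l v.
have cq t : 0 <= t <= 1 -> p (c t) = q (side o.+1 t).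
  by move=> t01; have := cl t; rewrite in_itv /= => ->.
by have := cross3 v c pc e cq 0 z01; rewrite subr0 sideS => <-.
Qed.

Lemma level_cell_system : (forall l v, exists w, mvI l w = v) ->
  cell_system mvI D.
Proof.
move=> ms.
have [a1 a2 a3] := @corner_step La D_base.
have [b1 b2 b3] := @corner_step Lb a3.
by split=> //; [exact: D_inj|case|case].
Qed.

End Level.

Lemma covering_hausdorff (E B : topologicalType) (p : E -> B) :
  covering_map p -> hausdorff_space B -> hausdorff_space E.
Proof.
move=> cp; rewrite !open_hausdorff => hB x y xy.
have [cont _] := cp; have [pxy|pxy] := eqVneq (p x) (p y); last first.
  have [[U V] /= [Ux Vy] [oU oV UV]] := hB _ _ pxy.
  exists (p @^-1` U, p @^-1` V) => /=; first by rewrite !inE in Ux Vy *.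
  split; [by apply: open_comp|by apply: open_comp|].
  by apply/eqP; rewrite -preimage_setI (eqP UV) preimage_set0.
have [U [S [oU Ux sS tS HU]]] := covering_sheets cp (p x).
have [V SV Vx] := HU _ Ux.
have [W SW Wy] : exists2 V, S V & V y by apply: HU; rewrite -pxy.
exists (V, W) => /=; first by rewrite !inE.
split; [exact: (sheet_open (sS V SV))|exact: (sheet_open (sS W SW))|].
apply/eqP; rewrite -subset0 => z [Vz Wz].
have VW : V = W by apply: tS => //; exists z.
have := sheet_inj (sS V SV) (x := x) (y := y); rewrite !inE => /(_ Vx).
by rewrite VW => /(_ Wy pxy) e; move/eqP: xy.
Qed.

(** * Topology of inverse limits *)

Section InverseLimit.
Variables (X : nat -> topologicalType) (f : forall k, X k.+1 -> X k).
Hypothesis f_cont : forall k, continuous (@f k).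
Notation L := (inverse_limit f).

Definition coord k (x : L) : X k := (set_val x : prod_topology X) k.

Lemma coordP k (x : L) : f (coord k.+1 x) = coord k x.
Proof. exact: (set_valP x). Qed.

Lemma coord_inj (x y : L) : (forall k, coord k x = coord k y) -> x = y.
Proof. by move=> e; apply/val_inj/functional_extensionality_dep. Qed.

Definition point_of (x : forall k, X k) (Hx : forall k, f (x k.+1) = x k) : L :=
  exist _ (x : prod_topology X) (mem_set (Hx : inverse_limit_set f x)).

Lemma coord_continuous k : continuous (@coord k).
Proof.
move=> x; apply: (@continuous_comp _ (prod_topology X) _ set_val (@proj _ X k)).
  exact: initial_continuous.
exact: proj_continuous.
Qed.

(** Cylinders over one coordinate form a base: two of them are compared at a common level by pulling
    back along the bonding maps. *)
Lemma limit_nbhs (x : L) (U : set L) : nbhs x U -> exists n (Q : set (X n)),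
  [/\ open Q, Q (coord n x) & forall y, Q (coord n y) -> U y].
Proof.
pose F : set_system (prod_topology X) := [set A | exists n (Q : set (X n)),
  [/\ open Q, Q (coord n x) & forall y : L, Q (coord n y) -> A (set_val y)]].
have push n m (Q : set (X n)) : open Q -> exists Q' : set (X (m + n)%N), open Q' /\
    forall y : L, Q' (coord (m + n) y) <-> Q (coord n y).
  move=> oO; elim: m => [|m [Q' [oO' H]]]; first by exists Q.
  exists (@f (m + n) @^-1` Q'); split.
    by apply: open_comp => // y _; exact: f_cont.
  by move=> y; rewrite /preimage /= -H -(coordP (m + n) y).
have FF : Filter F.
  split.
  - by exists 0%N, setT; split=> //; exact: openT.
  - move=> A B [n [Q [oO Ox OA]]] [m [Q' [oO' Q'x Q'B]]].
    have [P [oP HP]] := push n m Q oO; have [P' [oP' HP']] := push m n Q' oO'.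
    move: P' oP' HP'; rewrite addnC => P' oP' HP'.
    exists (m + n)%N, (P `&` P'); split; first exact: openI.
      by split; [exact/HP|exact/HP'].
    by move=> y [Py P'y]; split; [apply/OA/HP|apply/Q'B/HP'].
  - move=> A B AB [n [Q [oO Ox OA]]]; exists n, Q; split=> // y /OA; exact: AB.
have Fx : cvg_to F (nbhs (set_val x : prod_topology X)).
  apply/cvg_sup => i A [_ [[Q oQ <-] Qx QA]].
  by exists i, Q; split=> // y Qy; exact: QA.
rewrite nbhsE => -[V [[W oW WV] Vx] VU].
have [n [Q [oO Ox OW]]] : F W.
  by apply: Fx; apply: open_nbhs_nbhs; split=> //; move: Vx; rewrite -WV.
by exists n, Q; split=> // y /OW Wy; apply: VU; rewrite -WV.
Qed.

Lemma limit_continuous (T : topologicalType) (g : T -> L) :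
  (forall k, continuous (@coord k \o g)) -> continuous g.
Proof.
move=> cg t U /limit_nbhs[n [Q [oO Ot OU]]].
have : nbhs t ((@coord n \o g) @^-1` Q) by apply: cg; exact: open_nbhs_nbhs.
by move=> H; apply: (nbhsS H) => s /OU.
Qed.

Lemma coord_to_base k (x : L) : to_base f k (coord k x) = coord 0 x.
Proof. by elim: k => //= k <-; rewrite coordP. Qed.

End InverseLimit.

(** * Stars of points of the surface and their lifts *)

Section Star.
Variables (R : realType) (X0 : topologicalType) (q : R * R -> X0).
Hypothesis hq : genus2_surface q.

Definition near_class (z : R * R) r : set (R * R) :=
  [set w | exists2 x, glued z x & dist2 w x < r].

(** Asking all representatives in the disc to be near the class makes the complement the image of a
    compact set, so the star is open. *)
Definition star (z : R * R) r : set X0 :=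
  [set y | forall w, disc w -> q w = y -> near_class z r w].

Lemma q_glued z w : disc z -> disc w -> q z = q w <-> glued z w.
Proof. by move=> zd wd; have [_ _ _] := hq; apply. Qed.

Lemma q_surj y : exists2 z, @disc R z & q z = y.
Proof.
have [_ _ e _] := hq; have : [set: X0] y by [].
by rewrite -e => -[z zd <-]; exists z.
Qed.

Lemma dist2_open (x : R * R) r : open [set w | dist2 w x < r].
Proof.
change (open ((fun w => dist2 w x) @^-1` [set s | s < r])).
by apply: open_comp; [move=> w _; exact: dist2_continuous|exact: open_lt].
Qed.

Lemma near_class_open z r : open (near_class z r).
Proof.
have -> : near_class z r = \bigcup_(x in glued z) [set w | dist2 w x < r].
  by apply/seteqP; split=> w [x ? ?]; exists x.
by apply: bigcup_open => x _; exact: dist2_open.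
Qed.

Lemma star_open z r : open (star z r).
Proof.
have [hX _ _ _] := hq.
have -> : star z r = ~` ((q \o @retract R) @` (@disc R `&` ~` near_class z r)).
  apply/seteqP; split=> [y H [w [wd nw] e]|y H w wd e].
    by apply/nw/H => //; rewrite -e /= retract_id.
  apply: contrapT => nw; apply: H; exists w; first by split.
  by rewrite /= retract_id.
apply: closed_openC; apply: (compact_closed hX); apply: continuous_compact.
  by apply: continuous_subspaceT; exact: surface_map_continuous hq.
apply: compact_closedI; first exact: disc_compact.
by apply: open_closedC; exact: near_class_open.
Qed.

Lemma star_center z r : disc z -> 0 < r -> star z r (q z).
Proof.
move=> zd r0 w wd e; exists w.
  by apply/q_glued.
suff -> : dist2 w w = 0 by [].
by apply/eqP; rewrite dist2_eq0.
Qed.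

Variables (E : topologicalType) (p : E -> X0) (I : finType)
  (mvI : label -> I -> I) (D : I -> R * R -> E).
Hypothesis cp : covering_map p.
Hypothesis D_cont : forall v, continuous (D v).
Hypothesis D_proj : forall v z, p (D v z) = q (retract z).
Hypothesis D_surj : forall x z, disc z -> p x = q z -> exists v, D v z = x.
Hypothesis cs : cell_system mvI D.

(* The preimage of the star of z is partitioned by the open sets S e, indexed by
   the points e above q z. *)
Lemma star_lift_connected z r (C : set E) x : disc z -> star_radius z r ->
  p x = q z -> connected C -> C `<=` p @^-1` star z r -> C x ->
  forall v w, disc w -> C (D v w) ->
    exists y, [/\ glued z y, dist2 w y < r & D v y = x].
Proof.
move=> zd zr px cC CS Cx.
have [hX _ _ _] := hq.
pose S e := [set y | star z r (p y) /\
  exists v w u, [/\ disc w, D v w = y, glued z u, dist2 w u < r & D v u = e]].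
have uniq e e' y : S e y -> S e' y -> e = e'.
  move=> [_ [v [w [u [wd wy zu wu ue]]]]] [_ [v' [w' [u' [wd' wy' zu' wu' ue']]]]].
  have ww' : glued w w'.
    apply/q_glued => //; rewrite -(retract_id wd) -(retract_id wd').
    by rewrite -(D_proj v) -(D_proj v') wy wy'.
  rewrite -ue -ue'.
  have [_ H] := star_same cs v v' zr zu zu' wu wu' ww'.
  by apply: H; rewrite wy wy'.
have cover y : star z r (p y) -> exists e, S e y.
  move=> Sy; have [w wd wy] := q_surj (p y); have [v vy] := D_surj wd (esym wy).
  have [u zu wu] := Sy w wd wy.
  by exists (D v u); split=> //; exists v, w, u.
have SE e : S e = p @^-1` star z r `&` ~` \bigcup_(v in [set: I])
    (D v @` (@disc R `&` ~` [set w | exists2 u, glued z u & dist2 w u < r /\ D v u = e])).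
  apply/seteqP; split=> [y Sy|y [Sy nU]].
    split; first by have [] := Sy.
    move=> [v _ [w [wd nw] wy]]; apply: nw.
    have := Sy => -[Sy' _]; have [u zu wu] : near_class z r w.
      by apply: Sy' => //; rewrite -wy D_proj retract_id.
    exists u => //; split=> //.
    by apply: (uniq _ _ y) => //; split=> //; exists v, w, u.
  have [w wd wy] := q_surj (p y); have [v vy] := D_surj wd (esym wy).
  split=> //; exists v, w; apply: contrapT => H; apply: nU; exists v => //.
  exists w => //; split=> // -[u zu [wu vu]]; apply: H.
  by exists u.
have oS e : open (S e).
  rewrite SE; apply: openI.
    by apply: open_comp; [move=> y _; have [c _] := cp; exact: c|exact: star_open].
  apply: closed_openC; apply: compact_closed; first exact: (covering_hausdorff cp hX).
  apply: finite_bigcup_compact; first exact: finite_finset.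
  move=> v _; apply: continuous_compact; first exact: continuous_subspaceT.
  apply: compact_closedI; first exact: disc_compact.
  apply: open_closedC.
  have -> : [set w | exists2 u, glued z u & dist2 w u < r /\ D v u = e] =
      \bigcup_(u in [set u | glued z u /\ D v u = e]) [set w | dist2 w u < r].
    by apply/seteqP; split=> w [u]; [move=> ? [? ?]|move=> [? ?] ?]; exists u.
  by apply: bigcup_open => u _; exact: dist2_open.
have Sx : S x x.
  have [v vx] := D_surj zd px; split; first by rewrite px; apply: star_center; case: zr.
  exists v, z, z; split=> //; first exact: rst_refl.
  suff -> : dist2 z z = 0 by case: zr.
  by apply/eqP; rewrite dist2_eq0.
have CSx : C `<=` S x.
  apply: (@connected_sub_open _ C (S x) (\bigcup_(e in [set e | e <> x]) S e)) => //.
  - by apply: bigcup_open => e _; exact: oS.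
  - move=> y /CS /cover[e Sey]; have [<-|ne] := pselect (e = x); first by left.
    by right; exists e.
  - by rewrite -subset0 => y [_ [Sxy [e ne Sey]]]; apply: ne; exact: uniq Sey Sxy.
  - by exists x.
move=> v w wd Cw; have Sw := CSx _ Cw.
have [u zu wu] : near_class z r w.
  by have [H _] := Sw; apply: H => //; rewrite D_proj retract_id.
exists u; split=> //; apply: (uniq _ _ (D v w)) => //; split; first by have [] := Sw.
by exists v, w, u.
Qed.

End Star.

(** * The cells of the solenoid *)

Section Tower.
Variables (R : realType) (X : nat -> topologicalType) (q : R * R -> X 0%N)
  (f : forall k, X k.+1 -> X k) (fib : forall k, Lambda k -> X k).
Hypothesis htower : solenoid_tower q f fib.
Notation L := (inverse_limit f).

Let hq := tower_surface htower.
Let cp k := tower_covering htower k.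

Lemma bonding_continuous k : continuous (@f k).
Proof. by have [] := tower_bonding htower k. Qed.

Let lift_cross k l v :
  lifts_to (to_base f k) (fun t => q (side (offset l).+1 t)) (fib v) (fib v).
Proof.
by case: l; [exact: (tower_lift_alpha htower)|exact: (tower_lift_beta htower)].
Qed.

Lemma move_surj k l (v : Lambda k) : exists w, move l w = v.
Proof. by exists (invF (@move_inj k l) v); rewrite f_invF. Qed.

Lemma tower_cells_exist : exists D : forall k, Lambda k -> R * R -> X k, forall k,
  [/\ forall v, continuous (D k v),
      forall v z, to_base f k (D k v z) = q (retract z) &
      forall v, D k v (side 0 0) = fib v].
Proof.
have H k := cid (cells_exist hq (cp k) (tower_fibre htower k)).
by exists (fun k => sval (H k)) => k; exact: (svalP (H k)).
Qed.

Variable D : forall k, Lambda k -> R * R -> X k.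
Hypothesis DP : forall k,
  [/\ forall v, continuous (@D k v),
      forall v z, to_base f k (@D k v z) = q (retract z) &
      forall v, @D k v (side 0 0) = fib v].

Let D_cont k v : continuous (@D k v). Proof. by have [] := DP k. Qed.
Let D_proj k v z : to_base f k (@D k v z) = q (retract z).
Proof. by have [_ ->] := DP k. Qed.
Let D_base k v : @D k v (side 0 0) = fib v. Proof. by have [_ _] := DP k. Qed.

Lemma tower_cell_system k : cell_system (@move (Lambda k)) (@D k).
Proof.
apply: (level_cell_system hq (cp k) (tower_fibre htower k)
  (@D_cont k) (@D_proj k) (@D_base k)).
- exact: (tower_lift htower).
- exact: lift_cross.
- exact: move_surj.
Qed.

Let D_surj k x z : disc z -> to_base f k x = q z -> exists v, @D k v z = x.
Proof. exact: (D_surj hq (cp k) (tower_fibre htower k)). Qed.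

Lemma cell_forget k (w : Lambda k.+1) z : f (D w z) = D (forget w) z.
Proof.
apply: (@lift_unique _ _ _ (cp k) (R * R)%type (@f k \o D w) (D (forget w)) (side 0 0)).
- exact: normed_connected.
- by move=> y; apply: continuous_comp; [exact: D_cont|exact: bonding_continuous].
- exact: D_cont.
- by move=> t; rewrite /= D_proj -(D_proj w).
- by rewrite /= !D_base (tower_forget htower).
Qed.

Definition limit_cell (v : codes) z : L :=
  @point_of X f (fun k => D (vert v k) z) (fun k => cell_forget (vert v k.+1) z).

Lemma coord_limit_cell k v z : coord k (limit_cell v z) = D (vert v k) z.
Proof. by []. Qed.

Lemma limit_cell_continuous v : continuous (limit_cell v).
Proof. by apply: limit_continuous bonding_continuous _ _ _ => k; exact: D_cont. Qed.

Lemma limit_cell_proj v z : disc z -> coord 0 (limit_cell v z) = q z.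
Proof. by move=> zd; have := @D_proj 0 (vert v 0) z; rewrite retract_id. Qed.

Lemma limit_cell_system : cell_system mv limit_cell.
Proof.
split=> [l v|v w z e|l v t t01|l v t t01].
- by exists (mvi l v); exact: mviK.
- apply: vert_inj => k; apply: (cs_inj (tower_cell_system k) (z := z)).
  by rewrite -!coord_limit_cell e.
- apply: coord_inj => k; rewrite !coord_limit_cell.
  exact: (cs_fold (tower_cell_system k)).
- apply: coord_inj => k; rewrite !coord_limit_cell vert_mv.
  exact: (cs_cross (tower_cell_system k)).
Qed.

(** By [cs_inj] the vertex chosen at each level is the only one, so the choices are compatible. *)
Lemma limit_cell_surj (x : L) z : disc z -> coord 0 x = q z ->
  exists v, limit_cell v z = x.
Proof.
move=> zd xz.
have H k : {v | D (k := k) v z = coord k x}.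
  by apply: cid; apply: D_surj => //; rewrite coord_to_base.
pose u k := sval (H k); have uP k : D (u k) z = coord k x := svalP (H k).
have uS k : (u k.+1).1 = u k.
  by apply: (cs_inj (tower_cell_system k) (z := z)); rewrite -cell_forget !uP coordP.
pose v : codes := fun k => (u k.+1).2.
have vu k : vert v k = u k.
  elim: k => [|k IH]; first by case: (u 0%N).
  by rewrite /= IH -uS /v -surjective_pairing.
by exists v; apply: coord_inj => k; rewrite coord_limit_cell vu.
Qed.

Notation cell v := (cellI limit_cell v).

Lemma limit_cell_cover (x : L) : exists v, cell v x.
Proof.
have [z zd e] := q_surj hq (coord 0 x).
by have [v vx] := limit_cell_surj zd (esym e); exists v, z.
Qed.

Lemma limit_glued v w z z' : disc z -> disc z' ->
  limit_cell v z = limit_cell w z' -> glued z z'.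
Proof.
move=> zd zd' e; apply/(q_glued hq) => //.
by rewrite -(limit_cell_proj v zd) -(limit_cell_proj w zd') e.
Qed.

Lemma limit_cell_chain v w x : cell v x -> cell w x -> chain mv limit_cell x v w.
Proof.
move=> [z zd <-] [z' zd' e].
exact: (glued_chain limit_cell_system (limit_glued zd zd' (esym e)) (esym e)).
Qed.

Lemma cells_orbit v w x : cell v x -> cell w x -> orbit v w.
Proof.
move=> vx wx; elim: (limit_cell_chain vx wx) =>
  [u u' [_ _ [l [->|->]]]|u|u u' _|u u' u2 _ h1 _].
- exact: orbit_mv.
- exact/orbit_sym/orbit_mv.
- exact: orbit_refl.
- exact: orbit_sym.
- exact: orbit_trans.
Qed.

(** At each level the projected path yields a centre u whose image in the cell is the projection of
    x. All these centres are close to the same w, so they coincide, and x lies in the cell. *)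
Lemma limit_star_local (x : L) : exists W : set L, [/\ open W, W x &
  forall y, path_component R W x y -> forall v, cell v y -> cell v x].
Proof.
have [z zd e] := q_surj hq (coord 0 x).
have [r zr] := star_radius_exists z.
have cc k := @coord_continuous X f k.
exists (coord 0 @^-1` star q z r); split.
- apply: open_comp; first by move=> y _; exact: cc.
  exact: star_open.
- by rewrite /preimage /= -e; apply: star_center => //; case: zr.
move=> y [c [pc cS c0 c1]] v [w wd vw].
have H k : exists u, [/\ glued z u, dist2 w u < r & D (vert v k) u = coord k x].
  apply: (star_lift_connected hq (cp k) (@D_cont k) (@D_proj k) (@D_surj k)
    (tower_cell_system k) zd zr (C := coord k @` (c @` `[0, 1]))) => //.
  - by rewrite coord_to_base.
  - apply: connected_continuous_connected; last first.
      by apply: continuous_subspaceT; exact: cc.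
    by apply: connected_continuous_connected pc; exact: segment_connected.
  - by move=> _ [t /cS Ht <-]; rewrite /preimage /= coord_to_base.
  - by exists x => //; exists 0; rewrite //= in_itv /= lexx ler01.
  - exists y; last by rewrite -vw.
    by exists 1; rewrite //= in_itv /= lexx ler01.
have [u [zu wu _]] := H 0%N.
exists u; first exact: glued_disc zd zu.
apply: coord_inj => k; have [u' [zu' wu' <-]] := H k.
rewrite coord_limit_cell; congr (D _ _).
by apply: (star_sep zr) => //; exact: dist2_triangle wu wu'.
Qed.

(** A gluing class is finite, and each of its points determines at most one cell through x. *)
Lemma limit_cell_finite (x : L) : finite_set [set v | cell v x].
Proof.
have [z zd e] := q_surj hq (coord 0 x).
have [A HA] := glued_finite z.
apply: (@sub_finite_set _ _
  ((fun u => xget zero_code [set v | limit_cell v u = x]) @` [set` A])).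
  move=> v [u ud ux]; exists u.
    by apply: HA; apply/(q_glued hq) => //; rewrite e -ux limit_cell_proj.
  apply: (cs_inj limit_cell_system (z := u)); rewrite ux.
  have H : exists v, [set v | limit_cell v u = x] v by exists v.
  exact: (xgetPex zero_code H).
exact/finite_image/finite_seq.
Qed.

Lemma limit_path_cell v z z' (W : set L) : (forall y, W (limit_cell v y)) ->
  path_component R W (limit_cell v z) (limit_cell v z').
Proof.
move=> HW.
pose c (t : R) := limit_cell v (z + t *: (z' - z)).
have <- : c 0 = limit_cell v z by rewrite /c scale0r addr0.
have <- : c 1 = limit_cell v z' by rewrite /c scale1r addrC subrK.
apply: (@path_component_continuous R _ W c 0 1); last by move=> t; exact: HW.
move=> t.
apply: (@continuous_comp _ _ _ (fun t : R => z + t *: (z' - z)) (limit_cell v));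
  last exact: limit_cell_continuous.
by apply: cvgD; [exact: cvg_cst|apply: cvgZ; [exact: cvg_id|exact: cvg_cst]].
Qed.

(** Neighbouring cells touch along a side, so the cells of an orbit are connected by paths;
    conversely a path changes cells only inside stars, where all cells meet the centre and so share
    one orbit. *)
Lemma leaf_cells v x : cell v x ->
  path_component R setT x = \bigcup_(w in orbit v) cell w.
Proof.
move=> vx; apply/seteqP; split=> [y [c [pc _ c0 c1]]|y [w vw wy]]; last first.
  have [z zd <-] := vx; have [z' zd' <-] := wy.
  have H : forall u, orbit v u -> path_component R setT (limit_cell v z) (limit_cell u z).
    apply: orbit_ind; last exact: path_component_refl.
    move=> l u.
    have st : path_component R setT (limit_cell u z) (limit_cell (mv l u) z).
      apply: (@path_component_trans _ _ _ (limit_cell u (side (offset l).+1 0))).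
        exact: limit_path_cell.
      rewrite (cs_cross limit_cell_system) ?lexx ?ler01 //.
      exact: limit_path_cell.
    split=> h; first exact: path_component_trans h st.
    exact: path_component_trans h (path_component_sym st).
  by apply: path_component_trans (H w vw) _; exact: limit_path_cell.
pose P t := exists2 w, orbit v w & cell w (c (clamp 0 1 t)).
suff [w vw wy] : P 1.
  by exists w => //; rewrite -c1; move: wy; rewrite clamp_id ?lexx ?ler01.
apply: (@connected_locally_constant R P 0 (@real_connected R) _ _ 1); last first.
  by exists v; [exact: orbit_refl|rewrite clamp_id ?lexx ?ler01 ?c0].
have cc := path_continuous pc; move=> t.
have [W [oW Wt HW]] := limit_star_local (c (clamp 0 1 t)).
have : nbhs t ((c \o clamp 0 1) @^-1` W) by apply: cc; exact: open_nbhs_nbhs.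
move=> /nbhs_ballP[d /= d0 dW]; exists (ball t d); first exact: nbhsx_ballx.
have pw s : ball t d s -> path_component R W (c (clamp 0 1 t)) (c (clamp 0 1 s)).
  move=> ts; exists (fun a => (c \o clamp 0 1) (t + a * (s - t))); split.
  - apply: continuous_path => a.
    suff H : {for a, continuous (fun b : R => t + b * (s - t))}.
      exact: (continuous_comp H (cc _)).
    by apply: cvgD; [exact: cvg_cst|apply: cvgM; [exact: cvg_id|exact: cvg_cst]].
  - move=> y1 [a /= a01 <-]; rewrite in_itv /= in a01; apply: dW.
    move: ts; rewrite /ball /= /ball_ opprD addrA subrr sub0r normrN normrM.
    rewrite distrC => ts; apply: le_lt_trans ts.
    by rewrite ler_piMl // ger0_norm; lra.
  - by rewrite mul0r addr0.
  - by rewrite mul1r addrC subrK.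
move=> s s' ts ts' [w vw ws]; have wt := HW _ (pw s ts) _ ws.
have [w' w's'] := limit_cell_cover (c (clamp 0 1 s')).
exists w' => //; apply: orbit_trans vw _.
exact: cells_orbit wt (HW _ (pw s' ts') _ w's').
Qed.

End Tower.

(** * Ends of a leaf *)

(* Small balls are convex, hence a map continuous for the topology of T is
   continuous for the leaf topology. *)
Lemma leafwise_continuous (R : realType) (V : normedModType R) (T : topologicalType)
    (g : V -> T) : continuous g -> continuous (g : V -> leafwise R T).
Proof.
move=> cg z U; rewrite nbhsE => -[Q [oQ Qz] QU].
have [W [oW Wz WQ]] := oQ _ Qz.
have : nbhs z (g @^-1` W) by apply: cg; exact: open_nbhs_nbhs.
move=> /nbhs_ballP[d /= d0 dW]; apply: (nbhsS (nbhsx_ballx z d d0)) => y zy.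
apply/QU/WQ; exists (fun t => g (z + t *: (y - z))); split.
- apply: continuous_path => t.
  suff H : {for t, continuous (fun s : R => z + s *: (y - z))}.
    exact: (continuous_comp H (cg _)).
  by apply: cvgD; [exact: cvg_cst|apply: cvgZ; [exact: cvg_id|exact: cvg_cst]].
- move=> x [t /= t01 <-]; rewrite in_itv /= in t01; apply: dW.
  move: zy; rewrite -!ball_normE /ball_ /= opprD addrA subrr sub0r normrN normrZ.
  rewrite distrC => zy; apply: le_lt_trans zy.
  by rewrite ler_piMl // ger0_norm; lra.
- by rewrite scale0r addr0.
- by rewrite scale1r addrC subrK.
Qed.

Lemma open_disc_connected (R : realType) : connected [set z : R * R | norm2 z < 1].
Proof.
have -> : [set z : R * R | norm2 z < 1] =
    \bigcup_(z in [set z | norm2 z < 1]) ((fun t : R => t *: z) @` `[0, 1]).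
  apply/seteqP; split=> [z z1|y [z /= z1 [t /= t01 <-]]].
    by exists z => //; exists 1; rewrite /= ?in_itv /= ?lexx ?ler01 ?scale1r.
  move: t01; rewrite in_itv /= => /andP[t0 t1].
  have -> : norm2 (t *: z) = t ^+ 2 * norm2 z by rewrite /norm2 /= !exprMn mulrDr.
  by apply: le_lt_trans z1; rewrite ler_piMl ?norm2_ge0 // exprn_ile1.
apply: bigcup_connected.
  by exists 0 => z _; exists 0; rewrite ?scale0r //= in_itv /= lexx ler01.
move=> z _; apply: connected_continuous_connected; first exact: segment_connected.
by apply: continuous_subspaceT => t; apply: cvgZ; [exact: cvg_id|exact: cvg_cst].
Qed.

Lemma disc_interior_dense (R : realType) (z : R * R) U : disc z -> nbhs z U ->
  exists2 w, norm2 w < 1 & U w.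
Proof.
move=> zd HU.
have : nbhs (1 : R) ((fun t : R => t *: z) @^-1` U).
  have H : {for 1, continuous (fun t : R => t *: z)}.
    by apply: cvgZ; [exact: cvg_id|exact: cvg_cst].
  by apply: H; rewrite /= scale1r.
move=> /nbhs_ballP[d /= d0 dU].
pose t : R := 1 - Num.min (d / 2) (1 / 2).
have m0 : 0 < Num.min (d / 2) (1 / 2) by rewrite lt_min; apply/andP; split; lra.
have [md mh] : Num.min (d / 2) (1 / 2) <= d / 2 /\ Num.min (d / 2) (1 / 2) <= 1 / 2.
  by split; rewrite ge_min lexx ?orbT.
exists (t *: z).
  have -> : norm2 (t *: z) = t ^+ 2 * norm2 z by rewrite /norm2 /= !exprMn mulrDr.
  have t01 : 0 <= t < 1 by rewrite /t; lra.
  apply: (@le_lt_trans _ _ (t ^+ 2)); first by rewrite ler_piMr ?sqr_ge0.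
  by rewrite expr2; nra.
apply: dU; rewrite /ball /= /ball_ /t opprB addrC subrK.
by rewrite ger0_norm; lra.
Qed.

Section LeafEnds.
Variables (R : realType) (X : nat -> topologicalType) (q : R * R -> X 0%N)
  (f : forall k, X k.+1 -> X k) (fib : forall k, Lambda k -> X k).
Hypothesis htower : solenoid_tower q f fib.
Notation L := (inverse_limit f).
Variable D : forall k, Lambda k -> R * R -> X k.
Hypothesis DP : forall k,
  [/\ forall v, continuous (@D k v),
      forall v z, to_base f k (@D k v z) = q (retract z) &
      forall v, @D k v (side 0 0) = fib v].
Notation limit_cell := (limit_cell htower DP).
Notation cell v := (cellI limit_cell v).

Variables (x : L) (v : codes).
Hypothesis vx : cell v x.
Let leaf : set L := path_component R setT x.
Notation Y := (leaf_space R leaf).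

Let cellY w : set Y := [set y | cell w (set_val y : L)].
Let coreY w : set Y := [set y | exists2 z, norm2 z < 1 & limit_cell w z = set_val y].

Let in_leaf w z : orbit v w -> leaf (limit_cell w (retract z)).
Proof.
move=> vw; rewrite /leaf (leaf_cells vx); exists w => //.
by exists (retract z) => //; exact: retract_disc.
Qed.

Let chart w (vw : orbit v w) z : Y :=
  exist _ (limit_cell w (retract z) : leafwise R L) (mem_set (in_leaf z vw)).

Let chart_continuous w (vw : orbit v w) : continuous (chart vw).
Proof.
have cg : continuous (fun z => limit_cell w (retract z) : leafwise R L).
  apply: (@leafwise_continuous R (R * R)%type) => z.
  by apply: continuous_comp; [exact: retract_continuous|exact: limit_cell_continuous].
move=> z U [_ [[W oW <-] Wz WU]].
have : nbhs z ((fun z => limit_cell w (retract z) : leafwise R L) @^-1` W).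
  by apply: cg; exact: open_nbhs_nbhs.
by move=> H; apply: (nbhsS H) => y Wy; exact: WU.
Qed.

Let chart_val w (vw : orbit v w) z : disc z ->
  set_val (chart vw z) = limit_cell w z.
Proof. by move=> zd; rewrite /= /set_val /= retract_id. Qed.

Let interior_disc (z : R * R) : norm2 z < 1 -> disc z.
Proof. exact: ltW. Qed.

Let chartE w (vw : orbit v w) z (y : Y) : disc z -> limit_cell w z = set_val y ->
  chart vw z = y.
Proof. by move=> zd e; apply: val_inj; rewrite -[RHS]e; exact: chart_val. Qed.

Lemma leaf_ends n F lab b : @exhaustion codes (orbit v) adj n F lab b ->
  has_n_ends (leaf_space R leaf) n.
Proof.
move=> ex; apply: (@cellular_ends _ _ (orbit v) cellY coreY adj) ex.
- move=> w vw.
  have -> : cellY w = chart vw @` @disc R.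
    apply/seteqP; split=> [y [z zd e]|_ [z zd <-]]; first by exists z => //; exact: chartE.
    by exists z => //; rewrite chart_val.
  apply: continuous_compact; last exact: disc_compact.
  by apply: continuous_subspaceT; exact: chart_continuous.
- have H u : leaf u -> exists2 w, orbit v w & cell w u.
    by rewrite /leaf (leaf_cells vx) => -[w vw wu]; exists w.
  by move=> y; exact: (H _ (set_valP y)).
(* The path component of y in its star is open in the leaf topology and meets only the cells through
   y. *)
- move=> y; have [W [oW Wy HW]] := limit_star_local htower DP (set_val y).
  exists (set_val @^-1` (path_component R W (set_val y) : set (leafwise R L))).
    apply: open_nbhs_nbhs; split; last exact: path_component_refl.
    exists (path_component R W (set_val y)) => //.
    move=> u yu; exists W; split=> //; first by have [] := path_component_in yu.
    by move=> s; exact: path_component_trans yu.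
  by move=> w _ [u [yu wu]]; exact: HW yu _ wu.
- move=> y; apply: sub_finite_set (limit_cell_finite htower DP (set_val y)).
  by move=> w [].
- move=> w vw.
  have -> : coreY w = chart vw @` [set z | norm2 z < 1].
    apply/seteqP; split=> [y [z z1 e]|_ [z z1 <-]].
      by exists z => //; apply: chartE => //; exact: interior_disc.
    by exists z => //; rewrite chart_val //; exact: interior_disc.
  apply: connected_continuous_connected; first exact: open_disc_connected.
  by apply: continuous_subspaceT; exact: chart_continuous.
- move=> w vw; exists (chart vw 0), 0.
    by rewrite /norm2 /= expr0n /= addr0 ltr01.
  by rewrite chart_val //; apply: interior_disc; rewrite /norm2 /= expr0n /= addr0 ltr01.
- by move=> w vw y [z z1 e]; exists z => //; exact: interior_disc.
- move=> w vw y [z zd e] U; rewrite -(chartE vw zd e) => HU.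
  have : nbhs z (chart vw @^-1` U) by exact: chart_continuous HU.
  move=> /(disc_interior_dense zd)[z' z'1 Uz']; exists (chart vw z'); split=> //.
  by exists z' => //; rewrite chart_val //; exact: interior_disc.
(* An interior point of the disc is glued only to itself. *)
- move=> w w' y vw vw' [z z1 e] [z' z'd e'].
  have zd := interior_disc z1.
  have zz' := limit_glued zd z'd (etrans e (esym e')).
  have z'z := glued_interior z1 zz'; subst z'.
  by apply: (cs_inj (limit_cell_system htower DP) (z := z)); rewrite e e'.
(* The common point is the midpoint of the crossed side. *)
- have H l w : orbit v w -> exists y : Y, [/\ cellY w y, cellY (mv l w) y &
      forall u, orbit v u -> cellY u y -> u = w \/ u = mv l w].
    move=> vw; pose m : R * R := side (offset l).+1 (1 / 2).
    have md : disc m := side_disc _ _.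
    have h01 : 0 <= (1 / 2 : R) <= 1 by lra.
    have hh : 1 - 1 / 2 = 1 / 2 :> R by lra.
    have cr : limit_cell w m = limit_cell (mv l w) (side (offset l).+3 (1 / 2)).
      by rewrite /m (cs_cross (limit_cell_system htower DP)) // hh.
    exists (chart vw m); split.
    + by exists m => //; rewrite chart_val.
    + by exists (side (offset l).+3 (1 / 2)); [exact: side_disc|rewrite chart_val // cr].
    + move=> u vu [z zd]; rewrite chart_val // => e.
      have mz := limit_glued md zd (esym e).
      have [|ez|ez] := @glued_midpoint R (offset l).+1 z _ mz.
      * by case: (l).
      * by left; subst z; apply: (cs_inj (limit_cell_system htower DP) (z := m)).
      * right; subst z.
        apply: (cs_inj (limit_cell_system htower DP)
          (z := side (offset l).+3 (1 / 2))).
        by rewrite e cr.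
  move=> w w' vw vw' [l [e|e]].
    by subst w'; exact: H.
  have [y [wy w'y Hy]] := H l w' vw'; subst w; exists y; split=> //.
  by move=> u vu /(Hy u vu)[]; auto.
- move=> w w' y vw vw' wy w'y.
  have := limit_cell_chain wy w'y.
  elim=> [u u' [uy u'y a]|u|u u' _|u u' u2 _ h1 _].
  + apply: rst_step; split=> //.
      by apply: orbit_trans vw _; exact: cells_orbit wy uy.
    by apply: orbit_trans vw _; exact: cells_orbit wy u'y.
  + exact: rst_refl.
  + exact: rst_sym.
  + exact: rst_trans.
Qed.

End LeafEnds.

(** * Meager and countable sets *)

Lemma nowhere_denseS (T : topologicalType) (A B : set T) :
  A `<=` B -> nowhere_dense B -> nowhere_dense A.
Proof.
rewrite /nowhere_dense -!subset0 => AB; apply: subset_trans.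
exact/interiorS/closureS.
Qed.

Lemma meager_sub (T : topologicalType) (A : set T) (G : nat -> set T) :
  (forall n, nowhere_dense (G n)) -> A `<=` \bigcup_n G n -> meager A.
Proof.
move=> nG AG; exists (fun n => A `&` G n).
  by move=> n; apply: nowhere_denseS (nG n) => x [].
by rewrite -setI_bigcupr; apply/esym/setIidPl.
Qed.

Lemma has_n_ends_unique (Y : topologicalType) n m :
  has_n_ends Y n -> has_n_ends Y m -> n = m.
Proof.
rewrite /has_n_ends => Yn Ym; apply/card_eq_II.
by apply: card_eq_trans Ym; rewrite card_eq_sym.
Qed.

Lemma cantor_uncountable (T : Type) (g : (nat -> bool) -> T) (A : set T) :
  injective g -> (forall s, A (g s)) -> ~ countable A.
Proof.
move=> gi gA /countable_injP[c ci].
have ci' s s' : c (g s) = c (g s') -> s = s'.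
  by move=> e; apply/gi/ci; rewrite ?inE.
pose s k := `[< ~ exists s', c (g s') = k /\ s' k >].
have [sn|sn] := boolP (s (c (g s))).
  by move/asboolP: (sn); apply; exists s.
have /asboolP := sn; apply => -[s' [/ci' -> sn']].
by move: sn; rewrite sn'.
Qed.

(** An orbit is covered by at most three increasing sequences of finite tail classes. *)
Lemma orbit_countable v : countable (orbit v).
Proof.
have tails t : countable (\bigcup_(m in [set: nat]) tail_class m t).
  apply: bigcup_countable => // m _.
  exact/finite_set_countable/tail_class_finite.
have [v0|v0] := pselect (orbit v zero_code); last first.
  apply: sub_countable (tails v); apply: subset_card_le => w /(orbit_agree v0)[m a].
  by exists m.
rewrite (orbit_eq v0).
pose t (i : nat) := match i with
  0 => zero_code | 1 => last_code La | _ => last_code Lb end%N.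
apply: (@sub_countable _ _ _ (\bigcup_(i in [set: nat])
   \bigcup_(m in [set: nat]) tail_class m (t i))).
  apply: subset_card_le => w /zero_orbit_tail[m [a|[[] a]]].
  - by exists 0%N => //; exists m.
  - by exists 1%N => //; exists m.
  - by exists 2%N => //; exists m.
by apply: bigcup_countable => // i _; exact: tails.
Qed.

(** If nonzero copy numbers cut by one label stop at some level, every later copy number is cut by
    the other label, zeros included. *)
Lemma orbit_trichotomy v : [\/ orbit v zero_code,
  nonzero_cut La v /\ nonzero_cut Lb v |
  exists l N, forall k, (N <= k)%N -> cut l (v k)].
Proof.
have H l : nonzero_cut (other l) v \/ exists N, forall k, (N <= k)%N -> cut l (v k).
  have [|n] := pselect (nonzero_cut (other l) v); [by left|right].
  apply: contrapT => nex; apply: n => N; apply: contrapT => n2; apply: nex.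
  exists N => k Nk; apply: contrapT => nc; apply: n2; exists k => //.
  have vk : v k != ord0 by apply/eqP => e; apply: nc; rewrite e cut0.
  by split=> //; rewrite cut_other //; exact/negP.
case: (H La) => [hb|[N hN]]; last by constructor 3; exists La, N.
case: (H Lb) => [ha|[N hN]]; last by constructor 3; exists Lb, N.
by constructor 2.
Qed.

(** * The leaves of the solenoid *)

Section Leaves.
Variables (R : realType) (X : nat -> topologicalType) (q : R * R -> X 0%N)
  (f : forall k, X k.+1 -> X k) (fib : forall k, Lambda k -> X k).
Hypothesis htower : solenoid_tower q f fib.
Notation L := (inverse_limit f).
Variable D : forall k, Lambda k -> R * R -> X k.
Hypothesis DP : forall k,
  [/\ forall v, continuous (@D k v),
      forall v z, to_base f k (@D k v z) = q (retract z) &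
      forall v, @D k v (side 0 0) = fib v].
Notation limit_cell := (limit_cell htower DP).
Notation cell v := (cellI limit_cell v).

Let leaf x := path_component R (setT : set L) x.

Lemma leaf_ends4 v x : cell v x -> orbit v zero_code ->
  has_n_ends (leaf_space R (leaf x)) 4.
Proof.
move=> vx v0; have [F [lab [b ex]]] := four_ends.
by rewrite -(orbit_eq v0) in ex; exact: (leaf_ends vx ex).
Qed.

Lemma leaf_ends1 v x : cell v x -> nonzero_cut La v -> nonzero_cut Lb v ->
  has_n_ends (leaf_space R (leaf x)) 1.
Proof.
by move=> vx va vb; have [F [lab [b ex]]] := one_end va vb; exact: (leaf_ends vx ex).
Qed.

Lemma leaf_ends2 v x l N : cell v x -> ~ orbit v zero_code ->
  (forall k, (N <= k)%N -> cut l (v k)) ->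
  has_n_ends (leaf_space R (leaf x)) 2.
Proof.
move=> vx v0 vN; have [F [lab [b ex]]] := two_ends v0 (ex_intro _ N vN).
exact: (leaf_ends vx ex).
Qed.

(** A countable family of sets covering all leaves that do not have one end. *)
Definition thin_part l N : set L :=
  [set x | exists2 v, cell v x & forall k, (N <= k)%N -> cut l (v k)].

(** The closed set C imposes the condition through finitely many cells at each level. In any open
    set a copy number at a high level can be changed to one not cut by l, which leaves C. *)
Lemma thin_part_nowhere_dense l N : nowhere_dense (thin_part l N).
Proof.
have hq := tower_surface htower.
have cc k := @coord_continuous X f k.
pose S m : set (Lambda m) := [set u | exists2 v, vert v m = u &
  forall k, (N <= k < m)%N -> cut l (v k)].
pose C : set L := \bigcap_(m in [set: nat])
  coord m @^-1` (\bigcup_(u in S m) (D u @` @disc R)).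
have cC : closed C.
  apply: closed_bigI => m _; apply: preimage_closed; first by move=> y _; exact: cc.
  apply: compact_closed.
    apply: covering_hausdorff (tower_covering htower m) _.
    by have [] := hq.
  apply: finite_bigcup_compact; first exact: finite_finset.
  move=> u _; apply: continuous_compact; last exact: disc_compact.
  by apply: continuous_subspaceT; have [] := DP m.
have SC : closure (thin_part l N) `<=` C.
  rewrite [X in _ `<=` X](closure_id C).1 //; apply: closureS => x [v [z zd vz] vN] m _.
  exists (vert v m); first by exists v => // k /andP[Nk _]; exact: vN.
  by exists z => //; rewrite -vz.
rewrite /nowhere_dense -subset0 => x /(interiorS SC); rewrite /interior => Cx.
have [n [Q [oQ Qx QC]]] := limit_nbhs (bonding_continuous htower) Cx.
have [v [z zd vz]] := limit_cell_cover htower DP x.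
(* An interior point of the disc, so that it lies in a single cell. *)
have [w w1 Qw] : exists2 w, norm2 w < 1 & Q (D (vert v n) w).
  have [cD _ _] := DP n; apply: (disc_interior_dense zd (U := D (vert v n) @^-1` Q)).
  by apply: cD; apply: open_nbhs_nbhs; rewrite -(coord_limit_cell htower DP) vz.
have wd : disc w := ltW w1.
pose m := maxn n N.
(* Changing level m >= n keeps the first n copy numbers, hence membership in Q; m >= N makes the
   change violate C. *)
pose v' := set_code (lastc m (other l)) v.
have vv' : vert v' n = vert v n.
  have : (n <= m)%N by exact: leq_maxl.
  elim: (n) => //= k IH km; rewrite IH ?(ltnW km) //.
  by rewrite /v' set_code_neq // ltn_eqF.
have : C (limit_cell v' w) by apply: QC; rewrite coord_limit_cell vv'.
move=> /(_ m.+1 I)[u [y yu yN] [z' z'd e]].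
rewrite /= coord_limit_cell in e.
have [_ Dp _] := DP m.+1.
have wz' : glued w z'.
  apply/(q_glued hq) => //; rewrite -(retract_id wd) -(retract_id z'd).
  by rewrite -(Dp (vert v' m.+1)) -e Dp.
have zw := glued_interior w1 wz'; subst z'.
have {}e := cs_inj (tower_cell_system htower DP m.+1) e.
have : y m = v' m by move: e; rewrite -yu => -[].
rewrite /v' set_code_eq => ym.
have := yN m; rewrite ym leq_maxr ltnSn => /(_ isT).
by have := lastc_uncut m (other l); rewrite otherK => /negPf ->.
Qed.

Lemma orbit_thin v x : cell v x -> orbit v zero_code -> exists l N, thin_part l N x.
Proof.
move=> vx /orbit_sym/zero_orbit_tail[m [a|[l a]]].
  by exists La, m, v => // k mk; rewrite a // cut0.
by exists l, m, v => // k mk; rewrite a // lastc_cut.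
Qed.

Lemma meager_thin (A : set L) :
  (forall x, A x -> exists l N, thin_part l N x) -> meager A.
Proof.
move=> HA.
(* Parity and half of the index enumerate the pairs of a label and a level. *)
apply: (@meager_sub _ _ (fun n => thin_part (if odd n then Lb else La) n./2)).
  by move=> n; exact: thin_part_nowhere_dense.
move=> x /HA[l [N xN]].
exists (match l with La => N.*2 | Lb => N.*2.+1 end) => //.
by case: l xN => xN /=; rewrite ?uphalf_double ?odd_double ?doubleK.
Qed.

Lemma leaf_thin x : ~ has_n_ends (leaf_space R (leaf x)) 1 ->
  exists l N, thin_part l N x.
Proof.
move=> n1; have [v vx] := limit_cell_cover htower DP x.
have [v0|[va vb]|[l [N vN]]] := orbit_trichotomy v.
- exact: orbit_thin vx v0.
- by case: n1; exact: leaf_ends1 vx va vb.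
- by exists l, N, v.
Qed.

Let origin v := limit_cell v (side 0 0).

Let origin_cell v : cell v (origin v).
Proof. by exists (side 0 0) => //; exact: side_disc. Qed.

Lemma leaf_mem x : leaf x x.
Proof. exact: path_component_refl. Qed.

Lemma four_ended_leaf : exists! M : set L, leaves_with_ends R 4 M.
Proof.
exists (leaf (origin zero_code)); split.
  split; first by exists (origin zero_code).
  by apply: (leaf_ends4 (origin_cell zero_code)); exact: orbit_refl.
move=> M [[x ->] M4]; have [v vx] := limit_cell_cover htower DP x.
rewrite /leaf (leaf_cells (origin_cell zero_code)) (leaf_cells vx).
have [v0|[va vb]|[l [N vN]]] := orbit_trichotomy v.
- by rewrite (orbit_eq v0).
- by have := has_n_ends_unique M4 (leaf_ends1 vx va vb).
- have [v0|v0] := pselect (orbit v zero_code); first by rewrite (orbit_eq v0).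
  by have := has_n_ends_unique M4 (leaf_ends2 vx v0 vN).
Qed.

Lemma one_ended_residual : residual (\bigcup_(M in @leaves_with_ends R L 1) M).
Proof.
apply: meager_thin => x nx; apply: leaf_thin => x1; apply: nx.
by exists (leaf x); [split=> //; exists x|exact: leaf_mem].
Qed.

Lemma two_ended_meager : meager (\bigcup_(M in @leaves_with_ends R L 2) M).
Proof.
apply: meager_thin => x [M [[y ->] y2] yx]; apply: leaf_thin.
have -> : leaf x = leaf y.
  apply/seteqP; split=> z h; first exact: path_component_trans yx h.
  exact: path_component_trans (path_component_sym yx) h.
by move=> y1; have := has_n_ends_unique y1 y2.
Qed.

(** Sequences with values 0 and [lastc k La] are cut by La everywhere, so each lies in the orbit of
    the base point or on a leaf with two ends. They are uncountably many, while a leaf meets the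
    fibre in one countable orbit. *)
Lemma two_ended_uncountable : ~ countable (@leaves_with_ends R L 2).
Proof.
move=> c2.
pose code_of (s : nat -> bool) : codes := fun k =>
  if s k then lastc k La else ord0.
have code_inj : injective code_of.
  move=> s s' e; apply/funext => k; have := congr1 (fun v : codes => v k) e.
  rewrite /code_of; have := lastc_neq0 k La.
  by case: (s k); case: (s' k) => // /eqP n /esym; [move/esym|].
pose A := orbit zero_code `|` \bigcup_(M in @leaves_with_ends R L 2)
  [set v | leaf (origin v) = M].
apply: (@cantor_uncountable _ code_of A code_inj).
  move=> s; have [s0|s0] := pselect (orbit (code_of s) zero_code).
    by left; exact: orbit_sym.
  right; exists (leaf (origin (code_of s))) => //.
  split; first by exists (origin (code_of s)).
  apply: (@leaf_ends2 _ _ La 0 (origin_cell _) s0) => k _.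
  by rewrite /code_of; case: (s k); [exact: lastc_cut|exact: cut0].
have -> : A = \bigcup_(b in [set: bool]) (if b then orbit zero_code else
   \bigcup_(M in @leaves_with_ends R L 2) [set v | leaf (origin v) = M]).
  apply/seteqP; split=> [v [h|h]|v [[] _ h]];
    [by exists true|by exists false|by left|by right].
apply: bigcup_countable => // -[] _; first exact: orbit_countable.
apply: bigcup_countable => // M _.
have [->|/set0P[v vM]] := eqVneq [set v | leaf (origin v) = M] set0.
  exact: countable0.
apply: sub_countable (orbit_countable v); apply: subset_card_le => w wM.
have : leaf (origin v) (origin w) by rewrite vM -wM; exact: leaf_mem.
rewrite /leaf (leaf_cells (origin_cell v)) => -[u vu uw].
exact: orbit_trans vu (cells_orbit uw (origin_cell w)).
Qed.

End Leaves.

Theorem proposition3p3 (R : realType) (X : nat -> topologicalType)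
    (q : R * R -> X 0%N) (f : forall k, X k.+1 -> X k)
    (fib : forall k, Lambda k -> X k)
    (htower : solenoid_tower q f fib) :
  [/\ (exists! L : set (inverse_limit f), leaves_with_ends R 4 L),
      residual (\bigcup_(L in @leaves_with_ends R (inverse_limit f) 1) L) &
      ~ countable (@leaves_with_ends R (inverse_limit f) 2) /\
      meager (\bigcup_(L in @leaves_with_ends R (inverse_limit f) 2) L)].
Proof.
have [D DP] := tower_cells_exist htower.
split; [exact: four_ended_leaf DP|exact: one_ended_residual DP|].
by split; [exact: two_ended_uncountable DP|exact: two_ended_meager DP].
Qed.
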